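(* Almost surely, the operator $\mathcal H$ is self-adjoint on (a dense subset of) $L^2(\mathbb R)$, and it is the limit, as $L\to\infty$, in the strong resolvent sense, of $\mathcal H_L$: for every $z\in\mathbb C\setminus\mathbb R$ and every $g\in L^2(\mathbb R)$, $(\mathcal H_L-z)^{-1}g\to(\mathcal H-z)^{-1}g$ in $L^2(\mathbb R)$ as $L\to\infty$.
   Context: Let $\xi$ be a Gaussian white noise on $\mathbb R$ and let $B(t)=\langle\xi,\mathbf 1_{[0,t]}\rangle$ be the associated continuous two-sided Brownian motion with $B(0)=0$ (with $B(t)=-\langle\xi,\mathbf 1_{[t,0]}\rangle$ for $t<0$). For a function $f$ such that $f$ and $f'-Bf$ are locally absolutely continuous, set $\tau f:=-(f'-Bf)'-Bf'$, the rigorous meaning of $-f''+\xi f$. For an open interval $(a,b)\subset\mathbb R$ (possibly $\mathbb R$), let $\mathcal D^{\max}_{a,b}$ be the set of complex-valued $f\in L^2(a,b)$ such that $f$ and $f'-Bf$ are locally absolutely continuous on $(a,b)$ and $\tau f\in L^2(a,b)$. The operator $\mathcal H$ is $\mathcal Hf:=\tau f$ on the domain $\mathcal D=\mathcal D^{\max}_{\mathbb R}$. For $L>0$, the operator $\mathcal H_L$ is $\mathcal H_Lf:=\tau f$ on the domain $\{f\in\mathcal D^{\max}_{-L/2,L/2}:\ f(-L/2)=f(L/2)=0\}$ (Dirichlet boundary conditions); it is self-adjoint on $L^2(-L/2,L/2)$. The resolvent $(\mathcal H_L-z)^{-1}$ is regarded as an operator on $L^2(\mathbb R)$ by restricting $g\in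 L^2(\mathbb R)$ to $(-L/2,L/2)$, applying the resolvent of $\mathcal H_L$, and extending the result by $0$ outside $(-L/2,L/2)$. *)

(* Defs.v *)
From HB Require Import structures.
From mathcomp Require Import all_boot all_order all_algebra.
From mathcomp Require Import all_classical all_reals all_analysis.
From mathcomp Require Import complex.

Set Implicit Arguments.
Unset Strict Implicit.
Unset Printing Implicit Defensive.
Import Order.TTheory GRing.Theory Num.Theory.
Import numFieldNormedType.Exports.

Local Open Scope classical_set_scope.
Local Open Scope complex_scope.
Local Open Scope ring_scope.

Section WhiteNoise.
Context (R : realType) (d : measure_display) (Omega : measurableType d).
Variable P : probability Omega R.

Local Notation mu := (@lebesgue_measure R).

(* Degenerate laws are split off because [normal_prob m 0] is not the Dirac
   mass at [m]. *)
Definition gaussian_law (m s : R) (A : set R) : \bar R :=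
  if s == 0 then \d_m A else normal_prob m s A.

Definition is_gaussian (X : Omega -> R) : Prop :=
  exists m s : R, forall A : set R, measurable A ->
    P (X @^-1` A) = gaussian_law m s A.

(* Centered Gaussian process indexed by the real space L^2(R) whose covariance
   is the L^2 inner product.  The values of [xi] outside L^2 are irrelevant. *)
Definition white_noise (xi : (R -> R) -> {RV P >-> R}) : Prop :=
  [/\ (forall (n : nat) (f : 'I_n -> R -> R) (c : 'I_n -> R),
        (forall i, f i \in Lfun mu 2%:E) ->
        is_gaussian (fun w => \sum_(i < n) c i * xi (f i) w)),
      (forall f : R -> R, f \in Lfun mu 2%:E -> ('E_P[xi f] = 0)%E) &
      (forall f g : R -> R, f \in Lfun mu 2%:E -> g \in Lfun mu 2%:E ->
        covariance P (xi f) (xi g) = (\int[mu]_x (f x * g x)%:E)%E)].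

(* Each [B t] is a version of the pairing of the noise with the signed
   indicator of the interval between 0 and [t]. *)
Definition associated_brownian_motion
    (xi : (R -> R) -> {RV P >-> R}) (B : R -> {RV P >-> R}) : Prop :=
  [/\ (forall t : R, 0 <= t -> {ae P, forall w, B t w = xi \1_`[0, t] w}),
      (forall t : R, t < 0 -> {ae P, forall w, B t w = - xi \1_`[t, 0] w}) &
      {ae P, forall w, B 0 w = 0 /\ continuous (fun t => B t w : R)}].

End WhiteNoise.

Section SquareIntegrable.
Context (R : realType).
Implicit Types (D : set R) (f g : R -> R[i]).

Local Notation mu := (@lebesgue_measure R).

Definition cmeasurable_fun D f : Prop :=
  measurable_fun D (fun x => complex.Re (f x)) /\ measurable_fun D (fun x => complex.Im (f x)).

Definition l2norm D f : \bar R :=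
  Lnorm mu 2%:E (EFin \o patch (fun=> 0) D (fun x => Normc.normc (f x))).

Definition L2 D f : Prop := cmeasurable_fun D f /\ (l2norm D f < +oo)%E.

(* Almost-everywhere classes: [measurable_fun] refers to Borel sets, whereas
   functions such as derivatives are only determined almost everywhere. *)
Definition L2ae D f : Prop :=
  exists2 g : R -> R[i], L2 D g & f = g %[ae mu in D].

(* Linear in the first argument. *)
Definition inner D f g : R[i] :=
  (\int[mu]_(x in D) complex.Re (f x * (g x)^*)) +i*
  (\int[mu]_(x in D) complex.Im (f x * (g x)^*)).

End SquareIntegrable.

Section UnboundedOperators.
Context (R : realType).
Implicit Types (D : set R) (f g h u v : R -> R[i]) (z : R[i]).

Local Notation mu := (@lebesgue_measure R).

(* An unbounded operator on L^2(D) is given by its graph, on representatives: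
   [T f h] means that (the class of) [f] is in the domain and is mapped to
   (the class of) [h]. *)
Definition l2_operator := (R -> R[i]) -> (R -> R[i]) -> Prop.
Implicit Types T : l2_operator.

Definition densely_defined D T : Prop :=
  forall f, L2 D f -> forall e : R, 0 < e ->
    exists g h, T g h /\ (l2norm D (fun x => f x - g x)%R < e%:E)%E.

Definition adjoint D T : l2_operator := fun g h =>
  [/\ L2 D g, L2 D h & forall f k, T f k -> inner D k g = inner D f h].

Definition self_adjoint D T : Prop :=
  densely_defined D T /\ (forall g h, T g h <-> adjoint D T g h).

(* [u] is in the domain of [T] and [(T - z) u = g] in L^2(D). *)
Definition resolvent_eq D T z g u : Prop :=
  exists2 h, T u h & (fun x => h x - z * u x) = g %[ae mu in D].

(* [T - z] is a bijection from the domain of [T] onto L^2(D), with bounded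
   inverse. *)
Definition in_resolvent_set D T z : Prop :=
  exists2 C : R, 0 <= C & forall g, L2 D g ->
    exists u, [/\ resolvent_eq D T z g u,
      (forall v, resolvent_eq D T z g v -> v = u %[ae mu in D]) &
      (l2norm D u <= C%:E * l2norm D g)%E].

(* [(T - z)^-1] as an operator on L^2(R): restrict [g] to [D], apply the
   resolvent of [T], extend by 0 outside [D].  (The equation only involves the
   restriction of [g] to [D].) *)
Definition resolvent D T z g : R -> R[i] :=
  patch (fun=> 0) D (xget (fun=> 0) [set u | resolvent_eq D T z g u]).

End UnboundedOperators.

Section SchroedingerOperator.
Context (R : realType).
Implicit Types (D : set R) (f g h : R -> R[i]) (b : R -> R).

Local Notation mu := (@lebesgue_measure R).

Definition absolutely_continuous (c d : R) f : Prop :=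
  forall e : R, 0 < e -> exists2 dl : R, 0 < dl &
    forall (n : nat) (s t : 'I_n -> R),
      (forall i, [/\ c <= s i, s i <= t i & t i <= d]) ->
      trivIset [set: 'I_n] (fun i => `]s i, t i[%classic) ->
      \sum_(i < n) (t i - s i) < dl ->
      \sum_(i < n) Normc.normc (f (t i) - f (s i)) < e.

Definition locally_absolutely_continuous D f : Prop :=
  forall c d : R, `[c, d] `<=` D -> absolutely_continuous c d f.

Definition cderive f : R -> R[i] := fun x =>
  derive1 (fun y => complex.Re (f y)) x +i* derive1 (fun y => complex.Im (f y)) x.

(* The quasi-derivative f' - b f.  If it agrees almost everywhere with a
   continuous function and [f] is locally absolutely continuous, then [f] is
   C^1, so it makes no difference to read [f'] pointwise. *)
Definition quasi_derive b f : R -> R[i] := fun x =>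
  cderive f x - (b x)%:C * f x.

Definition tau b f : R -> R[i] := fun x =>
  - cderive (quasi_derive b f) x - (b x)%:C * cderive f x.

(* Meant for [D] an open interval. *)
Definition Dmax D b f : Prop :=
  [/\ L2 D f, locally_absolutely_continuous D f,
      locally_absolutely_continuous D (quasi_derive b f) & L2ae D (tau b f)].

(* [dom] and [tau b] only make sense on the locally absolutely continuous
   representative [f0] of the class of [f]. *)
Definition tau_operator D b (dom : (R -> R[i]) -> Prop) : l2_operator R :=
  fun f h => [/\ L2 D f, L2 D h & exists f0,
    [/\ dom f0, f = f0 %[ae mu in D] & h = tau b f0 %[ae mu in D]]].

Definition operator_H b : l2_operator R := tau_operator setT b (Dmax setT b).

Definition box (L : R) : set R := `](- (L / 2)), (L / 2)[.

(* Elements of the maximal domain live on the open interval, so their boundary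
   values are one-sided limits. *)
Definition dirichlet (L : R) f : Prop :=
  [/\ complex.Re (f x) @[x --> (- (L / 2))^'+] --> (0 : R),
      complex.Im (f x) @[x --> (- (L / 2))^'+] --> (0 : R),
      complex.Re (f x) @[x --> (L / 2)^'-] --> (0 : R) &
      complex.Im (f x) @[x --> (L / 2)^'-] --> (0 : R)].

Definition operator_HL b (L : R) : l2_operator R :=
  tau_operator (box L) b (fun f => Dmax (box L) b f /\ dirichlet L f).

End SchroedingerOperator.

(* Main.v *)
(** With [v = u' - b u], the equation [tau u = h] is the linear system [u' = b u + v],
    [v' = - b^2 u - b v - h], and Green's identity reads [(u1 v2 - v1 u2)' = h1 u2 - u1 h2].
    Call [b] quiet if, for some [M], the integral of [(b - b0)^2] over a unit interval is at most
    [M] on intervals arbitrarily far away in both directions. For almost every path this holds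
    with [b0] the value at the left end point: the expectations are at most 1, so by Fatou's
    lemma the inferior limit of these integrals is finite.

    On a quiet interval [[a, a + 1]], with [phi x = (x - a) (a + 1 - x)], an energy estimate bounds
    [phi u'] in [L^2] by [u] and [h]. Hence cutting [u] off there by a function whose derivative
    is proportional to [phi] is a small perturbation of [u] and of [tau u]. So compactly
    supported elements form a core and [H] is symmetric. The range of [H - z] is everything, the
    solution being a limit of Dirichlet solutions, and [H] is densely defined, so [H] is
    self-adjoint. A compactly supported [w] in the domain of [H] is in the domain of [H_L] for
    [L] large, and there [(H_L - z)^-1 (tau - z) w = w]; together with the uniform bound
    [1 / |Im z|] on the resolvents this gives strong resolvent convergence. *)

Require Import Defs.
From HB Require Import structures.
From mathcomp Require Import all_boot all_order all_algebra.
From mathcomp Require Import all_classical all_reals all_analysis.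
From mathcomp Require Import complex measurable_realfun.
From mathcomp Require Import ring lra.
Import Order.TTheory GRing.Theory Num.Theory.
Import numFieldNormedType.Exports.
Set Implicit Arguments.
Unset Strict Implicit.
Unset Printing Implicit Defensive.
Local Open Scope classical_set_scope.
Local Open Scope complex_scope.
Local Open Scope ring_scope.

(** * Absolutely continuous functions *)

(** Adding a constant to [b] does not change [tau], so on a unit interval only the oscillation of
    [b] matters; hence the free constant [b0]. Brownian oscillations on unit intervals are not
    bounded uniformly over the line, and the potential offers no lower bound, so neither a uniform
    estimate nor a quadratic form is used: it is enough that good intervals recur on both sides. The
    inferior limit is taken over Riemann sums as well as over intervals, because [B] is only a
    family of random variables: each Riemann sum is measurable in [w], and path continuity compares
    it with the integral afterwards. The equation for [v] holds only almost everywhere, so all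
    calculus is done with [primitive F f], an integral identity with [f] locally integrable. To this
    end the absolutely continuous functions of the definitions are shown to be integrals of their
    derivatives. Complex functions are handled by real and imaginary parts; for nonreal [z] these
    are coupled into a real system with four unknowns. *)

Section AC.
Context (R : realType).
Implicit Types (F G f g : R -> R) (a b c d : R).
Local Notation mu := (@lebesgue_measure R).

Definition ac_on (c d : R) (F : R -> R) : Prop :=
  forall e : R, 0 < e -> exists2 dl : R, 0 < dl &
    forall (n : nat) (s t : 'I_n -> R),
      (forall i, [/\ c <= s i, s i <= t i & t i <= d]) ->
      trivIset [set: 'I_n] (fun i => `]s i, t i[%classic) ->
      \sum_(i < n) (t i - s i) < dl ->
      \sum_(i < n) `|F (t i) - F (s i)| < e.

(** Subdivisions of a finite family of intervals are indexed by dependent pairs, so the condition is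
    needed for arbitrary finite index types. *)
Lemma ac_on_fin c d F : ac_on c d F -> forall e : R, 0 < e ->
  exists2 dl : R, 0 < dl & forall (I : finType) (s t : I -> R),
      (forall i, [/\ c <= s i, s i <= t i & t i <= d]) ->
      trivIset [set: I] (fun i => `]s i, t i[%classic) ->
      \sum_(i : I) (t i - s i) < dl ->
      \sum_(i : I) `|F (t i) - F (s i)| < e.
Proof.
move=> acF e e0; have [dl dl0 H] := acF e e0; exists dl => // I s t st tr.
rewrite big_enum_val [X in _ -> X < _]big_enum_val /=.
apply: H => // i j _ _ ij; apply: enum_val_inj; exact: tr.
Qed.

Lemma nth_itv_partition_le a b s i j : itv_partition a b s -> (i <= j <= size s)%N ->
  nth b (a :: s) i <= nth b (a :: s) j.
Proof.
move=> [ps _] /andP[ij js].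
have so : sorted <=%R (a :: s) by exact: (sub_path (@ltW _ _)).
by apply: (sorted_leq_nth le_trans lexx) => //; rewrite inE /= ltnS // (leq_trans ij).
Qed.

Lemma itv_partition_ends a b s : itv_partition a b s ->
  nth b (a :: s) 0 = a /\ nth b (a :: s) (size s) = b.
Proof. by move=> [_ /eqP lb]; split => //; rewrite nth_last /= lb. Qed.

Lemma variationE a b F s : variation a b F s =
  \sum_(i < size s) `|F (nth b (a :: s) i.+1) - F (nth b (a :: s) i)|.
Proof. by rewrite /variation big_mkord. Qed.

Lemma itv_partition_trivIset a b s : itv_partition a b s ->
  trivIset [set: 'I_(size s)]
    (fun i : 'I_(size s) => `]nth b (a :: s) i, nth b (a :: s) i.+1[%classic).
Proof.
move=> ps i j _ _; wlog ij : i j / (i <= j)%N.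
  move=> H; case/orP: (leq_total i j) => ij [x [xi xj]]; last apply/esym;
    by apply: H => //; exists x.
move=> [x [/=]]; rewrite !in_itv /= => /andP[_ xi] /andP[xj _].
apply/eqP; rewrite -val_eqE /=; move: ij; rewrite leq_eqVlt => /orP[//|ij].
have := @nth_itv_partition_le a b s i.+1 j ps.
by rewrite ij ltnW //= leNgt => /(_ isT)/negP[]; exact: lt_trans xi.
Qed.

Lemma total_variation_approx a b F (M e : R) : a <= b -> 0 < e ->
  (M%:E <= total_variation a b F)%E ->
  exists2 s, itv_partition a b s & M - e <= variation a b F s.
Proof.
rewrite le_eqVlt => /predU1P[<-|ab] e0.
  rewrite total_variationxx lee_fin => M0; exists [::] => //.
  by rewrite variationE big_ord0; lra.
move=> MT; have : ((M - e)%:E < total_variation a b F)%E.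
  by apply: lt_le_trans MT; rewrite lte_fin; lra.
rewrite /total_variation => /ereal_sup_gt[_ [_ [s ps <-] <-]].
by rewrite lte_fin => /ltW; exists s.
Qed.

(* Subdividing every interval of a disjoint family again gives a disjoint
   family with the same total length. *)
Lemma ac_on_total_variation c d F : ac_on c d F -> forall e : R, 0 < e ->
  exists2 dl : R, 0 < dl & forall (n : nat) (s t : 'I_n -> R),
      (forall i, [/\ c <= s i, s i <= t i & t i <= d]) ->
      trivIset [set: 'I_n] (fun i => `]s i, t i[%classic) ->
      \sum_(i < n) (t i - s i) < dl ->
      (\sum_(i < n) total_variation (s i) (t i) F <= e%:E)%E.
Proof.
move=> acF e e0; have [dl dl0 H] := ac_on_fin acF e0; exists dl => // n s t st tr sdl.
have var (p : 'I_n -> seq R) : (forall i, itv_partition (s i) (t i) (p i)) ->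
    \sum_(i < n) variation (s i) (t i) F (p i) < e.
  move=> ps; pose nt i := nth (t i) (s i :: p i).
  pose J i : finType := 'I_(size (p i)).
  under eq_bigr do rewrite variationE.
  rewrite (sig_big_dep _ _ (fun (i : 'I_n) (j : J i) => `|F (nt i j.+1) - F (nt i j)|)) /=.
  apply: (H {i : 'I_n & J i} (fun p => nt (tag p) (tagged p)) (fun p => nt (tag p) (tagged p).+1)).
  - move=> [i [j ji]] /=; have [si ti] := itv_partition_ends (ps i).
    have [? ? ?] := st i; split.
    + apply: (@le_trans _ _ (s i)) => //; rewrite -[leLHS]si.
      by apply: nth_itv_partition_le => //=; exact: ltnW.
    + by apply: nth_itv_partition_le => //=; rewrite leqnSn.
    + apply: (@le_trans _ _ (t i)) => //; rewrite -[leRHS]ti.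
      by apply: nth_itv_partition_le => //=; rewrite leqnn andbT.
  - move=> [i j] [i' j'] _ _ [x [/=]]; rewrite !in_itv /= => /andP[xi ix] /andP[xi' ix'].
    have sub k (l : J k) : nt k l < x -> x < nt k l.+1 -> s k < x < t k.
      have [sk tk] := itv_partition_ends (ps k) => x1 x2; apply/andP; split.
        apply: le_lt_trans x1; rewrite -[leLHS]sk.
        by apply: nth_itv_partition_le => //=; exact: ltnW.
      apply: (lt_le_trans x2); rewrite -[leRHS]tk.
      by apply: nth_itv_partition_le => //=; rewrite leqnn andbT.
    have ii' : i = i'.
      apply: tr => //; exists x; split; rewrite /= in_itv /=.
        exact: (sub i j).
      exact: (sub i' j').
    case: _ / ii' in j' xi' ix' *; congr existT.
    apply: (itv_partition_trivIset (ps i)) => //.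
    by exists x; split; rewrite /= in_itv /= ?(xi, ix) ?(xi', ix').
  - apply: le_lt_trans sdl; rewrite [leLHS](_ : _ =
        \sum_(i < n) \sum_(j : J i) (nt i j.+1 - nt i j)); last first.
      by rewrite (sig_big_dep _ _ (fun (i : 'I_n) (j : J i) => nt i j.+1 - nt i j)).
    apply: ler_sum => i _.
    have [si ti] := itv_partition_ends (ps i).
    rewrite -(big_mkord xpredT (fun j => nt i j.+1 - nt i j)) telescope_sumr //.
    by rewrite /nt si ti.
(* Finiteness comes first: a partition of one interval, completed by trivial partitions of the
   others, already has variation below [e]. Only then can [fine] be used. *)
have fin i : total_variation (s i) (t i) F \is a fin_num.
  have [? sti ?] := st i; apply/bounded_variationP => //; exists e => _ [q pq <-].
  have [p0 pp0] : exists p : 'I_n -> seq R, forall k, itv_partition (s k) (t k) (p k).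
    have : forall k : 'I_n, exists q : seq R, itv_partition (s k) (t k) q.
      move=> k; have [_ + _] := st k; rewrite le_eqVlt => /predU1P[<-|?].
        by exists [::].
      by exists [:: t k]; exact: itv_partition1.
    by move=> /choice[p ?]; exists p.
  apply: ltW; apply: le_lt_trans (var (fun k => if k == i then q else p0 k) _).
    rewrite (bigD1 i) //= eqxx lerDl sumr_ge0 // => k _; exact: variation_ge0.
  by move=> k; case: eqP => [->|].
rewrite -(@fineK _ (\sum_(i < n) _)%E); last by apply/sum_fin_numP => i _ _.
rewrite lee_fin; apply/ler_addgt0Pr => eta eta0.
(* Each total variation is approximated up to [eta / n.+1]; the successor keeps the denominator
   nonzero for an empty family. *)
have eta1 : 0 < eta / n.+1%:R by rewrite divr_gt0.
have : forall k : 'I_n, exists q : seq R, itv_partition (s k) (t k) q /\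
    fine (total_variation (s k) (t k) F) - eta / n.+1%:R <= variation (s k) (t k) F q.
  move=> k; have [_ stk _] := st k.
  have [|q ? ?] := @total_variation_approx _ _ F (fine (total_variation (s k) (t k) F)) _ stk eta1.
    by rewrite fineK.
  by exists q.
move=> /choice[p Hp].
have -> : fine (\sum_(i < n) total_variation (s i) (t i) F)%E =
   \sum_(i < n) fine (total_variation (s i) (t i) F).
  by rewrite sum_fine // => i _.
have vp := var p (fun k => (Hp k).1).
apply: (@le_trans _ _ (\sum_(i < n) (variation (s i) (t i) F (p i) + eta / n.+1%:R))).
  by apply: ler_sum => i _; rewrite -lerBlDr; exact: (Hp i).2.
rewrite big_split /= sumr_const card_ord lerD ?(ltW vp) // -[leLHS]mulr_natr mulrAC.
by rewrite ler_pdivrMr // ler_pM2l // ler_nat.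
Qed.

Lemma ac_on_total_variation1 c d F : ac_on c d F -> forall e : R, 0 < e ->
  exists2 dl : R, 0 < dl & forall s t : R, c <= s -> s <= t -> t <= d ->
    t - s < dl -> (total_variation s t F <= e%:E)%E.
Proof.
move=> acF e e0; have [dl dl0 H] := ac_on_total_variation acF e0; exists dl => //.
move=> s t cs st td tsd; have := H 1%N (fun=> s) (fun=> t).
by rewrite !big_ord1; apply => // i j _ _ _; rewrite !ord1.
Qed.

(** The interval is cut into [N] pieces shorter than the [dl] belonging to 1, so its total variation
    is at most [N]. *)
Lemma ac_on_bounded_variation c d F : c <= d -> ac_on c d F -> bounded_variation c d F.
Proof.
move=> cd /ac_on_total_variation1 /(_ _ ltr01)[dl dl0 H].
pose N := (Num.bound ((d - c) / dl)).+1.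
pose h := (d - c) / N%:R.
have h0 : 0 <= h by rewrite divr_ge0 // subr_ge0.
have hdl : h < dl.
  rewrite /h ltr_pdivrMr // mulrC -ltr_pdivrMr //.
  apply: lt_trans (archi_boundP _) _; first by rewrite divr_ge0 ?subr_ge0 // ltW.
  by rewrite ltr_nat.
have TVk k : (k <= N)%N -> (total_variation c (c + k%:R * h) F <= k%:R%:E)%E.
  elim: k => [|k IH] kN; first by rewrite mul0r addr0 total_variationxx.
  have kh : 0 <= k%:R * h by rewrite mulr_ge0.
  have hk : c + k%:R * h <= c + k.+1%:R * h by rewrite -natr1; lra.
  have hd : c + k.+1%:R * h <= d.
    rewrite -lerBrDl; apply: (@le_trans _ _ (N%:R * h)).
      by apply: ler_wpM2r => //; rewrite ler_nat.
    by rewrite /h mulrC divfK // pnatr_eq0.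
  rewrite (@total_variationD _ _ _ (c + k%:R * h)) ?lerDl //.
  rewrite -[in leRHS]natr1 EFinD; apply: leeD; first by apply: IH; exact: ltnW.
  by apply: H => //; rewrite ?lerDl // -natr1; lra.
apply/bounded_variationP => //; rewrite ge0_fin_numE ?total_variation_ge0 //.
have := TVk N (leqnn _); rewrite /h mulrC divfK ?pnatr_eq0 // subrKC => /le_lt_trans; apply.
by rewrite ltry.
Qed.

(** Jordan decomposition by the variation function [V] and [V - F]; [V] inherits absolute continuity
    because its increments are total variations of [F]. *)
Lemma ac_on_monotone_decomposition c d F : c <= d -> ac_on c d F ->
  exists G1 G2, [/\ ac_on c d G1 /\ {in `[c, d] &, nondecreasing G1},
     ac_on c d G2 /\ {in `[c, d] &, nondecreasing G2} & F = G1 \- G2].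
Proof.
move=> cd acF; pose V x := fine (total_variation c x F).
have bv := ac_on_bounded_variation cd acF.
have fV x : c <= x -> x <= d -> total_variation c x F \is a fin_num.
  by move=> cx xd; apply/bounded_variationP => //; exact: (bounded_variationl _ xd).
have VE s t : c <= s -> s <= t -> t <= d -> (V t - V s)%:E = total_variation s t F.
  move=> cs st td; rewrite EFinB !fineK ?fV //; [|exact: le_trans td|exact: le_trans st].
  rewrite [X in (X - _)%E](total_variationD _ cs st) addeAC subee ?add0e //.
  by apply: fV => //; exact: le_trans td.
have VF s t : c <= s -> s <= t -> t <= d -> `|F t - F s| <= V t - V s.
  by move=> cs st td; rewrite -lee_fin VE // total_variation_ge.
have acV : ac_on c d V.
  move=> e e0; have e20 : 0 < e / 2 by rewrite divr_gt0.
  have [dl dl0 H] := ac_on_total_variation acF e20; exists dl => // n s t st tr sdl.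
  have := H n s t st tr sdl.
  rewrite (eq_bigr (fun i => (`|V (t i) - V (s i)|)%:E)); last first.
    move=> i _; have [cs sti td] := st i; rewrite -VE // ger0_norm //.
    exact: le_trans (VF _ _ cs sti td).
  by rewrite sumEFin lee_fin => /le_lt_trans; apply; lra.
exists V, (V \- F); split.
- split=> // x y; rewrite !in_itv /= => /andP[cx xd] /andP[cy yd] xy.
  by rewrite -subr_ge0; exact: le_trans (VF _ _ cx xy yd).
- split=> [e e0|x y]; last first.
    rewrite !in_itv /= => /andP[cx xd] /andP[cy yd] xy.
    by have /ler_normlP[] := VF _ _ cx xy yd; lra.
  have e20 : 0 < e / 2 by rewrite divr_gt0.
  have [dl dl0 H] := acV _ e20; have [dl' dl0' H'] := acF _ e20.
  exists (Num.min dl dl'); first by rewrite lt_min dl0.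
  move=> n s t st tr; rewrite lt_min => /andP[/H + /H'] => /(_ st tr) h /(_ st tr) h'.
  apply: (@le_lt_trans _ _ (\sum_(i < n) `|V (t i) - V (s i)| + \sum_(i < n) `|F (t i) - F (s i)|)).
    rewrite -big_split /=; apply: ler_sum => i _.
    rewrite [X in `|X|](_ : _ = (V (t i) - V (s i)) - (F (t i) - F (s i))) ?ler_normB //.
    by rewrite /=; ring.
  by lra.
- by apply/funext => x /=; ring.
Qed.

(** Composing with this projection extends a function from [[c, d]] to the line by constants, so
    that results about the whole line apply. *)
Definition clamp c d x : R := Num.min d (Num.max c x).

Lemma clamp_itv c d x : c <= d -> c <= clamp c d x <= d.
Proof. by move=> cd; rewrite /clamp ge_min lexx le_min le_max cd lexx. Qed.

Lemma clamp_id c d x : c <= x -> x <= d -> clamp c d x = x.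
Proof. by move=> cx xd; rewrite /clamp max_r // min_r. Qed.

Lemma clamp_nondecreasing c d : nondecreasing (clamp c d).
Proof.
move=> x y xy; rewrite /clamp le_min !ge_min lexx /= !ge_max !le_max lexx /= xy.
by rewrite !orbT.
Qed.

Lemma clamp_minr c d x : c <= d -> clamp c d (Num.min x d) = clamp c d x.
Proof.
move=> cd; rewrite /clamp; have [//|dx] := leP x d.
by rewrite (max_r cd) minxx min_l // le_max (ltW dx) orbT.
Qed.

Lemma clamp_maxl c d x : clamp c d (Num.max x c) = clamp c d x.
Proof. by rewrite /clamp maxA (maxC c) -maxA maxxx maxC. Qed.

Lemma clamp_eq c d a b : c <= d -> a <= b -> Num.min b d < Num.max a c ->
  clamp c d b = clamp c d a.
Proof.
move=> cd ab; rewrite gt_min !lt_max => /orP[/orP[|bc]|/orP[da|]]; [lra| | |lra].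
  by rewrite /clamp !max_l //; lra.
by rewrite /clamp !max_r ?min_l //; lra.
Qed.

Lemma clamp_lip c d x y : x <= y -> clamp c d y - clamp c d x <= y - x.
Proof.
rewrite /clamp !minEle !maxEle => xy.
by repeat case: ifPn; rewrite -?ltNge; lra.
Qed.

Lemma clamp_in c d s t x : clamp c d s < x < clamp c d t -> s < x < t.
Proof.
rewrite /clamp !minEle !maxEle => /andP[].
by repeat case: ifPn; rewrite -?ltNge; lra.
Qed.

(** Clamping shortens intervals and keeps them disjoint, so the extended function satisfies the
    condition on the line with the same [dl]. *)
Lemma ac_on_clamp c d F : c <= d -> ac_on c d F -> forall e : R, 0 < e ->
  exists2 dl : R, 0 < dl & forall (n : nat) (s t : 'I_n -> R),
      (forall i, s i <= t i) ->
      trivIset [set: 'I_n] (fun i => `]s i, t i[%classic) ->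
      \sum_(i < n) (t i - s i) < dl ->
      \sum_(i < n) `|F (clamp c d (t i)) - F (clamp c d (s i))| < e.
Proof.
move=> cd acF e e0; have [dl dl0 H] := acF e e0; exists dl => // n s t st tr sdl.
apply: H.
- move=> i; split; first by case/andP: (clamp_itv (s i) cd).
    exact: clamp_nondecreasing.
  by case/andP: (clamp_itv (t i) cd).
- move=> i j _ _ [x [/=]]; rewrite !in_itv /= => xi xj; apply: tr => //; exists x.
  by split; rewrite /= in_itv /=; [exact: clamp_in xi|exact: clamp_in xj].
- by apply: le_lt_trans sdl; apply: ler_sum => i _; exact: clamp_lip.
Qed.

Lemma open_itvE (I : set R) : open I -> is_interval I -> (mu I < +oo)%E ->
  exists a b, a <= b /\ I = `]a, b[%classic.
Proof.
move=> oI iI; have [->|/set0P[p Ip]] := eqVneq I set0.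
  by exists 0, 0; split => //; rewrite set_itv_ge // bnd_simp ltxx.
move: oI Ip; rewrite -(RhullK (mem_set iI)).
case: (Rhull I) => [[xl l|[]] [xr r|[]]]; rewrite lebesgue_measure_itv //=.
- move=> oI Ip _.
  have sub y : [set` Interval (BSide xl l) (BSide xr r)] y -> l <= y <= r.
    by rewrite /= in_itv /= => /andP[/lteifW -> /lteifW ->].
  have lr : l <= r by have /andP[/le_trans] := sub _ Ip; exact.
  exists l, r; split=> //; apply/seteqP; split => x /=; last first.
    rewrite !in_itv /= => /andP[lx xr'].
    by apply/andP; split; apply: lteifS.
  move=> xI; have := oI x xI; rewrite -nbhs_ballE => -[e /= e0 ball_e].
  have e2 : 0 < e / 2 by rewrite divr_gt0.
  have h y : `|x - y| < e -> l <= y <= r by move=> h; apply: sub; exact: ball_e.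
  have /andP[? _] : l <= x - e / 2 <= r by apply: h; rewrite subKr ger0_norm; lra.
  have /andP[_ ?] : l <= x + e / 2 <= r.
    by apply: h; rewrite opprD addrA subrr sub0r normrN ger0_norm; lra.
  by rewrite in_itv /=; apply/andP; split; lra.
- by rewrite in_itv /= andbF.
- by rewrite ltry addye // ltxx.
- by rewrite ltNyr addey // ltxx.
Qed.

Lemma lebesgue_stieltjes_measure_itv_oc (f : cumulative R R) a b : a <= b ->
  lebesgue_stieltjes_measure f `]a, b]%classic = (f b - f a)%:E.
Proof.
move=> ab; rewrite /lebesgue_stieltjes_measure /measure_extension /=.
rewrite measurable_mu_extE /=; last exact: is_ocitv.
by rewrite wlength_itv_bnd.
Qed.

(** The Lebesgue-Stieltjes measure of the extended function is dominated by Lebesgue measure; its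
    Radon-Nikodym derivative is the density. *)
Lemma monotone_ac_density c d G : c <= d -> ac_on c d G ->
  {in `[c, d] &, nondecreasing G} ->
  exists g : R -> R, mu.-integrable setT (EFin \o g) /\
   forall a b, a <= b -> G (clamp c d b) - G (clamp c d a) = \int[mu]_(x in `[a, b]) g x.
Proof.
move=> cd acG ndG; pose Gc x := G (clamp c d x).
have ndGc : nondecreasing Gc.
  by move=> x y xy; apply: ndG; rewrite ?in_itv ?clamp_itv //; exact: clamp_nondecreasing.
have acGc := ac_on_clamp cd acG.
have ctGc : continuous Gc.
  move=> x; apply/cvgrPdist_lt => e e0; have [dl dl0 H] := acGc e e0.
  have H1 s t : s <= t -> t - s < dl -> `|Gc t - Gc s| < e.
    move=> st tsd; have := H 1%N (fun=> s) (fun=> t).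
    by rewrite !big_ord1; apply => // i j _ _ _; rewrite !ord1.
  exists dl => //= y xyd; have {}xyd : `|x - y| < dl := xyd; move: xyd.
  case: (leP x y) => xy; last first.
    by rewrite ger0_norm ?subr_ge0 ?ltW // => ?; apply: H1 => //; exact: ltW.
  by rewrite distrC ger0_norm ?subr_ge0 // => ?; rewrite distrC; exact: H1.
pose Gm := isCumulative.Build R _ R Gc ndGc (right_continuousW ctGc).
pose Gcum : cumulative R R := HB.pack Gc Gm.
pose nu : {measure set (measurableTypeR R) -> \bar R} := lebesgue_stieltjes_measure Gcum.
have nuoc a b : a <= b -> nu `]a, b]%classic = (Gc b - Gc a)%:E.
  exact: (lebesgue_stieltjes_measure_itv_oc Gcum).
(* A null set has an open neighbourhood of measure below [dl]; its components are disjoint intervals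
   over which the increments of [Gc] sum to less than [e]. *)
have nu_ac : nu `<< mu.
  apply/null_content_dominatesP => A mA A0; apply/eqP; rewrite -measure_le0.
  apply/lee_addgt0Pr => e e0; rewrite add0e.
  have [dl dl0 H] := acGc e e0.
  have [|U [oU AU UAdl]] := lebesgue_regularity_outer mA _ dl0; first by rewrite A0 ltry.
  have mU : measurable U by exact: open_measurable.
  have muU : (mu U < dl%:E)%E.
    rewrite -(setDKU AU) measureU0 //; exact: measurableD.
  apply: (le_trans (le_measure nu (mem_set mA) (mem_set mU) AU)).
  have UE := open_disjoint_itv_bigcup oU; set I := open_disjoint_itv oU in UE.
  have mI k : measurable (I k) by apply: open_measurable; exact: open_disjoint_itv_open.
  have tI : trivIset setT I by exact: open_disjoint_itv_trivIset.
  have IU k : I k `<=` U by rewrite UE; exact: bigcup_sup.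
  have /choice[ab abP] : forall k, exists p : R * R, p.1 <= p.2 /\ I k = `]p.1, p.2[%classic.
    move=> k; have [|||a [b [ab Iab]]] := @open_itvE (I k).
    - exact: open_disjoint_itv_open.
    - exact: open_disjoint_itv_is_interval.
    - apply: (@le_lt_trans _ _ (mu U)); first exact: (le_measure mu (mem_set (mI k)) (mem_set mU) (IU k)).
      by apply: lt_trans muU _; rewrite ltry.
    by exists (a, b).
  have nuU : nu U = (\sum_(i <oo) nu (I i))%E.
    by rewrite [in LHS]UE; apply: (@measure_semi_bigcup _ _ _ nu I) => //; rewrite -UE.
  apply: (@le_trans _ _ (\sum_(i <oo) nu (I i))%E); first by rewrite -nuU; exact: lexx.
  apply: lime_le; first by apply: is_cvg_nneseries => *; exact: measure_ge0.
  near=> n; rewrite big_mkord.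
  apply: (@le_trans _ _ (\sum_(i < n) (`|Gc (ab i).2 - Gc (ab i).1|%:E))%E).
    apply: lee_sum => i _; have [abi Ii] := abP i.
    apply: (@le_trans _ _ (nu `](ab i).1, (ab i).2]%classic)).
      have sI : I i `<=` `](ab i).1, (ab i).2]%classic.
        by rewrite Ii => x /=; rewrite !in_itv /= => /andP[-> /ltW].
      exact: (le_measure nu (mem_set (mI i)) (mem_set (measurable_itv _)) sI).
    by rewrite nuoc // lee_fin ler_norm.
  rewrite sumEFin lee_fin ltW //; apply: (H n (fun i => (ab i).1) (fun i => (ab i).2)).
  - by move=> i; have [] := abP i.
  - move=> i j _ _; rewrite -(abP i).2 -(abP j).2 => ij; apply/val_inj; exact: tI.
  - rewrite -lte_fin; apply: le_lt_trans muU; rewrite -sumEFin.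
    rewrite (eq_bigr (fun i : 'I_n => mu (I i))); last first.
      move=> i _; have [abi ->] := abP i; rewrite lebesgue_measure_itv /= lte_fin.
      move: abi; rewrite le_eqVlt => /predU1P[->|->]; last by rewrite EFinB.
      by rewrite ltxx subrr.
    have sU : \big[setU/set0]_(i < n) I i `<=` U.
      by rewrite [X in _ `<=` X]UE; exact: bigsetU_bigcup.
    have mUn : measurable (\big[setU/set0]_(i < n) I i).
      by apply: bigsetU_measurable => i _; exact: mI.
    apply: le_trans (le_measure mu (mem_set mUn) (mem_set mU) sU).
    rewrite (@measure_bigsetU_ord _ _ _ mu n xpredT (fun i : 'I_n => I i)).
    - exact: lexx.
    - by move=> i; exact: mI.
    - by move=> i j _ _ ij; apply/val_inj; exact: tI.
(* [Gc] is constant outside []c, d]], so restricting to this interval loses nothing and gives a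
   finite measure. *)
pose E : set (measurableTypeR R) := `]c, d]%classic; have mE : measurable E by exact: measurable_itv.
have nuE : (nu E < +oo)%E by rewrite nuoc // ltry.
pose nuf : {finite_measure set (measurableTypeR R) -> \bar R} := mfrestr mE nuE.
have nuf_ac : nuf `<< mu.
  apply/null_content_dominatesP => A mA A0; rewrite /nuf /= /mfrestr /mrestr.
  apply/eqP; rewrite -measure_le0.
  move/null_content_dominatesP : nu_ac => /(_ A mA A0) <-.
  by apply: le_measure; rewrite ?inE //; exact: measurableI.
have [f [f0 ffin fint fE]] := radon_nikodym_sigma_finite nuf_ac.
have fg : EFin \o (fine \o f) = f by apply/funext => x /=; rewrite fineK.
exists (fine \o f); split; first by rewrite fg.
move=> a b ab.
rewrite -Rintegral_itv_obnd_cbnd; last first.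
  by rewrite fg; apply: integrableS fint.
rewrite /Rintegral.
have -> : (\int[mu]_(x in `]a, b]) ((fine \o f) x)%:E = \int[mu]_(x in `]a, b]) f x)%E.
  by apply: eq_integral => x _; rewrite -[RHS]fineK.
rewrite -fE //= /mfrestr /mrestr /E -set_itvI /=.
have -> : [set` (`]a, b]%R `&` `]c, d]%R)%O] = `]Num.max a c, Num.min b d]%classic.
  apply/seteqP; split => x; rewrite set_itvI /= !in_itv /= gt_max le_min.
    by move=> [/andP[-> ->] /andP[-> ->]].
  by move=> /andP[/andP[-> ->] /andP[-> ->]].
(* If the two intervals do not overlap, [Gc] takes the same value at [a] and [b]. *)
have [mM|Mm] := leP (Num.max a c) (Num.min b d); last first.
  rewrite set_itv_ge ?bnd_simp -?leNgt ?ltW //.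
  by rewrite (clamp_eq cd ab Mm) subrr [lebesgue_stieltjes_measure _ _](measure0 nu).
transitivity (fine (Gc (Num.min b d) - Gc (Num.max a c))%:E); last first.
  by rewrite -nuoc.
by rewrite /= /Gc clamp_minr // clamp_maxl.
Unshelve. all: by end_near. Qed.

Lemma ac_on_density c d F : c <= d -> ac_on c d F ->
  exists g : R -> R, mu.-integrable setT (EFin \o g) /\
   forall a b, a <= b -> F (clamp c d b) - F (clamp c d a) = \int[mu]_(x in `[a, b]) g x.
Proof.
move=> cd /(ac_on_monotone_decomposition cd)[G1 [G2 [[ac1 nd1] [ac2 nd2] ->]]].
have [g1 [int1 g1E]] := monotone_ac_density cd ac1 nd1.
have [g2 [int2 g2E]] := monotone_ac_density cd ac2 nd2.
exists (g1 \- g2); split.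
  rewrite (_ : _ \o _ = (EFin \o g1) \- (EFin \o g2))%E //.
  exact: integrableB.
move=> a b ab; rewrite RintegralB //.
- by rewrite -g1E // -g2E //=; ring.
- exact: integrableS int1.
- exact: integrableS int2.
Qed.
End AC.

(** * Primitives of locally integrable functions *)

Section Primitive.
Context {R : realType}.
Implicit Types (F G f g : R -> R) (a b c d x : R).
Local Notation mu := (@lebesgue_measure R).

Lemma ae_imp (P Q : R -> Prop) : (forall x, P x -> Q x) ->
  {ae mu, forall x, P x} -> {ae mu, forall x, Q x}.
Proof. by move=> PQ; apply: filterS => //; exact: (ae_filter_ringOfSetsType mu). Qed.

Lemma ae_imp2 (P Q S : R -> Prop) : (forall x, P x -> Q x -> S x) ->
  {ae mu, forall x, P x} -> {ae mu, forall x, Q x} -> {ae mu, forall x, S x}.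
Proof. by move=> PQ; apply: filterS2 => //; exact: (ae_filter_ringOfSetsType mu). Qed.

Lemma ae_imp3 (P Q S T : R -> Prop) : (forall x, P x -> Q x -> S x -> T x) ->
  {ae mu, forall x, P x} -> {ae mu, forall x, Q x} -> {ae mu, forall x, S x} ->
  {ae mu, forall x, T x}.
Proof. by move=> PQ; apply: filterS3 => //; exact: (ae_filter_ringOfSetsType mu). Qed.

Definition locint f := forall a b, mu.-integrable `[a, b] (EFin \o f).

(** The working form of absolute continuity: the derivative is part of the data and the identity
    holds on the whole line, so no domains have to be carried along. *)
Definition primitive F f := locint f /\
  forall a b, a <= b -> F b - F a = \int[mu]_(x in `[a, b]) f x.

Lemma bigcup_itvcc : \bigcup_n `[- n%:R, n%:R]%classic = [set: R].
Proof.
apply/seteqP; split => // x _; exists (Num.bound `|x|) => //=; rewrite in_itv /=.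
by rewrite -ler_norml ltW // archi_boundP.
Qed.

Lemma locint_measurable f : locint f -> measurable_fun setT f.
Proof.
move=> lf; rewrite -bigcup_itvcc; apply/measurable_fun_bigcup => // i.
by apply/measurable_EFinP; exact: (measurable_int mu (lf _ _)).
Qed.

Lemma locint_locally_integrable f : locint f -> locally_integrable setT f.
Proof.
move=> lf; split; [exact: locint_measurable|exact: openT|move=> K _ cK].
have [M [_ KM]] := compact_bounded cK.
have K1 : K `<=` `[- (`|M| + 1), `|M| + 1].
  move=> x Kx; rewrite /= in_itv /= -ler_norml; apply: KM => //.
  by rewrite (le_lt_trans (ler_norm M)) // ltrDl.
have /integrableP[//] : mu.-integrable K (EFin \o f).
by apply: integrableS (lf _ _) => //; [exact: compact_measurable|exact: K1].
Qed.

Lemma continuous_bounded_itv f a b : continuous f ->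
  exists2 M, 0 < M & forall x, a <= x -> x <= b -> `|f x| <= M.
Proof.
move=> cf.
have /compact_bounded[M [_ HM]] : compact (f @` `[a, b]).
  by apply: continuous_compact (@segment_compact _ _ _); exact: continuous_subspaceT.
exists (`|M| + 1); first by rewrite ltr_wpDl.
move=> x ax xb; apply: HM; first by rewrite (le_lt_trans (ler_norm M)) // ltrDl.
by exists x => //=; rewrite in_itv /= ax.
Qed.

Lemma continuous_locint f : continuous f -> locint f.
Proof.
move=> cf a b; apply: continuous_compact_integrable; first exact: segment_compact.
exact: continuous_subspaceT.
Qed.

Lemma locintD f g : locint f -> locint g -> locint (fun x => f x + g x).
Proof.
move=> lf lg a b; rewrite (_ : EFin \o _ = (EFin \o f) \+ (EFin \o g))%E //.
exact: integrableD.
Qed.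

Lemma locintB f g : locint f -> locint g -> locint (fun x => f x - g x).
Proof.
move=> lf lg a b; rewrite (_ : EFin \o _ = (EFin \o f) \- (EFin \o g))%E //.
exact: integrableB.
Qed.

Lemma locintZ (k : R) f : locint f -> locint (fun x => k * f x).
Proof.
move=> lf a b; rewrite (_ : EFin \o _ = (fun x => k%:E * (EFin \o f) x))%E //.
exact: integrableZl.
Qed.

Lemma locintN f : locint f -> locint (fun x => - f x).
Proof.
move=> lf a b; rewrite (_ : EFin \o _ = -%E \o (EFin \o f)) //.
exact: integrableN.
Qed.

Lemma locint_cst (k : R) : locint (fun=> k).
Proof. by apply: continuous_locint => x; exact: cvg_cst. Qed.

Lemma locint_le f g : measurable_fun setT f -> (forall x, `|f x| <= g x) -> locint g ->
  locint f.
Proof.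
move=> mf fg lg a b; apply: le_integrable (lg a b) => //.
  by apply/measurable_EFinP; exact: measurable_funTS.
by move=> x _; rewrite /= lee_fin (le_trans (fg x)) // ler_norm.
Qed.

Lemma locintM f g : continuous f -> locint g -> locint (fun x => f x * g x).
Proof.
move=> cf lg a b; have [M M0 fM] := continuous_bounded_itv a b cf.
apply: (@le_integrable _ _ _ mu _ (measurable_itv _) _ (EFin \o (fun x => M * g x))).
- apply/measurable_EFinP; apply: measurable_funM; first exact: measurable_funTS (continuous_measurable_fun cf).
  exact: measurable_funTS (locint_measurable lg).
- move=> x /=; rewrite in_itv /= => /andP[ax xb]; rewrite lee_fin !normrM.
  by rewrite ler_wpM2r // (le_trans (fM x ax xb)) // ler_norm.
- exact: locintZ.
Qed.

Lemma Rintegral_itv_cat f a b c : locint f -> a <= b -> b <= c ->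
  \int[mu]_(x in `[a, c]) f x = \int[mu]_(x in `[a, b]) f x + \int[mu]_(x in `[b, c]) f x.
Proof.
move=> lf ab bc; apply/eqP; rewrite addrC -subr_eq; apply/eqP.
rewrite Rintegral_itvB //.
by rewrite Rintegral_itv_obnd_cbnd //; apply: integrableS (lf b c) => //; exact: subset_itv_oc_cc.
Qed.

Lemma primitive_near_eq F f x a : primitive F f -> a < x ->
  \forall y \near x, \int[mu]_(t in `[a, y]) f t + F a = F y.
Proof.
move=> [lf Ff] ax; near=> y; rewrite -Ff ?subrK //.
by apply: ltW; near: y; exact: lt_nbhsr.
Unshelve. all: by end_near. Qed.

(** The fundamental theorem at a Lebesgue point applies to the integral from [x - 1], which differs
    from [F] by a constant near [x]. *)
Lemma primitive_is_derive_lebesgue F f x : primitive F f -> lebesgue_pt f x ->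
  is_derive x 1 F (f x).
Proof.
move=> pF lx; have [lf _] := pF.
have x1 : x - 1 < x by rewrite ltrBlDr ltrDl.
have x2 : x < x + 1 by rewrite ltrDl.
have := @FTC1_lebesgue_pt _ f (BLeft (x - 1)) x (x + 1) x2 (lf _ _).
cbv zeta => /(_ _ lx) [|dF F']; first by rewrite /= lte_fin.
apply: near_eq_is_derive; first exact: (primitive_near_eq pF x1).
rewrite -[f x]addr0; apply: is_deriveD.
by rewrite -F' derive1E; exact: DeriveDef.
Qed.

Lemma primitive_ae_is_derive F f : primitive F f ->
  {ae mu, forall x, is_derive x 1 F (f x)}.
Proof.
move=> pF; have [lf _] := pF.
have := lebesgue_differentiation (locint_locally_integrable lf).
apply: ae_imp => x; exact: primitive_is_derive_lebesgue.
Qed.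

Lemma primitive_is_derive F f x : primitive F f -> {for x, continuous f} ->
  is_derive x 1 F (f x).
Proof.
move=> pF cf; apply: primitive_is_derive_lebesgue => //.
apply: (@continuous_lebesgue_pt _ _ _ setT) => //.
  by split => //; exact: openT.
by apply: locint_measurable; case: pF.
Qed.

Lemma locint_small f a b (e : R) : locint f -> 0 < e -> exists2 dl, 0 < dl &
  forall A, measurable A -> A `<=` `[a, b] -> (mu A < dl%:E)%E ->
   \int[mu]_(x in A) `|f x| < e.
Proof.
move=> lf e0.
have fi : mu.-integrable setT (EFin \o (f \_ `[a, b])).
  rewrite -restrict_EFin; apply/integrable_restrict => //=; rewrite setTI.
  exact: lf.
have [dl [dl0 H]] := integral_normr_continuous fi e0.
exists dl => // A mA Aab Adl; have := H A mA Adl; congr (_ < _).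
apply: eq_Rintegral => x /set_mem Ax; rewrite patchE ifT //.
by apply/mem_set; exact: Aab.
Qed.

(** Absolute continuity of the integral, applied to the union of the intervals. *)
Lemma primitive_ac F f a b : primitive F f -> ac_on a b F.
Proof.
move=> [lf Ff] e e0; have [dl dl0 H] := locint_small a b lf e0; exists dl => // n s t st tr sdl.
pose A := \big[setU/set0]_(i < n) `]s i, t i[%classic.
have sub (i : 'I_n) : `]s i, t i[%classic `<=` `[a, b]%classic.
  have [? ? ?] := st i; move=> x /=; rewrite !in_itv /= => /andP[/ltW ? /ltW ?].
  by apply/andP; split; lra.
have mA : measurable A by exact: bigsetU_measurable.
have Aab : A `<=` `[a, b].
  rewrite /A; elim/big_ind : _ => [//|S T hS hT x [/hS|/hT] //|i _]; exact: sub.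
have muA : (mu A < dl%:E)%E.
  rewrite /A (@measure_bigsetU_ord _ _ _ mu n xpredT); last 2 first.
  - by move=> i; exact: measurable_itv.
  - exact: tr.
  apply: (@le_lt_trans _ _ (\sum_(i < n) (t i - s i)%:E)%E).
    apply: lee_sum => i _; apply: (@le_trans _ _ (mu `]s i, t i[%classic)); first exact: lexx.
    have [_ + _] := st i; rewrite lebesgue_measure_itv /= lte_fin.
    by rewrite le_eqVlt => /predU1P[->|->]; rewrite ?ltxx ?subrr // EFinB.
  by rewrite sumEFin lte_fin.
apply: le_lt_trans (H A mA Aab muA).
have iA : mu.-integrable A (EFin \o (fun x => `|f x|)).
  by apply: integrable_norm; exact: integrableS (lf a b).
have -> : \int[mu]_(x in A) `|f x| = \sum_(i < n) \int[mu]_(x in `]s i, t i[) `|f x|.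
  rewrite /Rintegral /A integral_bigsetU_EFin //=.
  - rewrite sum_fine // => i _; apply: integrable_fin_num => //.
    by apply: integrable_norm; apply: integrableS (lf a b) => //; exact: sub.
  - exact: index_enum_uniq.
  - by move=> i j _ _; exact: tr.
  - by have /measurable_int := iA.
apply: ler_sum => i _; have [_ sti _] := st i; rewrite Ff //.
apply: (le_trans (le_normr_Rintegral _ _)) => //.
have li : mu.-integrable `[s i, t i] (EFin \o (fun x => `|f x|)).
  by apply: integrable_norm; exact: lf.
rewrite -Rintegral_itv_bndo_bndc; last first.
  by apply: integrableS li => //; exact: subset_itv_co_cc.
rewrite -Rintegral_itv_obnd_cbnd //.
by apply: integrableS li => //; exact: subset_itv_oo_cc.
Qed.

Lemma primitiveD F f G g : primitive F f -> primitive G g ->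
  primitive (fun x => F x + G x) (fun x => f x + g x).
Proof.
move=> [lf Ff] [lg Gg]; split; first exact: locintD.
move=> a b ab; rewrite RintegralD //.
by rewrite -Ff // -Gg //; ring.
Qed.

Lemma primitiveZ (k : R) F f : primitive F f -> primitive (fun x => k * F x) (fun x => k * f x).
Proof.
move=> [lf Ff]; split; first exact: locintZ.
move=> a b ab; rewrite RintegralZl //.
by rewrite -Ff // mulrBr.
Qed.

Lemma primitiveB F f G g : primitive F f -> primitive G g ->
  primitive (fun x => F x - G x) (fun x => f x - g x).
Proof.
move=> [lf Ff] [lg Gg]; split; first exact: locintB.
move=> a b ab; rewrite RintegralB //.
by rewrite -Ff // -Gg //; ring.
Qed.

Lemma Rintegral_ae_eq (D : set R) f g : measurable D -> measurable_fun D f -> measurable_fun D g ->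
  {ae mu, forall x, D x -> f x = g x} -> \int[mu]_(x in D) f x = \int[mu]_(x in D) g x.
Proof.
move=> mD mf mg fg; congr fine; apply: ae_eq_integral => //.
- exact/measurable_EFinP.
- exact/measurable_EFinP.
- by apply: ae_imp fg => x /= h Dx; rewrite h.
Qed.

Lemma primitive_eq F f g : (f =1 g) -> primitive F f -> primitive F g.
Proof. by move=> /funext ->. Qed.

Lemma primitive_eql F G f : (F =1 G) -> primitive F f -> primitive G f.
Proof. by move=> /funext ->. Qed.

Lemma primitive_of_derive F f : (forall x, is_derive x 1 F (f x)) -> continuous f ->
  primitive F f.
Proof.
move=> dF cf; have lf := continuous_locint cf; split => // a b.
rewrite le_eqVlt => /predU1P[->|ab].
  by rewrite subrr set_itv1 Rintegral_set1.
have cF x : {for x, continuous F}.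
  by apply/differentiable_continuous/derivable1_diffP.
rewrite /Rintegral (@continuous_FTC2 _ f F) //.
- exact: continuous_subspaceT.
- split => [x _ //| |].
  + by apply: cvg_at_right_filter; exact: cF.
  + by apply: cvg_at_left_filter; exact: cF.
- by move=> x _; rewrite derive1E derive_val.
Qed.
End Primitive.

(** * Product rule and oriented integrals *)

Section PrimitiveProducts.
Context {R : realType}.
Implicit Types (F G f g : R -> R) (a b c d x : R).
Local Notation mu := (@lebesgue_measure R).

Lemma primitive_continuous F f : primitive F f -> continuous F.
Proof.
move=> pF x; apply/cvgrPdist_lt => e e0.
have [dl dl0 H] := primitive_ac (x - 1) (x + 1) pF e0.
have H1 s t : x - 1 <= s -> s <= t -> t <= x + 1 -> t - s < dl -> `|F t - F s| < e.
  move=> xs st tx tsd; have := H 1%N (fun=> s) (fun=> t).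
  by rewrite !big_ord1; apply => // i j _ _ _; rewrite !ord1.
exists (Num.min dl 1) => /=; first by rewrite lt_min dl0 ltr01.
move=> y xy; have {xy} : `|x - y| < Num.min dl 1 := xy.
rewrite lt_min => /andP[]; case: (leP x y) => xy.
  by rewrite distrC ger0_norm ?subr_ge0 // => ? ?; rewrite distrC; apply: H1 => //; lra.
by rewrite ger0_norm ?subr_ge0 ?ltW // => ? ?; apply: H1; lra.
Qed.

Lemma primitive_ae_eq F f g : primitive F f -> measurable_fun setT g ->
  {ae mu, forall x, f x = g x} -> primitive F g.
Proof.
move=> [lf Ff] mg fg; have lg : locint g.
  move=> a b; have /integrableP[mf ifoo] := lf a b.
  apply/integrableP; split; first by apply/measurable_EFinP; exact: measurable_funTS.
  apply: le_lt_trans ifoo; rewrite le_eqVlt; apply/orP; left; apply/eqP.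
  apply: ae_eq_integral => //.
  - by do 2 apply: measurableT_comp => //; exact: measurable_funTS.
  - exact: measurableT_comp.
  - by apply: ae_imp fg => x /= ->.
split => // a b ab; rewrite Ff //; apply: Rintegral_ae_eq => //.
- exact: measurable_funTS (locint_measurable lf).
- exact: measurable_funTS.
- by apply: ae_imp fg => x /= ->.
Qed.

Lemma ac_onM c d F G (M : R) : (forall x, c <= x -> x <= d -> `|F x| <= M) ->
  (forall x, c <= x -> x <= d -> `|G x| <= M) ->
  ac_on c d F -> ac_on c d G -> ac_on c d (fun x => F x * G x).
Proof.
move=> FM GM acF acG e e0.
have N0 : 0 < `|M| + 1 by rewrite ltr_wpDl.
have e1 : 0 < e / 2 / (`|M| + 1) by rewrite !divr_gt0.
have [d1 d10 H1] := acF _ e1; have [d2 d20 H2] := acG _ e1.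
exists (Num.min d1 d2); first by rewrite lt_min d10.
move=> n s t st tr; rewrite lt_min => /andP[/(H1 n s t st tr) S1 /(H2 n s t st tr) S2].
apply: (@le_lt_trans _ _ ((`|M| + 1) * (\sum_(i < n) `|F (t i) - F (s i)|) +
   (`|M| + 1) * (\sum_(i < n) `|G (t i) - G (s i)|))).
  rewrite !big_distrr -big_split /=; apply: ler_sum => i _; have [cs sti td] := st i.
  rewrite (_ : F (t i) * G (t i) - _ = G (t i) * (F (t i) - F (s i)) +
    F (s i) * (G (t i) - G (s i))); last by ring.
  apply: (le_trans (ler_normD _ _)); rewrite !normrM.
  have M1 : M <= `|M| + 1 by rewrite (le_trans (ler_norm M)) // lerDl.
  apply: lerD; apply: ler_wpM2r => //; apply: le_trans M1.
    by apply: GM => //; exact: le_trans sti.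
  by apply: FM => //; exact: le_trans td.
move: S1 S2; rewrite !ltr_pdivlMr // => S1 S2; lra.
Qed.

(** The passage from the epsilon-delta condition to [primitive]: the extension by constants is a
    primitive on the line, and its density is the derivative of [F] almost everywhere inside. *)
Lemma ac_on_primitive c d F : c <= d -> ac_on c d F ->
  exists g, primitive (F \o clamp c d) g /\
    {ae mu, forall x, c < x -> x < d -> is_derive x 1 F (g x)}.
Proof.
move=> cd acF; have [g [ig Fg]] := ac_on_density cd acF; exists g.
have pF : primitive (F \o clamp c d) g.
  by split => // a b; apply: integrableS ig.
split => //; have := primitive_ae_is_derive pF; apply: ae_imp => x dF cx xd.
apply: near_eq_is_derive dF; near=> y => /=; rewrite clamp_id //; apply: ltW; near: y.
  exact: lt_nbhsr.
exact: lt_nbhsl.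
Unshelve. all: by end_near. Qed.

(** The product is absolutely continuous on bounded intervals, hence the integral of some density,
    and that density is the Leibniz expression almost everywhere. *)
Lemma primitiveM F f G g : primitive F f -> primitive G g ->
  primitive (fun x => F x * G x) (fun x => f x * G x + F x * g x).
Proof.
move=> pF pG; have [lf _] := pF; have [lg _] := pG.
have cF := primitive_continuous pF; have cG := primitive_continuous pG.
have lfg : locint (fun x => f x * G x + F x * g x).
  apply: locintD; last exact: locintM.
  by rewrite (_ : (fun x => _) = (fun x => G x * f x)); [exact: locintM|apply/funext => x; rewrite mulrC].
(* The margin of 1 puts [[a, b]] inside the open interval where the density is known to be the
   derivative. *)
split => // a b ab; pose a1 := a - 1; pose b1 := b + 1.
have [M1 _ HM1] := continuous_bounded_itv a1 b1 cF.
have [M2 _ HM2] := continuous_bounded_itv a1 b1 cG.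
have acFG : ac_on a1 b1 (fun x => F x * G x).
  apply: (@ac_onM _ _ _ _ (Num.max M1 M2)); [| |exact: primitive_ac pF|exact: primitive_ac pG].
  - by move=> x ? ?; rewrite le_max HM1.
  - by move=> x ? ?; rewrite le_max HM2 ?orbT.
have ab1 : a1 <= b1 by rewrite /a1 /b1; lra.
have [k [[lk Hk] dk]] := ac_on_primitive ab1 acFG.
have := Hk a b ab; rewrite /= !clamp_id ?/a1 ?/b1; try lra; move=> ->.
apply: Rintegral_ae_eq => //.
- exact: measurable_funTS (locint_measurable lk).
- exact: measurable_funTS (locint_measurable lfg).
- apply: ae_imp3 dk (primitive_ae_is_derive pF) (primitive_ae_is_derive pG) => x dk dF dG.
  rewrite /= in_itv /= => /andP[ax xb].
  have {}dk : is_derive x 1 (fun x => F x * G x) (k x) by apply: dk; rewrite /a1 /b1; lra.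
  rewrite -[LHS]/(k x) -(@derive_val _ _ _ _ _ _ _ dk).
  have := is_deriveM dF dG => /(@derive_val _ _ _ _ _ _ _).
  by rewrite /GRing.scale /= => ->; ring.
Qed.

Lemma primitive_shift F f (k : R) : primitive F f -> primitive (fun x => F x + k) f.
Proof. by move=> [lf Ff]; split => // a b ab; rewrite -Ff //; ring. Qed.

(* For [t < x0] the first integral vanishes, for [x0 < t] the second one. *)
Definition oint x0 f (t : R) : R :=
  \int[mu]_(x in `[x0, t]) f x - \int[mu]_(x in `[t, x0]) f x.

Lemma ointr x0 f t : x0 <= t -> oint x0 f t = \int[mu]_(x in `[x0, t]) f x.
Proof.
rewrite /oint le_eqVlt => /predU1P[->|xt]; first by rewrite set_itv1 Rintegral_set1 subr0.
by rewrite [X in _ - X](_ : _ = 0) ?subr0 // set_itv_ge ?Rintegral_set0 // bnd_simp -ltNge.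
Qed.

Lemma ointl x0 f t : t <= x0 -> oint x0 f t = - \int[mu]_(x in `[t, x0]) f x.
Proof.
rewrite /oint le_eqVlt => /predU1P[->|xt]; first by rewrite set_itv1 Rintegral_set1 subr0 oppr0.
by rewrite [X in X - _](_ : _ = 0) ?sub0r // set_itv_ge ?Rintegral_set0 // bnd_simp -ltNge.
Qed.

Lemma oint0 x0 f : oint x0 f x0 = 0.
Proof. by rewrite ointr // set_itv1 Rintegral_set1. Qed.

Lemma primitive_oint x0 f : locint f -> primitive (oint x0 f) f.
Proof.
move=> lf; split => // a b ab.
case: (leP x0 a) => xa.
  by rewrite !ointr ?(le_trans xa) // (Rintegral_itv_cat lf xa ab); ring.
case: (leP x0 b) => xb.
  by rewrite ointr // ointl ?ltW // (Rintegral_itv_cat lf (ltW xa) xb); ring.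
by rewrite !ointl ?ltW // (Rintegral_itv_cat lf ab (ltW xb)); ring.
Qed.

Lemma primitive_ointE x0 F f t : primitive F f -> F t = F x0 + oint x0 f t.
Proof.
move=> [lf Ff]; case: (leP x0 t) => xt; first by rewrite ointr // -Ff //; ring.
by rewrite ointl ?ltW // -Ff ?ltW //; ring.
Qed.

End PrimitiveProducts.

(** * Linear differential systems *)

Section LinearODE.
Context {R : realType}.
Implicit Types (F G f g : R -> R) (a b c d x : R).
Local Notation mu := (@lebesgue_measure R).

(** In the norm weighted by [expR (2 * M * |x - x0|)] integration gains a factor [1 / (2 * M)]: for
    [L = M * e] the result is [e / 2]. Picard iteration and the Gronwall estimate both rest on this
    halving, whatever the size of [K]. *)
Lemma oint_exp_bound x0 f (K L M t : R) : locint f -> 0 < M -> 0 <= L ->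
  (forall x, `|x - x0| < K -> `|f x| <= L * expR (2 * M * `|x - x0|)) ->
  `|t - x0| < K -> `|oint x0 f t| <= L / (2 * M) * expR (2 * M * `|t - x0|).
Proof.
move=> lf M0 L0 fL tK; have M20 : 0 < 2 * M by lra.
(* Antiderivatives of the weight to the right of [x0] ([s = 1]) and to the left ([s = -1]). *)
have P s : primitive (fun x => L / (2 * M) * (s * expR (2 * M * (s * (x - x0)))))
    (fun x => s * s * (L * expR (2 * M * (s * (x - x0))))).
  apply: primitive_of_derive.
    move=> x; apply: is_derive_eq.
    rewrite /GRing.scale /= !(mul0r, mulr0, add0r, addr0, mulr1, subr0).
    by field; lra.
  move=> x; apply: cvgM; first exact: cvg_cst.
  apply: cvgM; first exact: cvg_cst.
  apply: continuous_cvg; first exact: continuous_expR.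
  apply: cvgM; first exact: cvg_cst.
  apply: cvgM; first exact: cvg_cst.
  by apply: cvgB; [exact: cvg_id|exact: cvg_cst].
case: (leP x0 t) => xt.
  rewrite ointr //.
  apply: (le_trans (le_normr_Rintegral _ _)) => //.
  apply: (@le_trans _ _ (\int[mu]_(x in `[x0, t]) (1 * 1 * (L * expR (2 * M * (1 * (x - x0))))))).
    apply: le_Rintegral => //.
    - by apply: integrable_norm; exact: lf.
    - exact: (P 1).1.
    - move=> x /=; rewrite in_itv /= => /andP[xx xt']; rewrite !mul1r.
      have -> : x - x0 = `|x - x0| by rewrite ger0_norm // subr_ge0.
      by apply: fL; move: tK; rewrite !ger0_norm ?subr_ge0 //; lra.
  rewrite -(P 1).2 // subrr !(mul1r, mulr0) expR0 ger0_norm ?subr_ge0 //.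
  by rewrite gerDl oppr_le0 mulr_ge0 // divr_ge0 // ltW.
rewrite (ointl _ (ltW xt)) normrN.
apply: (le_trans (le_normr_Rintegral _ _)) => //.
apply: (@le_trans _ _ (\int[mu]_(x in `[t, x0]) (-1 * -1 * (L * expR (2 * M * (-1 * (x - x0))))))).
  apply: le_Rintegral => //.
  - by apply: integrable_norm; exact: lf.
  - exact: (P (-1)).1.
  - move=> x /=; rewrite in_itv /= => /andP[xx xt']; rewrite mulrNN !mul1r mulN1r.
    have -> : - (x - x0) = `|x - x0| by rewrite ler0_norm // subr_le0.
    by apply: fL; move: tK; rewrite (ler0_norm (_ : t - x0 <= 0)) ?subr_le0 ?(ltW xt) // ler0_norm ?subr_le0 //; lra.
rewrite -(P (-1)).2 ?(ltW xt) // subrr !(mulN1r, mulr0, oppr0) expR0.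
rewrite (ler0_norm (_ : t - x0 <= 0)) ?subr_le0 ?(ltW xt) //.
have : 0 <= L / (2 * M) by rewrite divr_ge0 // ltW.
by move: (L / (2 * M)) (expR _) => p q p0; lra.
Qed.

Lemma cvg_half_pow (E : R) : (fun k : nat => E * 2^-1 ^+ k) @ \oo --> (0 : R).
Proof. by apply: cvg_geometric; rewrite ger0_norm ?invr_ge0 // invf_lt1 // ltr1n. Qed.

Lemma half_pow_le0 (E z : R) : (forall k : nat, z <= E * 2^-1 ^+ k) -> z <= 0.
Proof. by move=> H; apply: (cvgr_to_ge (cvg_half_pow E)); exact: nearW. Qed.

Lemma half_pow_eq0 (E z : R) : (forall k : nat, `|z| <= E * 2^-1 ^+ k) -> z = 0.
Proof. by move=> /half_pow_le0; rewrite normr_le0 => /eqP. Qed.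

(** Subtracting and adding the remaining error gives nested intervals; a common point is the limit
    and carries the error bound with it. *)
Lemma geometric_increments_cvg (u : nat -> R) (E : R) :
  (forall k, `|u k.+1 - u k| <= E * 2^-1 ^+ k) ->
  exists l, forall k, `|u k - l| <= 2 * E * 2^-1 ^+ k.
Proof.
move=> H; pose v k := u k - 2 * E * 2^-1 ^+ k; pose w k := u k + 2 * E * 2^-1 ^+ k.
have E0 : 0 <= E by have := H 0%N; rewrite expr0 mulr1; exact: le_trans.
have p0 k : 0 <= 2 * E * (2^-1 : R) ^+ k by rewrite !mulr_ge0 // exprn_ge0 // invr_ge0.
have ndv : {homo v : m n / (m <= n)%N >-> m <= n}.
  apply: homo_leq => [x //|x y z xy yz|k]; first exact: le_trans yz.
  by have := H k; rewrite ler_norml /v exprS => /andP[? _]; lra.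
have niw : {homo w : m n / (m <= n)%N >-> n <= m}.
  apply: homo_leq => [x //|x y z xy yz|k]; first exact: le_trans xy.
  by have := H k; rewrite ler_norml /w exprS => /andP[_ ?]; lra.
have vw m k : v m <= w k.
  apply: (@le_trans _ _ (v (maxn m k))); first by apply: ndv; exact: leq_maxl.
  apply: (@le_trans _ _ (w (maxn m k))); first by rewrite /v /w; have := p0 (maxn m k); lra.
  by apply: niw; exact: leq_maxr.
exists (sup (range v)) => k.
have h1 : v k <= sup (range v).
  by apply: ub_le_sup; [exists (w 0%N) => _ [m _ <-]; exact: vw|exists k].
have h2 : sup (range v) <= w k.
  by apply: ge_sup; [exists (v 0%N), 0%N|move=> _ [m _ <-]; exact: vw].
by rewrite ler_norml; move: h1 h2; rewrite /v /w => ? ?; apply/andP; split; lra.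
Qed.

Lemma continuous_sum n (u : 'I_n -> R -> R) :
  (forall i, continuous (u i)) -> continuous (fun x => \sum_i u i x).
Proof. by move=> cu x; apply: cvg_big => [|i _]; [exact: add_continuous|exact: cu]. Qed.

Lemma locint_bounded f : measurable_fun setT f ->
  (forall K : R, exists M, forall x, `|x| <= K -> `|f x| <= M) -> locint f.
Proof.
move=> mf bf a b; apply: measurable_bounded_integrable => //.
- by apply: compact_finite_measure; exact: segment_compact.
- exact: measurable_funTS.
- have [M HM] := bf (`|a| + `|b|); exists M; split; first exact: num_real.
  move=> N MN x /=; rewrite in_itv /= => /andP[ax xb]; apply: le_trans (ltW MN); apply: HM.
  rewrite ler_norml; have := ler_norm b; have := ler_norm (- a); rewrite normrN.
  by have := normr_ge0 a; have := normr_ge0 b => *; apply/andP; split; lra.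
Qed.

Lemma continuous_family_bounded n (u : 'I_n -> R -> R) (K : R) :
  (forall i, continuous (u i)) ->
  exists2 M, 0 < M & forall i x, `|x| <= K -> `|u i x| <= M.
Proof.
move=> cu; have /choice[M HM] : forall i, exists m, 0 < m /\ forall x, `|x| <= K -> `|u i x| <= m.
  move=> i; have [m m0 Hm] := continuous_bounded_itv (- K) K (cu i); exists m; split => //.
  by move=> x; rewrite ler_norml => /andP[? ?]; exact: Hm.
exists (1 + \sum_i M i).
  by rewrite ltr_wpDr // sumr_ge0 // => i _; exact: ltW (HM i).1.
move=> i x xK; apply: (le_trans ((HM i).2 x xK)).
rewrite (bigD1 i) //= addrCA lerDl addr_ge0 // sumr_ge0 // => j _; exact: ltW (HM j).1.
Qed.

Lemma expR_mul_norm_ge1 (M x : R) : 0 <= M -> 1 <= expR (2 * M * `|x|).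
Proof. by move=> M0; rewrite -expR0 ler_expR !mulr_ge0. Qed.

(** Starting from a crude bound [S] on the compact interval, each use of the integral equation
    halves the part [S] in the weighted norm and reproduces [2 * C], since
    [C + 2 * C / 2 = 2 * C]. *)
Lemma linear_ode_gronwall n (y f : 'I_n -> R -> R) x0 (K M C : R) : 0 < M ->
  (forall i, primitive (y i) (f i)) ->
  (forall x e, `|x - x0| < K -> (forall j, `|y j x| <= e) -> forall i, `|f i x| <= M * e) ->
  (forall i, `|y i x0| <= C) ->
  forall x, `|x - x0| < K -> forall i, `|y i x| <= 2 * C * expR (2 * M * `|x - x0|).
Proof.
move=> M0 py fM yC.
have cy i : continuous (y i) := primitive_continuous (py i).
have [S S0 HS] := continuous_family_bounded (K + `|x0|) cy.
have [K0|K0] := leP K 0; first by move=> x /lt_le_trans /(_ K0); rewrite normr_lt0.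
have step k : forall x, `|x - x0| < K -> forall i,
    `|y i x| <= (2 * C + S * 2^-1 ^+ k) * expR (2 * M * `|x - x0|).
  elim: k => [|k IH] x xK i.
    have C0 : 0 <= C := le_trans (normr_ge0 _) (yC i).
    apply: (@le_trans _ _ S).
      apply: HS; rewrite -[x](subrK x0) (le_trans (ler_normD _ _)) //.
      by rewrite lerD2r ltW.
    rewrite expr0 mulr1; have := @expR_mul_norm_ge1 M (x - x0) (ltW M0).
    by move=> e1; apply: (@le_trans _ _ (S * 1)); [rewrite mulr1|apply: ler_pM => //; lra].
  have C0 : 0 <= C := le_trans (normr_ge0 _) (yC i).
  have Q0 : 0 <= 2 * C + S * 2^-1 ^+ k.
    by rewrite addr_ge0 ?mulr_ge0 ?exprn_ge0 ?invr_ge0 // ltW.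
  rewrite (primitive_ointE x0 x (py i)).
  apply: (le_trans (ler_normD _ _)).
  have MQ0 : 0 <= M * (2 * C + S * 2^-1 ^+ k) by apply: mulr_ge0 => //; exact: ltW.
  have B : `|oint x0 (f i) x| <=
      M * (2 * C + S * 2^-1 ^+ k) / (2 * M) * expR (2 * M * `|x - x0|).
    apply: (oint_exp_bound (py i).1 M0 MQ0 _ xK) => z zK.
    by rewrite -(mulrA M); apply: fM => // j; exact: IH.
  apply: (le_trans (lerD (yC i) B)).
  have := @expR_mul_norm_ge1 M (x - x0) (ltW M0); rewrite exprS.
  have -> : M * (2 * C + S * 2^-1 ^+ k) / (2 * M) = C + S * 2^-1 ^+ k / 2.
    by field; lra.
  move: (expR _) => e e1; have : C * 1 <= C * e by apply: ler_wpM2l.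
  by move: (S * 2^-1 ^+ k) (2^-1 ^+ k) => p q; lra.
move=> x xK i; rewrite -subr_le0.
apply: (@half_pow_le0 (S * expR (2 * M * `|x - x0|))) => k.
by have := step k x xK i; lra.
Qed.

Lemma ointB x0 f g x : locint f -> locint g ->
  oint x0 (fun x => f x - g x) x = oint x0 f x - oint x0 g x.
Proof.
move=> lf lg.
have := primitiveB (primitive_oint x0 lf) (primitive_oint x0 lg).
by move=> /(@primitive_ointE _ x0 _ _ x); rewrite !oint0 subrr add0r.
Qed.

Lemma locint_sum n (u : 'I_n -> R -> R) :
  (forall i, locint (u i)) -> locint (fun x => \sum_i u i x).
Proof.
move=> lu a b; rewrite (_ : EFin \o _ = (fun x => \sum_i (EFin \o u i) x)%E); last first.
  by apply/funext => x; rewrite /= sumEFin.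
by apply: integrable_sum => // i _; exact: lu.
Qed.

(** Picard iteration: the increments halve at each step in the weighted norm, so the iterates
    converge on every bounded interval and the solution is global. *)
Lemma linear_ode_exists n (A : 'I_n -> 'I_n -> R -> R) (G : 'I_n -> R -> R) x0 (c : 'I_n -> R) :
  (forall i j, continuous (A i j)) -> (forall i, locint (G i)) ->
  exists y : 'I_n -> R -> R, forall i, y i x0 = c i /\
    primitive (y i) (fun x => \sum_j A i j x * y j x + G i x).
Proof.
move=> cA lG.
pose Ay (z : 'I_n -> R -> R) i x := \sum_j A i j x * z j x.
pose Y0 i x := c i + oint x0 (G i) x.
pose Y := fix Y k : 'I_n -> R -> R := if k is k'.+1 then
  (fun i x => Y0 i x + oint x0 (Ay (Y k') i) x) else Y0.
have cAy z : (forall j, continuous (z j)) -> forall i, continuous (Ay z i).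
  move=> cz i; apply: continuous_sum => j x; apply: cvgM; [exact: cA|exact: cz].
have cY0 i : continuous (Y0 i).
  apply: (@primitive_continuous _ _ (G i)).
  apply: primitive_eql (primitive_shift (c i) (primitive_oint x0 (lG i))) => x.
  by rewrite addrC.
have cY k : forall i, continuous (Y k i).
  elim: k => [//|k IH] i x; apply: cvgD; first exact: cY0.
  exact: (primitive_continuous (primitive_oint x0 (continuous_locint (cAy _ IH i)))).
have bA (K : R) : exists2 M, 0 < M & forall i x e (z : 'I_n -> R), `|x - x0| < K ->
    (forall j, `|z j| <= e) -> `|\sum_j A i j x * z j| <= M * e.
  have [S S0 HS] := continuous_family_bounded (K + `|x0|)
     (u := fun k : 'I_#|{: 'I_n * 'I_n}| => A (enum_val k).1 (enum_val k).2) (fun k => cA _ _).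
  (* [n.+1] instead of [n] keeps the constant positive when [n = 0]. *)
  exists (S * n.+1%:R) => [|i x e z xK ze]; first by rewrite mulr_gt0.
  have SA j : `|A i j x| <= S.
    have := HS (enum_rank (i, j)) x; rewrite enum_rankK /=; apply.
    rewrite -[x](subrK x0) (le_trans (ler_normD _ _)) //.
    by rewrite lerD2r ltW.
  apply: (le_trans (ler_norm_sum _ _ _)).
  have e0 : 0 <= e := le_trans (normr_ge0 _) (ze i).
  apply: (@le_trans _ _ (\sum_(j < n) S * e)).
    by apply: ler_sum => j _; rewrite normrM; apply: ler_pM.
  rewrite sumr_const card_ord -[leLHS]mulr_natr mulrAC ler_wpM2r // ler_wpM2l ?ler_nat //.
  exact: ltW.
have lAyY k i : locint (Ay (Y k) i) by apply: continuous_locint; exact: cAy.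
have AyB (z w : 'I_n -> R -> R) i : (fun x => \sum_j A i j x * (z j x - w j x)) =
    (fun x => Ay z i x - Ay w i x).
  by apply/funext => x; rewrite /Ay -sumrB; apply: eq_bigr => j _; rewrite mulrBr.
have inc (K : R) : exists C M, [/\ 0 < M, 0 <= C,
    (forall i x e (z : 'I_n -> R), `|x - x0| < K ->
      (forall j, `|z j| <= e) -> `|\sum_j A i j x * z j| <= M * e) &
    forall k i x, `|x - x0| < K ->
    `|Y k.+1 i x - Y k i x| <= C * expR (2 * M * `|x - x0|) * 2^-1 ^+ k].
  have [M M0 HM] := bA K.
  have [C C0 HC] := continuous_family_bounded (K + `|x0|)
    (u := fun i x => Y 1 i x - Y 0 i x) (fun i x => cvgB (@cY 1 i x) (@cY 0 i x)).
  exists C, M; split => //; first exact: ltW.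
  elim=> [|k IH] i x xK.
    rewrite expr0 mulr1; apply: (@le_trans _ _ C).
      apply: HC; rewrite -[x](subrK x0) (le_trans (ler_normD _ _)) //.
      by rewrite lerD2r ltW.
    rewrite ler_peMr ?(ltW C0) //; exact: expR_mul_norm_ge1 (ltW M0).
  have -> : Y k.+2 i x - Y k.+1 i x =
      oint x0 (fun x => \sum_j A i j x * (Y k.+1 j x - Y k j x)) x.
    by rewrite AyB (ointB _ _ (lAyY k.+1 i) (lAyY k i)) /=; ring.
  have L0 : 0 <= M * (C * 2^-1 ^+ k).
    by rewrite mulr_ge0 ?mulr_ge0 ?exprn_ge0 ?invr_ge0 //; exact: ltW.
  apply: (le_trans (oint_exp_bound _ M0 L0 _ xK)).
  - by rewrite AyB; exact: (locintB (lAyY k.+1 i) (lAyY k i)).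
  - move=> z zK; rewrite -(mulrA M); apply: (HM i z _ (fun j => Y k.+1 j z - Y k j z)) => // j.
    by rewrite mulrAC; exact: IH.
  - rewrite le_eqVlt; apply/orP; left; apply/eqP; rewrite exprS; field; lra.
pose y i x := lim (Y k i x @[k --> \oo]).
have Yy (K : R) : exists C M, [/\ 0 < M, 0 <= C,
    (forall i x e (z : 'I_n -> R), `|x - x0| < K ->
      (forall j, `|z j| <= e) -> `|\sum_j A i j x * z j| <= M * e) &
    forall k i x, `|x - x0| < K ->
    `|Y k i x - y i x| <= C * expR (2 * M * `|x - x0|) * 2^-1 ^+ k].
  have [C [M [M0 C0 HM HY]]] := inc K; exists (2 * C), M; split => // [|k i x xK]; first lra.
  have [l Hl] := geometric_increments_cvg (fun k => HY k i x xK).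
  have -> : y i x = l.
    apply/cvg_lim => //; apply/subr_cvg0; apply/norm_cvg0P => /=.
    apply: (@squeeze_cvgr _ _ _ _ (fun=> 0) (fun k => 2 * (C * expR (2 * M * `|x - x0|)) * 2^-1 ^+ k)).
    - by apply: nearW => m; rewrite normr_ge0 Hl.
    - exact: cvg_cst.
    - exact: cvg_half_pow.
  by have := Hl k; rewrite !mulrA.
have Yc i x : Y k i x @[k --> \oo] --> y i x.
  have [C [M [M0 C0 HM HY]]] := Yy (`|x - x0| + 1).
  apply/subr_cvg0; apply/norm_cvg0P => /=.
  apply: (@squeeze_cvgr _ _ _ _ (fun=> 0) (fun k => C * expR (2 * M * `|x - x0|) * 2^-1 ^+ k)).
  - by apply: nearW => m; rewrite normr_ge0 HY // ltrDl.
  - exact: cvg_cst.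
  - exact: cvg_half_pow.
(* So far [y] is only a pointwise limit; measurability and local boundedness allow it to be
   integrated, and continuity then follows from the integral equation. *)
have my i : measurable_fun setT (y i).
  apply: (measurable_fun_cvg (h := fun k => Y k i)) => [k|x _]; last exact: Yc.
  exact: continuous_measurable_fun.
have ly i : locint (y i).
  apply: locint_bounded => // K.
  have [C [M [M0 C0 HM HY]]] := Yy (K + `|x0| + 1).
  have [S S0 HS] := continuous_family_bounded K cY0.
  exists (S + C * expR (2 * M * (K + `|x0| + 1))) => x xK.
  have xx : `|x - x0| < K + `|x0| + 1 by rewrite (le_lt_trans (ler_normB _ _)) //; lra.
  rewrite (_ : y i x = Y0 i x - (Y 0%N i x - y i x)); last by rewrite /=; ring.
  rewrite (le_trans (ler_normB _ _)) // lerD ?HS // (le_trans (HY 0%N i x xx)) //.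
  by rewrite expr0 mulr1 ler_wpM2l // ler_expR ler_wpM2l //; lra.
have lAy i : locint (Ay y i).
  by apply: locint_sum => j; apply: locintM.
(* The limit of the recursion: the defect is at most a constant times [2^-1 ^+ k] for every [k]. *)
have yE i x : y i x = Y0 i x + oint x0 (Ay y i) x.
  have [C [M [M0 C0 HM HY]]] := Yy (`|x - x0| + 1).
  have xx : `|x - x0| < `|x - x0| + 1 by rewrite ltrDl.
  apply/eqP; rewrite -subr_eq0; apply/eqP.
  apply: (@half_pow_eq0 (2 * C * expR (2 * M * `|x - x0|))) => k.
  have -> : y i x - (Y0 i x + oint x0 (Ay y i) x) = - (Y k.+1 i x - y i x) +
    oint x0 (fun x => \sum_j A i j x * (Y k j x - y j x)) x.
    by rewrite AyB (ointB _ _ (lAyY k i) (lAy i)) /=; ring.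
  apply: (le_trans (ler_normD _ _)); rewrite normrN.
  have L0 : 0 <= M * (C * 2^-1 ^+ k).
    by rewrite mulr_ge0 ?mulr_ge0 ?exprn_ge0 ?invr_ge0 //; exact: ltW.
  apply: (le_trans (lerD (HY k.+1 i x xx) (oint_exp_bound _ M0 L0 _ xx))).
  - by rewrite AyB; exact: (locintB (lAyY k i) (lAy i)).
  - move=> z zK; rewrite -(mulrA M); apply: (HM i z _ (fun j => Y k j z - y j z)) => // j.
    by rewrite mulrAC; exact: HY.
  - have -> : M * (C * 2^-1 ^+ k) / (2 * M) = C * 2^-1 ^+ k / 2 by field; lra.
    have e0 : 0 <= C * 2^-1 ^+ k * expR (2 * M * `|x - x0|).
      by rewrite !mulr_ge0 ?exprn_ge0 ?invr_ge0 ?expR_ge0.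
    rewrite exprS; move: e0; lra.
exists y => i; split.
  by rewrite yE oint0 addr0 /Y0 oint0 addr0.
have := primitiveD (primitive_oint x0 (lAy i)) (primitive_shift (c i) (primitive_oint x0 (lG i))).
by apply: primitive_eql => x; rewrite yE /Y0; ring.
Qed.
End LinearODE.

(** * The equation tau u = h as a system *)

Section System4.
Context {R : realType}.
Implicit Types (F G f g : R -> R) (a c d x : R).
Local Notation mu := (@lebesgue_measure R).

(** [N] depends only on the coefficients and the interval, and the equation is required only there,
    so the bound is uniform over solutions known merely near [x0]. *)
Lemma linear_system_bound n (A : 'I_n -> 'I_n -> R -> R) x0 (K : R) :
  (forall i j, continuous (A i j)) ->
  exists2 N, 0 < N & forall (y f : 'I_n -> R -> R) (C : R),
    (forall i, primitive (y i) (f i)) ->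
    (forall x i, `|x - x0| < K -> f i x = \sum_j A i j x * y j x) ->
    (forall i, `|y i x0| <= C) -> forall x i, `|x - x0| < K -> `|y i x| <= N * C.
Proof.
move=> cA.
have [S S0 HS] := continuous_family_bounded (K + `|x0|)
   (u := fun k : 'I_#|{: 'I_n * 'I_n}| => A (enum_val k).1 (enum_val k).2) (fun k => cA _ _).
pose M := S * n.+1%:R; have M0 : 0 < M by rewrite mulr_gt0.
exists (2 * expR (2 * M * K)); first by rewrite mulr_gt0 // expR_gt0.
move=> y f C py fA yC x i xK.
have C0 : 0 <= C := le_trans (normr_ge0 _) (yC i).
have := linear_ode_gronwall (K := K) M0 py _ yC xK i.
move=> H; apply: (le_trans (H _)); last first.
  rewrite mulrAC ler_wpM2r // ler_wpM2l // ler_expR ler_wpM2l ?mulr_ge0 // ltW //.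
move=> {x xK H} x e xK ye {}i; rewrite fA //.
have SA j : `|A i j x| <= S.
  have := HS (enum_rank (i, j)) x; rewrite enum_rankK /=; apply.
  rewrite -[x](subrK x0) (le_trans (ler_normD _ _)) //.
  by rewrite lerD2r ltW.
apply: (le_trans (ler_norm_sum _ _ _)).
have e0 : 0 <= e := le_trans (normr_ge0 _) (ye i).
apply: (@le_trans _ _ (\sum_(j < n) S * e)).
  by apply: ler_sum => j _; rewrite normrM; apply: ler_pM.
rewrite sumr_const card_ord -[leLHS]mulr_natr mulrAC ler_wpM2r // ler_wpM2l ?ler_nat //.
exact: ltW.
Qed.

Definition quad {T} (a1 a2 a3 a4 : T) (i : 'I_4) : T := nth a1 [:: a1; a2; a3; a4] i.

(* [tau u = h] as a first-order system for [u] and [v := u' - b u]. *)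
Definition rsol (b h u v : R -> R) :=
  primitive u (fun x => b x * u x + v x) /\
  primitive v (fun x => - (b x) ^+ 2 * u x - b x * v x - h x).

(* The real form, in the variables [ur, vr, ui, vi], of [tau u = z u]. *)
Definition system4 (b : R -> R) (zr zi : R) (i j : 'I_4) (x : R) : R :=
  quad (quad (b x) 1 0 0)
       (quad (- (b x) ^+ 2 - zr) (- b x) zi 0)
       (quad 0 0 (b x) 1)
       (quad (- zi) 0 (- (b x) ^+ 2 - zr) (- b x)) i j.

Lemma continuous_system4 (b : R -> R) zr zi i j : continuous b ->
  continuous (system4 b zr zi i j).
Proof.
move=> cb x; have cs (k : R) : (fun=> k : R) y @[y --> x] --> k by exact: cvg_cst.
have cb2 : - (b y) ^+ 2 - zr @[y --> x] --> - (b x) ^+ 2 - zr.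
  apply: cvgB; last exact: cvg_cst.
  by apply: cvgN; rewrite (_ : (fun _ => _) = (fun y => b y * b y)) //; apply: cvgM; exact: cb.
have cbN : - b y @[y --> x] --> - b x by apply: cvgN; exact: cb.
rewrite /continuous_at /system4 /quad.
by case: i => [[|[|[|[|]]]]] //= _; case: j => [[|[|[|[|]]]]] //= _; exact: cb.
Qed.

Lemma system4E b zr zi i x (y1 y2 y3 y4 : R) :
  \sum_j system4 b zr zi i j x * quad y1 y2 y3 y4 j =
  quad (b x * y1 + y2)
     ((- (b x) ^+ 2 - zr) * y1 - b x * y2 + zi * y3)
     (b x * y3 + y4)
     (- zi * y1 + (- (b x) ^+ 2 - zr) * y3 - b x * y4) i.
Proof.
rewrite !big_ord_recl big_ord0 addr0 /system4 /quad /=.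
by case: i => [[|[|[|[|]]]]] //= _; ring.
Qed.

Lemma quad_ind (P : 'I_4 -> Prop) : P (@Ordinal 4 0 isT) -> P (@Ordinal 4 1 isT) ->
  P (@Ordinal 4 2 isT) -> P (@Ordinal 4 3 isT) -> forall i, P i.
Proof.
move=> p0 p1 p2 p3 i; have := ltn_ord i.
case: i => [[|[|[|[|]]]]] //= lti _.
- by rewrite (_ : Ordinal lti = @Ordinal 4 0 isT) //; exact/val_inj.
- by rewrite (_ : Ordinal lti = @Ordinal 4 1 isT) //; exact/val_inj.
- by rewrite (_ : Ordinal lti = @Ordinal 4 2 isT) //; exact/val_inj.
- by rewrite (_ : Ordinal lti = @Ordinal 4 3 isT) //; exact/val_inj.
Qed.

(* [u = ur + i ui] solves [tau u = g + z u]. *)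
Definition csol (b : R -> R) (zr zi : R) (gr gi ur vr ui vi : R -> R) :=
  rsol b (fun x => gr x + (zr * ur x - zi * ui x)) ur vr /\
  rsol b (fun x => gi x + (zr * ui x + zi * ur x)) ui vi.

Lemma csol_exists (b : R -> R) zr zi gr gi x0 (c1 c2 c3 c4 : R) : continuous b -> locint gr -> locint gi ->
  exists ur vr ui vi, csol b zr zi gr gi ur vr ui vi /\
    [/\ ur x0 = c1, vr x0 = c2, ui x0 = c3 & vi x0 = c4].
Proof.
move=> cb lr li.
pose G := quad (fun=> 0) (fun x => - gr x) (fun=> 0) (fun x => - gi x).
have lG i : locint (G i).
  by move: i; apply: quad_ind; rewrite /G /quad /=; do ?[exact: locint_cst|exact: locintN].
have [y Hy] := @linear_ode_exists R 4 (system4 b zr zi) G x0 (quad c1 c2 c3 c4)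
  (fun i j => @continuous_system4 b zr zi i j cb) lG.
pose o k (lk : (k < 4)%N) := y (Ordinal lk).
have yE x : y ^~ x = quad (o 0%N isT x) (o 1%N isT x) (o 2%N isT x) (o 3%N isT x).
  apply/funext => i; move: i; exact: quad_ind.
exists (o 0%N isT), (o 1%N isT), (o 2%N isT), (o 3%N isT); split; last first.
  by split; exact: (Hy _).1.
have H i : primitive (y i) (fun x => quad (b x * (o 0%N isT x) + (o 1%N isT x))
     ((- (b x) ^+ 2 - zr) * (o 0%N isT x) - b x * (o 1%N isT x) + zi * (o 2%N isT x))
     (b x * (o 2%N isT x) + (o 3%N isT x))
     (- zi * (o 0%N isT x) + (- (b x) ^+ 2 - zr) * (o 2%N isT x) - b x * (o 3%N isT x)) i + G i x).
  apply: primitive_eq (Hy i).2 => x; congr (_ + _).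
  rewrite -system4E; apply: eq_bigr => j _; congr (_ * _).
  by rewrite -yE.
split; split.
- by apply: primitive_eq (H (@Ordinal 4 0 isT)) => x; rewrite /G /quad /=; ring.
- by apply: primitive_eq (H (@Ordinal 4 1 isT)) => x; rewrite /G /quad /=; ring.
- by apply: primitive_eq (H (@Ordinal 4 2 isT)) => x; rewrite /G /quad /=; ring.
- by apply: primitive_eq (H (@Ordinal 4 3 isT)) => x; rewrite /G /quad /=; ring.
Qed.

(** With [C = 0] this is uniqueness; with small [C] it is continuous dependence on the data at
    [x0]. *)
Lemma csol_bound (b : R -> R) zr zi x0 K : continuous b -> exists2 N, 0 < N &
  forall ur vr ui vi fr kr fi ki C,
  primitive ur fr -> primitive vr kr -> primitive ui fi -> primitive vi ki ->
  (forall x, `|x - x0| < K -> [/\ fr x = b x * ur x + vr x,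
     kr x = - (b x) ^+ 2 * ur x - b x * vr x - (zr * ur x - zi * ui x),
     fi x = b x * ui x + vi x &
     ki x = - (b x) ^+ 2 * ui x - b x * vi x - (zr * ui x + zi * ur x)]) ->
  `|ur x0| <= C -> `|vr x0| <= C -> `|ui x0| <= C -> `|vi x0| <= C ->
  forall x, `|x - x0| < K ->
    [/\ `|ur x| <= N * C, `|vr x| <= N * C, `|ui x| <= N * C & `|vi x| <= N * C].
Proof.
move=> cb; have [N N0 HN] := linear_system_bound x0 K
  (fun i j => @continuous_system4 b zr zi i j cb).
exists N => // ur vr ui vi fr kr fi ki C pur pvr pui pvi H Cur Cvr Cui Cvi.
have := HN (quad ur vr ui vi) (quad fr kr fi ki) C.
have /[swap]/[apply] : forall i, primitive (quad ur vr ui vi i) (quad fr kr fi ki i).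
  by apply: quad_ind.
have /[swap]/[apply] : forall x i, `|x - x0| < K -> quad fr kr fi ki i x =
    \sum_j system4 b zr zi i j x * quad ur vr ui vi j x.
  move=> x i xK; have [e1 e2 e3 e4] := H x xK.
  transitivity (\sum_j system4 b zr zi i j x * quad (ur x) (vr x) (ui x) (vi x) j); last first.
    by apply: eq_bigr => j _; congr (_ * _); move: j; exact: quad_ind.
  rewrite system4E; move: i; apply: quad_ind; rewrite /quad /=.
  - by rewrite e1.
  - by rewrite e2; ring.
  - by rewrite e3.
  - by rewrite e4; ring.
have /[swap]/[apply] : forall i, `|quad ur vr ui vi i x0| <= C by exact: quad_ind.
move=> B x xK; split.
- exact: (B x (@Ordinal 4 0 isT) xK).
- exact: (B x (@Ordinal 4 1 isT) xK).
- exact: (B x (@Ordinal 4 2 isT) xK).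
- exact: (B x (@Ordinal 4 3 isT) xK).
Qed.

Lemma rsolB b h1 u1 v1 h2 u2 v2 : rsol b h1 u1 v1 -> rsol b h2 u2 v2 ->
  rsol b (fun x => h1 x - h2 x) (fun x => u1 x - u2 x) (fun x => v1 x - v2 x).
Proof.
move=> [p1 q1] [p2 q2]; split.
- by apply: primitive_eq (primitiveB p1 p2) => x; ring.
- by apply: primitive_eq (primitiveB q1 q2) => x; ring.
Qed.

Lemma rsolD b h1 u1 v1 h2 u2 v2 : rsol b h1 u1 v1 -> rsol b h2 u2 v2 ->
  rsol b (fun x => h1 x + h2 x) (fun x => u1 x + u2 x) (fun x => v1 x + v2 x).
Proof.
move=> [p1 q1] [p2 q2]; split.
- by apply: primitive_eq (primitiveD p1 p2) => x; ring.
- by apply: primitive_eq (primitiveD q1 q2) => x; ring.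
Qed.

Lemma rsolZ b k h u v : rsol b h u v ->
  rsol b (fun x => k * h x) (fun x => k * u x) (fun x => k * v x).
Proof.
move=> [p q]; split.
- by apply: primitive_eq (primitiveZ k p) => x; ring.
- by apply: primitive_eq (primitiveZ k q) => x; ring.
Qed.

Lemma rsol_eq b h k u v : h =1 k -> rsol b h u v -> rsol b k u v.
Proof. by move=> /funext ->. Qed.

Lemma rsol_continuous b h u v : rsol b h u v -> continuous u /\ continuous v.
Proof. by move=> [/primitive_continuous ? /primitive_continuous]. Qed.

Lemma rsol_locint b h u v : continuous b -> rsol b h u v -> locint h.
Proof.
move=> cb su; have [cu cv] := rsol_continuous su; have [_ [lq _]] := su.
have l1 : locint (fun x => - (b x) ^+ 2 * u x - b x * v x).
  have -> : (fun x => - (b x) ^+ 2 * u x - b x * v x) =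
    (fun x => - (b x * (b x * u x)) - b x * v x) by apply/funext => x; ring.
  apply: continuous_locint => x; apply: cvgB; last by apply: cvgM; [exact: cb|exact: cv].
  by apply: cvgN; apply: cvgM; [exact: cb|apply: cvgM; [exact: cb|exact: cu]].
by rewrite (_ : h = fun x => (- (b x) ^+ 2 * u x - b x * v x) -
  (- (b x) ^+ 2 * u x - b x * v x - h x)); [exact: locintB|apply/funext => x; ring].
Qed.

Lemma rsol_green b h1 u1 v1 h2 u2 v2 : rsol b h1 u1 v1 -> rsol b h2 u2 v2 ->
  primitive (fun x => u1 x * v2 x - v1 x * u2 x) (fun x => h1 x * u2 x - u1 x * h2 x).
Proof.
move=> [p1 q1] [p2 q2].
by apply: primitive_eq (primitiveB (primitiveM p1 q2) (primitiveM q1 p2)) => x; ring.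
Qed.

(** Since [(X u)' - b X u = X v + X' u], no derivative of [b] appears, and [u'] enters the error
    only through [X' u']. *)
Lemma rsol_cutoff b h u v (X X' X'' : R -> R) : rsol b h u v ->
  primitive X X' -> primitive X' X'' ->
  rsol b (fun x => X x * h x - 2 * X' x * (b x * u x + v x) - X'' x * u x)
    (fun x => X x * u x) (fun x => X x * v x + X' x * u x).
Proof.
move=> [p q] dX dX'; split.
- by apply: primitive_eq (primitiveM dX p) => x; ring.
- by apply: primitive_eq (primitiveD (primitiveM dX q) (primitiveM dX' p)) => x; ring.
Qed.

End System4.

(** * Local energy estimates *)

Section Energy.
Context {R : realType}.
Implicit Types (F G f g b h u v : R -> R) (a c d x : R).
Local Notation mu := (@lebesgue_measure R).

Definition hump a x : R := (x - a) * (a + 1 - x).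

Lemma hump_primitive a : primitive (hump a) (fun x => 2 * a + 1 - 2 * x).
Proof.
apply: primitive_of_derive => x; last first.
  by apply: cvgB; [exact: cvg_cst|apply: cvgM; [exact: cvg_cst|exact: cvg_id]].
apply: is_derive_eq; rewrite /GRing.scale /=; ring.
Qed.

Lemma hump_bounds a x : a <= x -> x <= a + 1 ->
  [/\ 0 <= hump a x, hump a x <= 1 / 4 & `|2 * a + 1 - 2 * x| <= 1].
Proof.
move=> ax xa; rewrite /hump; split; [by rewrite mulr_ge0 // subr_ge0| |].
  by have := sqr_ge0 (2 * (x - a) - 1); rewrite expr2 => ?; nra.
by rewrite ler_norml; apply/andP; split; lra.
Qed.

Lemma locint_sqr f : continuous f -> locint (fun x => f x ^+ 2).
Proof. by move=> cf; apply: continuous_locint => x; rewrite /continuous_at expr2; apply: cvgM; exact: cf. Qed.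

Lemma le_Rintegral_itv f g a d : locint f -> locint g ->
  (forall x, a <= x -> x <= d -> f x <= g x) ->
  \int[mu]_(x in `[a, d]) f x <= \int[mu]_(x in `[a, d]) g x.
Proof.
move=> lf lg fg; apply: le_Rintegral => //.
by move=> x /=; rewrite in_itv /= => /andP[? ?]; exact: fg.
Qed.

Lemma Rintegral_itvD f g a d : locint f -> locint g ->
  \int[mu]_(x in `[a, d]) (f x + g x) = \int[mu]_(x in `[a, d]) f x + \int[mu]_(x in `[a, d]) g x.
Proof. by move=> lf lg; rewrite RintegralD. Qed.

Lemma Rintegral_itvZ (k : R) f a d : locint f ->
  \int[mu]_(x in `[a, d]) (k * f x) = k * \int[mu]_(x in `[a, d]) f x.
Proof. by move=> lf; rewrite RintegralZl. Qed.

Lemma Rintegral_itv_cst (k a d : R) : a <= d -> \int[mu]_(x in `[a, d]) k = k * (d - a).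
Proof.
move=> ad; have [_ P] : primitive (fun x : R => k * x) (fun=> k).
  apply: primitive_of_derive => x; last exact: cvg_cst.
  by apply: is_derive_eq; rewrite /GRing.scale /=; ring.
by rewrite -P // mulrBr.
Qed.

Lemma Rintegral_itv_sub f a c d : locint f -> (forall x, 0 <= f x) -> a <= c -> c <= d ->
  \int[mu]_(x in `[a, c]) f x <= \int[mu]_(x in `[a, d]) f x.
Proof.
move=> lf f0 ac cd; rewrite (Rintegral_itv_cat lf ac cd) lerDl.
exact: Rintegral_ge0.
Qed.

(** The weight [1 / (20 * M)] in [K] makes [5 * K * Q] contain at most [E / 4], which is absorbed by
    [E / 2]. *)
Lemma energy_arith (M Q K E U H : R) : 1 <= M -> 0 <= Q -> 0 <= E -> 0 <= U -> 0 <= H ->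
  Q <= M -> K = (1 + 20 * M) * U + E / (20 * M) ->
  2^-1 * E + - (5 * K) * Q + -6 * U + -1 * H <= 0 ->
  E <= 4 * (5 * M * (1 + 20 * M) + 6) * (U + H).
Proof.
move=> M1 Q0 E0 U0 H0 QM KE ineq.
have M0 : 0 < 20 * M by lra.
have K0 : 0 <= K.
  by rewrite KE; apply: addr_ge0; [apply: mulr_ge0 => //; lra|apply: divr_ge0 => //; lra].
have KQ : K * Q <= K * M by rewrite ler_wpM2l.
have KM : K * M = (1 + 20 * M) * M * U + E / 20 by rewrite KE; field; lra.
have : 0 <= M * (1 + 20 * M) * H by apply: mulr_ge0 => //; apply: mulr_ge0; lra.
by lra.
Qed.

Section interval.
Context (b h u v : R -> R) (a : R).
Context (cb : continuous b) (su : rsol b h u v) (lh2 : locint (fun x => h x ^+ 2)).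
Local Notation p := (fun x => b x * u x + v x).
Local Notation phi := (hump a).
Local Notation E := (\int[mu]_(x in `[a, a + 1]) (phi x * p x) ^+ 2).
Local Notation U := (\int[mu]_(x in `[a, a + 1]) u x ^+ 2).
Local Notation H := (\int[mu]_(x in `[a, a + 1]) h x ^+ 2).

Let cu : continuous u := (rsol_continuous su).1.
Let cv : continuous v := (rsol_continuous su).2.
Let cphi : continuous phi := primitive_continuous (hump_primitive a).
Let cp : continuous p.
Proof. by move=> x; apply: cvgD; [apply: cvgM; [exact: cb|exact: cu]|exact: cv]. Qed.
Let lu2 : locint (fun x => u x ^+ 2) := locint_sqr cu.
Let lE : locint (fun x => (phi x * p x) ^+ 2).
Proof. by apply: locint_sqr => x; apply: cvgM; [exact: cphi|exact: cp]. Qed.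

(** The square vanishes at [a], so it is the integral of its derivative [2 phi u (phi' u + phi p)];
    Young's inequality with parameter [e] decides how much of [E] enters. *)
Lemma hump_sqr_le x (e : R) : a <= x -> x <= a + 1 -> 0 < e ->
  (phi x * u x) ^+ 2 <= (1 + e^-1) * U + e * E.
Proof.
move=> ax xa e0.
have e1 : 0 < e^-1 by rewrite invr_gt0.
have pA := primitiveM (hump_primitive a) su.1.
have [lq q] := primitiveM pA pA.
have lr : locint (fun x => (1 + e^-1) * u x ^+ 2 + e * (phi x * p x) ^+ 2).
  by apply: locintD; exact: locintZ.
have -> : (phi x * u x) ^+ 2 = phi x * u x * (phi x * u x) - phi a * u a * (phi a * u a).
  by rewrite /hump subrr !mul0r subr0 expr2.
rewrite q //; apply: (@le_trans _ _ (\int[mu]_(x in `[a, x]) ((1 + e^-1) * u x ^+ 2 + e * (phi x * p x) ^+ 2))).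
  apply: le_Rintegral_itv => // y ay yx.
  have ya1 : y <= a + 1 by exact: le_trans xa.
  have [f0 f1 f'1] := hump_bounds ay ya1.
  move: f0 f1 f'1; move: (phi y) (2 * a + 1 - 2 * y) => f f' f0 f1 f'1.
  rewrite /=; move: (b y * u y + v y) => P; move: (u y) => V.
  have : 0 <= (f * V - e * (f * P)) ^+ 2 * e^-1 by rewrite mulr_ge0 ?sqr_ge0 // ltW.
  have -> : (f * V - e * (f * P)) ^+ 2 * e^-1 = e^-1 * f ^+ 2 * V ^+ 2 - 2 * (f * V) * (f * P) + e * (f * P) ^+ 2.
    by field; lra.
  have ff : f ^+ 2 <= 1 by rewrite expr2; nra.
  have : e^-1 * f ^+ 2 * V ^+ 2 <= e^-1 * V ^+ 2.
    by rewrite ler_wpM2r ?sqr_ge0 // ler_piMr // ltW.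
  have : 2 * (f * f') * V ^+ 2 <= V ^+ 2.
    rewrite ler_piMl ?sqr_ge0 //; move: f'1; rewrite ler_norml => /andP[? ?]; nra.
  by move: (e^-1) => i; lra.
rewrite -!Rintegral_itvZ // -Rintegral_itvD //; last by exact: locintZ.
  by apply: Rintegral_itv_sub => // y; rewrite addr_ge0 // mulr_ge0 ?sqr_ge0 ?addr_ge0 // ltW.
exact: locintZ.
Qed.

(* Since [u' = b u + v], test with [hump ^ 2] and integrate by parts; only [b - b0] survives. *)
Lemma energy (b0 M : R) : 1 <= M ->
  \int[mu]_(x in `[a, a + 1]) (b x - b0) ^+ 2 <= M ->
  E <= 4 * (5 * M * (1 + 20 * M) + 6) * (U + H).
Proof.
move=> M1 bM; have M0 : 0 < 20 * M by lra.
pose e := (20 * M)^-1; have e0 : 0 < e by rewrite invr_gt0.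
have eK : e^-1 = 20 * M by rewrite /e invrK.
pose K := (1 + e^-1) * U + e * E.
have AK x : a <= x -> x <= a + 1 -> (phi x * u x) ^+ 2 <= K by move=> ? ?; exact: hump_sqr_le.
have lb2 : locint (fun x => (b x - b0) ^+ 2).
  by apply: locint_sqr => x; apply: cvgB; [exact: cb|exact: cvg_cst].
have pA := primitiveM (hump_primitive a) su.1.
(* [v + b0 u] is [u' - (b - b0) u]. The product of [phi u] and [phi (v + b0 u)] vanishes at both
   ends, so its derivative has integral 0. *)
have pw := primitiveM (hump_primitive a) (primitiveD su.2 (primitiveZ b0 su.1)).
have [lq q] := primitiveM pA pw.
have fa : phi a = 0 by rewrite /hump; ring.
have fa1 : phi (a + 1) = 0 by rewrite /hump; ring.
have aa1 : a <= a + 1 by rewrite lerDl.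
have q0 := q a (a + 1) aa1; rewrite fa fa1 !mul0r subrr in q0.
have l1 : locint (fun x => 2^-1 * (phi x * p x) ^+ 2) by exact: locintZ.
have l2 : locint (fun x => (- (5 * K)) * (b x - b0) ^+ 2) by exact: locintZ.
have l3 : locint (fun x => (- 6) * u x ^+ 2) by exact: locintZ.
have l4 : locint (fun x => (-1) * h x ^+ 2) by exact: locintZ.
have l12 := locintD l1 l2; have l123 := locintD l12 l3; have l := locintD l123 l4.
have := @le_Rintegral_itv _ _ a (a + 1) l lq.
rewrite -q0 Rintegral_itvD // Rintegral_itvD // Rintegral_itvD // !Rintegral_itvZ // => ineq.
have {}ineq : 2^-1 * E + - (5 * K) * \int[mu]_(x in `[a, a + 1]) (b x - b0) ^+ 2 + -6 * U + -1 * H <= 0.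
  apply: ineq => x ax xa; have := AK x ax xa.
  have [f0 f1 f'1] := hump_bounds ax xa; move: f0 f1 f'1.
  rewrite /=; move: (b x) (v x) (h x) => B V Hx.
  move: (phi x) (2 * a + 1 - 2 * x) => f f'.
  move: (u x) => y f0 f1 f'1 Ak.
  have f2 : f' ^+ 2 <= 1.
    by move: f'1; rewrite ler_norml expr2 => /andP[? ?]; nra.
  have ff2 : f ^+ 2 <= 1 by rewrite expr2; nra.
  pose P := f * (B * y + V); pose be := B - b0.
  (* The two cross terms containing [P] take a quarter of [P ^+ 2] each, leaving one half. The
     squares cost [5 * be ^+ 2 * (f * y) ^+ 2], where [(f * y) ^+ 2] is at most [K], and at most
     [6 * y ^+ 2 + Hx ^+ 2]. *)
  have h1 : 0 <= (P / 2 + 2 * f' * y) ^+ 2 by exact: sqr_ge0.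
  have h2 : 0 <= (P / 2 - 2 * be * (f * y)) ^+ 2 by exact: sqr_ge0.
  have h3 : 0 <= (f' * y - be * (f * y)) ^+ 2 by exact: sqr_ge0.
  have h4 : 0 <= (f ^+ 2 * y - Hx) ^+ 2 by exact: sqr_ge0.
  have h5 : f' ^+ 2 * y ^+ 2 <= y ^+ 2 by rewrite ler_piMl ?sqr_ge0.
  have h6 : (f ^+ 2) ^+ 2 * y ^+ 2 <= y ^+ 2.
    by rewrite ler_piMl ?sqr_ge0 // exprn_ile1 ?sqr_ge0.
  have h7 : be ^+ 2 * (f * y) ^+ 2 <= be ^+ 2 * K by rewrite ler_wpM2l ?sqr_ge0.
  have h8 := sqr_ge0 y; have h9 := sqr_ge0 Hx.
  by move: h1 h2 h3 h4 h5 h6 h7 h8 h9; rewrite /P /be; lra.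
have KE : K = (1 + 20 * M) * U + E / (20 * M) by rewrite /K eK /e; ring.
apply: (energy_arith M1 _ _ _ _ bM KE ineq); apply: Rintegral_ge0 => x _; exact: sqr_ge0.
Qed.

(** Again the square is the integral of its derivative. As [v' = - b p - h], the second factor [phi]
    allows [phi v] to be written as [phi p - b phi u], which [E] and [U] control. *)
Lemma hump_data_le (B : R) x : (forall y, a <= y -> y <= a + 1 -> `|b y| <= B) ->
  a <= x -> x <= a + 1 ->
  (phi x * (phi x * v x)) ^+ 2 <= (10 + 2 * B ^+ 2) * E + 10 * B ^+ 2 * U + 2 * H.
Proof.
move=> bB ax xa.
have pZ := primitiveM (hump_primitive a) (primitiveM (hump_primitive a) su.2).
have [lq q] := primitiveM pZ pZ.
have l1 : locint (fun x => (10 + 2 * B ^+ 2) * (phi x * p x) ^+ 2) by exact: locintZ.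
have l2 : locint (fun x => (10 * B ^+ 2) * u x ^+ 2) by exact: locintZ.
have l3 : locint (fun x => 2 * h x ^+ 2) by exact: locintZ.
have l12 := locintD l1 l2; have l := locintD l12 l3.
have fa : phi a = 0 by rewrite /hump; ring.
have qx := q a x ax; rewrite fa !mul0r subr0 in qx.
rewrite expr2 qx.
apply: (@le_trans _ _ (\int[mu]_(x in `[a, x]) ((10 + 2 * B ^+ 2) * (phi x * p x) ^+ 2 +
   (10 * B ^+ 2) * u x ^+ 2 + 2 * h x ^+ 2))).
  apply: le_Rintegral_itv => // y ay yx.
  have ya1 : y <= a + 1 by exact: le_trans xa.
  have [f0 f1 f'1] := hump_bounds ay ya1; have bb := bB y ay ya1; move: f0 f1 f'1 bb.
  rewrite /=; move: (b y) (v y) (h y) => c V Hx.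
  move: (phi y) (2 * a + 1 - 2 * y) => f f'.
  move: (u y) => z f0 f1 f'1 cB.
  have B0 : 0 <= B := le_trans (normr_ge0 _) cB.
  have c2 : c ^+ 2 <= B ^+ 2 by rewrite -real_normK ?num_real // lerXn2r ?nnegrE.
  pose P := f * (c * z + V); pose W := f * V.
  have WE : W = P - c * (f * z) by rewrite /W /P; ring.
  have ff2 : f ^+ 2 <= 1 by rewrite expr2; nra.
  have h1 : 0 <= (P + c * (f * z)) ^+ 2 by exact: sqr_ge0.
  have h2 : (c * (f * z)) ^+ 2 <= B ^+ 2 * z ^+ 2.
    rewrite exprMn; apply: ler_pM => //; try exact: sqr_ge0.
    by rewrite exprMn ler_piMl ?sqr_ge0.
  have W2 : W ^+ 2 <= 2 * P ^+ 2 + 2 * (B ^+ 2 * z ^+ 2) by rewrite WE; lra.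
  have h3 : 4 * (f * f') * W ^+ 2 <= 4 * W ^+ 2.
    rewrite -mulrA ler_wpM2l // ler_piMl ?sqr_ge0 //.
    by move: f'1; rewrite ler_norml => /andP[? ?]; nra.
  have h4 : 0 <= (f * W + f * (c * P + f * Hx)) ^+ 2 by exact: sqr_ge0.
  have h5 : 0 <= (c * P - f * Hx) ^+ 2 by exact: sqr_ge0.
  have h6 : f ^+ 2 * W ^+ 2 <= W ^+ 2 by rewrite ler_piMl ?sqr_ge0.
  have h7 : f ^+ 2 * Hx ^+ 2 <= Hx ^+ 2 by rewrite ler_piMl ?sqr_ge0.
  have h8 : c ^+ 2 * P ^+ 2 <= B ^+ 2 * P ^+ 2 by rewrite ler_wpM2r ?sqr_ge0.
  have h9 : f ^+ 2 * (c * P + f * Hx) ^+ 2 <= (c * P + f * Hx) ^+ 2 by rewrite ler_piMl ?sqr_ge0.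
  by move: W2 h3 h4 h5 h6 h7 h8 h9; rewrite /W /P; lra.
rewrite Rintegral_itvD // Rintegral_itvD // !Rintegral_itvZ //.
apply: lerD; last by rewrite ler_wpM2l //; apply: Rintegral_itv_sub => // y; exact: sqr_ge0.
apply: lerD; apply: ler_wpM2l.
- by have := sqr_ge0 B; lra.
- by apply: Rintegral_itv_sub => // y; exact: sqr_ge0.
- by have := sqr_ge0 B; lra.
- by apply: Rintegral_itv_sub => // y; exact: sqr_ge0.
Qed.
End interval.

Lemma midpoint_arith (B2 c U H E y z : R) : 0 <= B2 -> 0 <= c -> 0 <= U -> 0 <= H -> 0 <= E ->
  E <= c * (U + H) -> (1 / 4 * y) ^+ 2 <= (1 + 1^-1) * U + 1 * E ->
  (1 / 4 * (1 / 4 * z)) ^+ 2 <= (10 + 2 * B2) * E + 10 * B2 * U + 2 * H ->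
  y ^+ 2 <= (16 * (2 + c) + 256 * ((10 + 2 * B2) * c + 10 * B2 + 2)) * (U + H) /\
  z ^+ 2 <= (16 * (2 + c) + 256 * ((10 + 2 * B2) * c + 10 * B2 + 2)) * (U + H).
Proof.
rewrite invr1 => B20 c0 U0 H0 E0 Ec h1 h2.
have h3 : B2 * E <= B2 * (c * (U + H)) by rewrite ler_wpM2l.
have h4 : 0 <= B2 * H by rewrite mulr_ge0.
have h5 : 0 <= B2 * U by rewrite mulr_ge0.
have h6 : 0 <= c * (U + H) by apply: mulr_ge0 => //; exact: addr_ge0.
have h7 : 0 <= B2 * (c * (U + H)) by exact: mulr_ge0.
by split; lra.
Qed.

(** [phi] is [1 / 4] at the midpoint, so the two pointwise bounds control the initial data there by
    [L^2] norms. Here [b0 = 0] and [M] comes from the maximum of [|b|], so the constant depends on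
    the place. *)
Lemma rsol_midpoint_le b a : continuous b -> exists2 C, 0 < C & forall h u v,
  rsol b h u v -> locint (fun x => h x ^+ 2) ->
  u (a + 1 / 2) ^+ 2 <= C * (\int[mu]_(x in `[a, a + 1]) u x ^+ 2 + \int[mu]_(x in `[a, a + 1]) h x ^+ 2) /\
  v (a + 1 / 2) ^+ 2 <= C * (\int[mu]_(x in `[a, a + 1]) u x ^+ 2 + \int[mu]_(x in `[a, a + 1]) h x ^+ 2).
Proof.
move=> cb; have [B B0 HB] := continuous_bounded_itv a (a + 1) cb.
pose M := B ^+ 2 + 1; have M1 : 1 <= M by rewrite /M lerDr sqr_ge0.
pose c := 4 * (5 * M * (1 + 20 * M) + 6).
have c0 : 0 < c.
  by rewrite /c mulr_gt0 // ltr_wpDl // mulr_ge0 //; lra.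
exists (16 * (2 + c) + 256 * ((10 + 2 * B ^+ 2) * c + 10 * B ^+ 2 + 2)).
  by have := sqr_ge0 B; have := mulr_ge0 (sqr_ge0 B) (ltW c0); lra.
move=> h u v su lh2.
have am : a <= a + 1 / 2 by lra.
have ma : a + 1 / 2 <= a + 1 by lra.
have := hump_data_le cb su lh2 HB am ma.
have := hump_sqr_le cb su am ma ltr01.
have bM : \int[mu]_(x in `[a, a + 1]) (b x - 0) ^+ 2 <= M.
  apply: (@le_trans _ _ (\int[mu]_(x in `[a, a + 1]) (B ^+ 2))).
    apply: le_Rintegral_itv; [|exact: locint_cst|].
      by apply: locint_sqr => x; apply: cvgB; [exact: cb|exact: cvg_cst].
    move=> x ax xa; rewrite subr0 -real_normK ?num_real // lerXn2r ?nnegrE ?(ltW B0) //.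
    exact: HB.
  by rewrite Rintegral_itv_cst ?lerDl // addrC addKr mulr1 /M lerDl.
have := energy cb su lh2 M1 bM; rewrite -/c.
have -> : hump a (a + 1 / 2) = 1 / 4 by rewrite /hump; field.
have U0 : 0 <= \int[mu]_(x in `[a, a + 1]) u x ^+ 2 by apply: Rintegral_ge0 => x _; exact: sqr_ge0.
have H0 : 0 <= \int[mu]_(x in `[a, a + 1]) h x ^+ 2 by apply: Rintegral_ge0 => x _; exact: sqr_ge0.
have E0 : 0 <= \int[mu]_(x in `[a, a + 1]) (hump a x * (b x * u x + v x)) ^+ 2.
  by apply: Rintegral_ge0 => x _; exact: sqr_ge0.
move=> Ec h1 h2; exact: (midpoint_arith (sqr_ge0 B) (ltW c0) U0 H0 E0 Ec h1 h2).
Qed.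
End Energy.

(** * Cutoffs and symmetry *)

Section Cutoff.
Context {R : realType}.
Implicit Types (F G f g b h u v : R -> R) (a c d x : R).
Local Notation mu := (@lebesgue_measure R).

Lemma ae_neq a : {ae mu, forall x, x != a}.
Proof.
exists [set a]; split; first exact: measurable_set1.
  exact: lebesgue_measure_set1.
by move=> x /= /negP; rewrite negbK => /eqP.
Qed.

Definition ramp a x : R := clamp a (a + 1) x - a.

Lemma ramp_lt a x : x <= a -> ramp a x = 0.
Proof.
by move=> xa; rewrite /ramp /clamp max_l // min_r ?subrr // lerDl.
Qed.

Lemma ramp_gt a x : a + 1 <= x -> ramp a x = 1.
Proof.
move=> ax; rewrite /ramp /clamp min_l; first by rewrite addrC addKr.
by rewrite le_max ax orbT.
Qed.

Lemma ramp_mid a x : a <= x -> x <= a + 1 -> ramp a x = x - a.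
Proof. by move=> ax xa; rewrite /ramp clamp_id. Qed.

Lemma ramp_bounds a x : 0 <= ramp a x <= 1.
Proof.
have a1 : a <= a + 1 by rewrite lerDl.
have /andP[h1 h2] := clamp_itv x a1; rewrite /ramp; apply/andP; split; lra.
Qed.

(** Absolute continuity provides some density, which is then identified away from the two
    corners. *)
Lemma primitive_ramp a : primitive (ramp a) (\1_(`[a, a + 1[) : R -> R).
Proof.
have pid : primitive (fun x : R => x) (fun=> 1).
  by apply: primitive_of_derive => x; exact: cvg_cst.
have a1 : a <= a + 1 by rewrite lerDl.
have [g [pg dg]] := ac_on_primitive a1 (primitive_ac a (a + 1) pid).
have pr : primitive (ramp a) g.
  by apply: primitive_eql (primitive_shift (- a) pg) => x.
have dr := primitive_ae_is_derive pr.
apply: primitive_ae_eq pr _ _; first exact: measurable_indic.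
apply: ae_imp3 (ae_neq a) (ae_neq (a + 1)) dr => x xa xa1 drx.
rewrite -(@derive_val _ _ _ _ _ _ _ drx) indicE mem_setE /= in_itv /=.
case: (ltP x a) => [xlt|xge].
  rewrite /=; have : is_derive x 1 (ramp a) 0.
    apply: near_eq_is_derive (is_derive_cst 0 x 1); near=> y.
    by rewrite ramp_lt // ltW //; near: y; exact: lt_nbhsl.
  by move=> ?; rewrite derive_val.
have ax : a < x by rewrite lt_neqAle eq_sym xa.
case: (ltP x (a + 1)) => [xlt|xge1] /=.
  have : is_derive x 1 (ramp a) 1.
    have h := is_deriveB (is_derive_id x 1) (is_derive_cst a x 1); rewrite subr0 in h.
    apply: near_eq_is_derive h; near=> y.
    rewrite ramp_mid //=; apply: ltW; near: y; [exact: lt_nbhsr|exact: lt_nbhsl].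
  by move=> ?; rewrite derive_val.
have ax1 : a + 1 < x by rewrite lt_neqAle eq_sym xa1.
have : is_derive x 1 (ramp a) 0.
  apply: near_eq_is_derive (is_derive_cst (1 : R^o) x 1); near=> y.
  by rewrite ramp_gt // ltW //; near: y; exact: lt_nbhsr.
by move=> ?; rewrite derive_val.
Unshelve. all: by end_near. Qed.

(** The derivative is [6 * hump a] on the interval; 6 is the inverse of the integral of [hump a], so
    the function rises from 0 to 1. *)
Definition smoothstep a x : R := 3 * ramp a x ^+ 2 - 2 * ramp a x ^+ 3.

Lemma primitive_smoothstep a :
  primitive (smoothstep a) (fun x => 6 * (ramp a x - ramp a x ^+ 2)).
Proof.
have p1 := primitive_ramp a; have p2 := primitiveM p1 p1; have p3 := primitiveM p2 p1.
have p := primitiveB (primitiveZ 3 p2) (primitiveZ 2 p3).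
apply: primitive_eql; last (apply: primitive_eq p => x).
  move=> x; rewrite /smoothstep; ring.
rewrite indicE mem_setE /= in_itv /=.
case: (leP a x) => ax /=; last by rewrite ramp_lt ?(ltW ax) //; ring.
case: (ltP x (a + 1)) => xa /=; last by rewrite ramp_gt //; ring.
by rewrite ramp_mid ?(ltW xa) //; ring.
Qed.

Lemma primitive_smoothstep' a :
  primitive (fun x => 6 * (ramp a x - ramp a x ^+ 2))
    (fun x => 6 * (\1_(`[a, a + 1[) x * (1 - 2 * ramp a x))).
Proof.
have p1 := primitive_ramp a; have p2 := primitiveM p1 p1.
by apply: primitive_eq (primitiveZ 6 (primitiveB p1 p2)) => x; ring.
Qed.

Definition sqint f := measurable_fun setT f /\ mu.-integrable setT (EFin \o (fun x => f x ^+ 2)).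

Lemma sqint_locint f : sqint f -> locint (fun x => f x ^+ 2).
Proof. by move=> [_ i2] a c; apply: integrableS i2. Qed.

Lemma sqint_dom f g : measurable_fun setT f ->
  mu.-integrable setT (EFin \o g) -> (forall x, f x ^+ 2 <= g x) -> sqint f.
Proof.
move=> mf ig fg; split => //; apply: le_integrable ig => //.
  by apply/measurable_EFinP; apply: measurable_funX.
by move=> x _; rewrite /= lee_fin ger0_norm ?sqr_ge0 // (le_trans (fg x)) // ler_norm.
Qed.

Lemma integrableTD f g : mu.-integrable setT (EFin \o f) -> mu.-integrable setT (EFin \o g) ->
  mu.-integrable setT (EFin \o (fun x => f x + g x)).
Proof.
move=> lf lg; rewrite (_ : EFin \o _ = (EFin \o f) \+ (EFin \o g))%E //.
exact: integrableD.
Qed.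

Lemma integrableTZ (k : R) f : mu.-integrable setT (EFin \o f) ->
  mu.-integrable setT (EFin \o (fun x => k * f x)).
Proof.
move=> lf; rewrite (_ : EFin \o _ = (fun x => k%:E * (EFin \o f) x))%E //.
exact: integrableZl.
Qed.

Lemma integrable_patch f (D : set R) : measurable D -> mu.-integrable D (EFin \o f) ->
  mu.-integrable setT (EFin \o (f \_ D)).
Proof.
by move=> mD iD; rewrite -restrict_EFin; apply/integrable_restrict => //=; rewrite setTI.
Qed.

Lemma sqintD f g : sqint f -> sqint g -> sqint (fun x => f x + g x).
Proof.
move=> [mf f2] [mg g2]; apply: sqint_dom (integrableTZ 2 (integrableTD f2 g2)) _.
  exact: measurable_funD.
by move=> x; have := sqr_ge0 (f x - g x); lra.
Qed.

Lemma sqintZ k f : sqint f -> sqint (fun x => k * f x).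
Proof.
move=> [mf f2]; apply: sqint_dom (integrableTZ (k ^+ 2) f2) _.
  by apply: measurable_funM => //; exact: measurable_cst.
by move=> x; rewrite exprMn.
Qed.

Lemma sqintB f g : sqint f -> sqint g -> sqint (fun x => f x - g x).
Proof.
move=> sf sg; have := sqintD sf (sqintZ (-1) sg).
by congr sqint; apply/funext => x; rewrite mulN1r.
Qed.

Lemma sqint_mul f g : sqint f -> sqint g -> mu.-integrable setT (EFin \o (fun x => f x * g x)).
Proof.
move=> [mf f2] [mg g2]; apply: le_integrable (integrableTD f2 g2) => //.
  by apply/measurable_EFinP; apply: measurable_funM.
move=> x _; rewrite /= lee_fin (le_trans _ (ler_norm _)) // normrM.
rewrite -(real_normK (num_real (f x))) -(real_normK (num_real (g x))).
have := sqr_ge0 (`|f x| - `|g x|); have := sqr_ge0 (`|f x| + `|g x|); lra.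
Qed.

(** Young's inequality takes the place of Cauchy-Schwarz: [k] is chosen later to balance a small
    factor against a bounded one. *)
Lemma sqint_mul_le f g (k : R) : 0 < k -> sqint f -> sqint g ->
  `|\int[mu]_x (f x * g x)| <= k * (\int[mu]_x f x ^+ 2) + k^-1 * (\int[mu]_x g x ^+ 2).
Proof.
move=> k0 sf sg; have [_ f2] := sf; have [_ g2] := sg.
apply: le_trans (le_normr_Rintegral measurableT (sqint_mul sf sg)) _.
have k1 : 0 < k^-1 by rewrite invr_gt0.
have i1 := integrableTZ k f2; have i2 := integrableTZ k^-1 g2.
rewrite -RintegralZl // -RintegralZl // -RintegralD //.
apply: le_Rintegral => //.
- by apply: integrable_norm; exact: sqint_mul.
- exact: integrableTD.
move=> x _; rewrite normrM.
rewrite -(real_normK (num_real (f x))) -(real_normK (num_real (g x))).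
move: (normr_ge0 (f x)) (normr_ge0 (g x)).
move: `|f x| `|g x| => y z y0 z0.
have : 0 <= (k * y - z) ^+ 2 * k^-1 by rewrite mulr_ge0 ?sqr_ge0 // ltW.
have -> : (k * y - z) ^+ 2 * k^-1 = k * y ^+ 2 - 2 * (y * z) + k^-1 * z ^+ 2.
  by field; lra.
have : 0 <= y * z by exact: mulr_ge0.
by move: (k^-1) => i; lra.
Qed.

Lemma Rintegral_patch f (D : set R) : \int[mu]_x (f \_ D) x = \int[mu]_(x in D) f x.
Proof. by rewrite -Rintegral_mkcond. Qed.

Lemma le_RintegralT f g : mu.-integrable setT (EFin \o f) -> mu.-integrable setT (EFin \o g) ->
  (forall x, f x <= g x) -> \int[mu]_x f x <= \int[mu]_x g x.
Proof. by move=> lf lg fg; apply: le_Rintegral. Qed.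

Lemma cvg_integral_itv f : measurable_fun setT f -> (forall x, 0 <= f x) ->
  (\int[mu]_(x in `[(- n%:R)%R, n%:R%R]) (f x)%:E @[n --> \oo] --> \int[mu]_x (f x)%:E)%E.
Proof.
move=> mf f0.
have H := @ge0_nondecreasing_set_cvg_integral _ _ R
  (fun n : nat => `[- n%:R, n%:R]%classic : set (measurableTypeR R)) (EFin \o f) mu.
rewrite [X in integral _ X _](_ : _ = \bigcup_n `[- n%:R, n%:R]%classic); last exact/esym/bigcup_itvcc.
apply: H => //=.
- move=> m n mn; apply/subsetPset => x /=; rewrite !in_itv /= => /andP[h1 h2].
  have : m%:R <= n%:R :> R by rewrite ler_nat.
  by move=> ?; apply/andP; split; lra.
- by move=> i; apply/measurable_EFinP; exact: measurable_funTS.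
- by move=> i x _; rewrite lee_fin.
Qed.

Lemma Rintegral_tail_le f (e : R) : mu.-integrable setT (EFin \o f) -> (forall x, 0 <= f x) ->
  0 < e -> exists N : R, forall a c, a <= - N -> N <= c ->
    \int[mu]_(x in ~` `[a, c[) f x <= e.
Proof.
move=> fi f0 e0.
have mf : measurable_fun setT f by apply/measurable_EFinP; exact: (measurable_int mu fi).
have h : \int[mu]_(x in `[- n%:R, n%:R]) f x @[n --> \oo] --> \int[mu]_x f x.
  apply: fine_cvg; rewrite fineK; last exact: integrable_fin_num.
  exact: cvg_integral_itv.
move/cvgrPdist_le : h => /(_ e e0)[n _ /(_ n (leqnn _)) /= Hn].
(* The extra 1 makes [[- n, n]] lie in the half-open interval [[a, c[]. *)
exists (n%:R + 1) => a c an nc.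
have mD : measurable (`[a, c[%classic : set R) by exact: measurable_itv.
have : \int[mu]_x f x = \int[mu]_(x in `[a, c[) f x + \int[mu]_(x in ~` `[a, c[) f x.
  rewrite -Rintegral_setU ?setUv //; last by apply/disj_setPS; rewrite setICr.
  exact: measurableC.
have : \int[mu]_(x in `[- n%:R, n%:R]) f x <= \int[mu]_(x in `[a, c[) f x.
  rewrite -(Rintegral_patch f (`[- n%:R, n%:R])) -(Rintegral_patch f `[a, c[).
  apply: le_RintegralT.
  - by apply: integrable_patch => //; exact: integrableS fi.
  - by apply: integrable_patch => //; exact: integrableS fi.
  move=> x; rewrite !patchE; case: ifPn => [|_]; last by case: ifP.
  rewrite inE /= in_itv /= => /andP[h1 h2]; rewrite ifT // inE /= in_itv /=.
  by apply/andP; split; lra.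
have := ler_norm (\int[mu]_x f x - \int[mu]_(x in `[- n%:R, n%:R]) f x).
by move: Hn; rewrite /reverse_coercion; lra.
Qed.
End Cutoff.

(** * Truncating solutions on quiet intervals *)

Section Core.
Context {R : realType}.
Implicit Types (F G f g b h u v : R -> R) (a c d x : R).
Local Notation mu := (@lebesgue_measure R).

Lemma le_Rintegral_subset f (A D : set R) : mu.-integrable setT (EFin \o f) ->
  (forall x, 0 <= f x) -> measurable A -> measurable D -> A `<=` D ->
  \int[mu]_(x in A) f x <= \int[mu]_(x in D) f x.
Proof.
move=> fi f0 mA mD AD; rewrite -(Rintegral_patch f A) -(Rintegral_patch f D).
apply: le_RintegralT.
- by apply: integrable_patch => //; exact: integrableS fi.
- by apply: integrable_patch => //; exact: integrableS fi.
move=> x; rewrite !patchE; case: ifPn => [/set_mem/AD/mem_set ->|_] //.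
by case: ifP.
Qed.

Definition energy_cst (M : R) : R := 4 * (5 * M * (1 + 20 * M) + 6).

Lemma energy_cst_ge0 M : 1 <= M -> 0 <= energy_cst M.
Proof.
by move=> M1; rewrite /energy_cst mulr_ge0 // addr_ge0 // mulr_ge0 //; lra.
Qed.

Lemma smoothstep_lt a x : x <= a -> smoothstep a x = 0.
Proof. by move=> xa; rewrite /smoothstep ramp_lt //; ring. Qed.

Lemma smoothstep_gt a x : a + 1 <= x -> smoothstep a x = 1.
Proof. by move=> xa; rewrite /smoothstep ramp_gt //; ring. Qed.

Lemma smoothstep_bounds a x : 0 <= smoothstep a x <= 1.
Proof.
rewrite /smoothstep; have /andP[] := ramp_bounds a x; move: (ramp a x) => r r0 r1.
have h1 := mulr_ge0 (sqr_ge0 r) (_ : 0 <= 1 - r).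
have h2 := mulr_ge0 (sqr_ge0 (1 - r)) r0.
have {}h1 : 0 <= r ^+ 2 * (1 - r) by apply: h1; lra.
have h3 := sqr_ge0 (1 - r); have h4 := sqr_ge0 r.
by apply/andP; split; lra.
Qed.

Lemma hump_ramp a x : a <= x -> x <= a + 1 -> ramp a x - ramp a x ^+ 2 = hump a x.
Proof. by move=> ax xa; rewrite ramp_mid // /hump; ring. Qed.

Lemma ramp_out a x : ~~ (a <= x <= a + 1) -> ramp a x - ramp a x ^+ 2 = 0.
Proof.
rewrite negb_and -!ltNge => /orP[xa|ax]; first by rewrite ramp_lt ?(ltW xa) //; ring.
by rewrite ramp_gt ?(ltW ax) //; ring.
Qed.

Lemma cutoff_arith0 (A B : R) : 0 ^+ 2 <= 432 * 0 + 864 * (A ^+ 2 + B ^+ 2).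
Proof. by have := sqr_ge0 A; have := sqr_ge0 B; lra. Qed.

(** The square of a sum of three terms gives [432 = 3 * 12 ^ 2]; separating the contributions of
    [ra] and [rc] doubles it to [864]. *)
Lemma cutoff_arith (X X'' H U P ra rc : R) : 0 <= X <= 1 -> `|X''| <= 12 ->
  ((X - 1) * H - 12 * (ra - rc) * P - X'' * U) ^+ 2 <=
  432 * (U ^+ 2 + H ^+ 2) + 864 * ((ra * P) ^+ 2 + (rc * P) ^+ 2).
Proof.
move=> /andP[X0 X1] X2.
have h1 : ((X - 1) * H) ^+ 2 <= H ^+ 2.
  by rewrite exprMn ler_piMl ?sqr_ge0 // expr2; nra.
have h2 : (X'' * U) ^+ 2 <= 144 * U ^+ 2.
  rewrite exprMn ler_wpM2r ?sqr_ge0 // -real_normK ?num_real //.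
  by have := normr_ge0 X''; rewrite expr2; nra.
move: h1 h2; move: ((X - 1) * H) (X'' * U) => A B h1 h2.
have s1 := sqr_ge0 (A + 12 * (ra - rc) * P); have s2 := sqr_ge0 (A + B).
have s3 := sqr_ge0 (12 * (ra - rc) * P - B); have s4 := sqr_ge0 ((ra + rc) * P).
have s5 := sqr_ge0 H; have s6 := sqr_ge0 U.
lra.
Qed.

(** [X] is 1 on [[a + 1, c]] and 0 outside [[a, c + 1]], so the errors live outside [[a + 1, c[] and
    are tails of [u] and [h]. The critical term [X' u'] is a multiple of [phi u'] on the two
    transition intervals, where [energy] applies. *)
Lemma rsol_cutoff_estimate b h u v (M : R) a c (b1 b2 : R) : continuous b -> rsol b h u v ->
  sqint u -> sqint h -> 1 <= M ->
  \int[mu]_(x in `[a, a + 1]) (b x - b1) ^+ 2 <= M ->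
  \int[mu]_(x in `[c, c + 1]) (b x - b2) ^+ 2 <= M -> a + 1 <= c ->
  exists k w y, [/\ rsol b k w y,
    (forall x, x < a \/ c + 1 <= x -> [/\ w x = 0, y x = 0 & k x = 0]),
    sqint w /\ sqint k,
    \int[mu]_x (w x - u x) ^+ 2 <= \int[mu]_(x in ~` `[a + 1, c[) (u x ^+ 2 + h x ^+ 2) &
    \int[mu]_x (k x - h x) ^+ 2 <= (432 + 1728 * energy_cst M) *
       \int[mu]_(x in ~` `[a + 1, c[) (u x ^+ 2 + h x ^+ 2)].
Proof.
move=> cb su qu qh M1 bM1 bM2 ac.
have [cu cv] := rsol_continuous su.
have lh := rsol_locint cb su.
have mh := locint_measurable lh.
have mmu := continuous_measurable_fun cu.
have cp : continuous (fun x => b x * u x + v x).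
  by move=> x; apply: cvgD; [apply: cvgM; [exact: cb|exact: cu]|exact: cv].
pose r e x := ramp e x - ramp e x ^+ 2.
pose X x := smoothstep a x - smoothstep c x.
pose X' x := 6 * r a x - 6 * r c x.
pose X'' x := 6 * (\1_(`[a, a + 1[) x * (1 - 2 * ramp a x)) - 6 * (\1_(`[c, c + 1[) x * (1 - 2 * ramp c x)).
have pX : primitive X X' := primitiveB (primitive_smoothstep a) (primitive_smoothstep c).
have pX' : primitive X' X'' := primitiveB (primitive_smoothstep' a) (primitive_smoothstep' c).
have sw := rsol_cutoff su pX pX'.
set k := (fun x => _) in sw; set w := (fun x => X x * u x) in sw; set y := (fun x => _) in sw.
pose D := ~` `[a + 1, c[%classic.
have mD : measurable D by apply: measurableC; exact: measurable_itv.
pose q x := u x ^+ 2 + h x ^+ 2.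
have q0 x : 0 <= q x by rewrite addr_ge0 ?sqr_ge0.
have iq : mu.-integrable setT (EFin \o q) := integrableTD qu.2 qh.2.
have iqD : mu.-integrable setT (EFin \o (q \_ D)).
  by apply: integrable_patch => //; exact: integrableS iq.
have mk : measurable_fun setT k.
  by apply: locint_measurable; exact: rsol_locint sw.
have mw : measurable_fun setT w.
  by apply: continuous_measurable_fun; exact: (rsol_continuous sw).1.
have X01 x : 0 <= X x <= 1.
  rewrite /X; have [xc|cx] := leP x c.
    by rewrite (smoothstep_lt xc) subr0 smoothstep_bounds.
  rewrite (@smoothstep_gt a x); last lra.
  by have /andP[? ?] := smoothstep_bounds c x; apply/andP; split; lra.
have inD x : x \notin D -> [/\ X x = 1, X' x = 0 & X'' x = 0].
  rewrite /D notin_setE /= => /contrapT; rewrite in_itv /= => /andP[ax xc].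
  split.
  - by rewrite /X smoothstep_gt // smoothstep_lt ?(ltW xc) // subr0.
  - rewrite /X' /r (ramp_gt ax) (ramp_lt (ltW xc)); ring.
  - rewrite /X'' !indicE !mem_setE /= !in_itv /= (ltNge x) ax andbF (leNgt c) xc /=; ring.
pose Ea x := (hump a x * (b x * u x + v x)) ^+ 2.
pose Ec x := (hump c x * (b x * u x + v x)) ^+ 2.
have lE e : locint (fun x => (hump e x * (b x * u x + v x)) ^+ 2).
  apply: locint_sqr => x; apply: cvgM; last exact: cp.
  exact: primitive_continuous (hump_primitive e) x.
have iEa : mu.-integrable setT (EFin \o (Ea \_ `[a, a + 1])).
  by apply: integrable_patch => //; exact: lE.
have iEc : mu.-integrable setT (EFin \o (Ec \_ `[c, c + 1])).
  by apply: integrable_patch => //; exact: lE.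
have rE e x : (r e x * (b x * u x + v x)) ^+ 2 =
    ((fun x => (hump e x * (b x * u x + v x)) ^+ 2) \_ `[e, e + 1]) x.
  rewrite patchE; case: ifPn; rewrite mem_setE /= in_itv /=.
    by move=> /andP[ex xe]; rewrite /r hump_ramp.
  by move=> xe; rewrite /r ramp_out // mul0r expr0n.
have Xd x : `|X'' x| <= 12.
  have B e : `|\1_(`[e, e + 1[) x * (1 - 2 * ramp e x)| <= 1.
    rewrite normrM -[leRHS]mul1r; apply: ler_pM => //.
      by rewrite indicE; case: (_ \in _); rewrite ?normr1 ?normr0.
    by have /andP[? ?] := ramp_bounds e x; rewrite ler_norml; apply/andP; split; lra.
  rewrite /X''; apply: (le_trans (ler_normB _ _)); rewrite !normrM (ger0_norm (_ : 0 <= 6)) //.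
  have := B a; have := B c; rewrite !normrM; lra.
pose W x := 432 * (q \_ D) x + 864 * ((Ea \_ `[a, a + 1]) x + (Ec \_ `[c, c + 1]) x).
have iW : mu.-integrable setT (EFin \o W).
  by apply: integrableTD; apply: integrableTZ => //; exact: integrableTD.
have kW x : (k x - h x) ^+ 2 <= W x.
  rewrite /W -[(Ea \_ _) x]rE -[(Ec \_ _) x]rE patchE; case: ifPn => [_|/inD[X1 X'0 X''0]]; last first.
    rewrite (_ : k x - h x = 0); last by rewrite /k X1 X'0 X''0; ring.
    exact: cutoff_arith0.
  rewrite (_ : k x - h x = (X x - 1) * h x - 12 * (r a x - r c x) * (b x * u x + v x) - X'' x * u x).
    exact: cutoff_arith (X01 x) (Xd x).
  by rewrite /k /X'; ring.
have qkh : sqint (fun x => k x - h x).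
  by apply: sqint_dom iW kW; exact: measurable_funB.
(* One energy estimate for each transition interval; together they turn [864] into [1728]. *)
have EaU e : `[e, e + 1[ `<=` D -> forall be : R,
    \int[mu]_(x in `[e, e + 1]) (b x - be) ^+ 2 <= M ->
    \int[mu]_x ((fun x => (hump e x * (b x * u x + v x)) ^+ 2) \_ `[e, e + 1]) x <=
    energy_cst M * \int[mu]_(x in D) q x.
  move=> eD be beM; rewrite Rintegral_patch.
  apply: (le_trans (energy cb su (sqint_locint qh) M1 beM)); rewrite -/(energy_cst M).
  rewrite ler_wpM2l ?energy_cst_ge0 //.
  rewrite -Rintegral_itvD; [|exact: locint_sqr|exact: sqint_locint].
  rewrite -Rintegral_itv_bndo_bndc; last by apply: integrableS iq.
  by apply: le_Rintegral_subset.
have Ea1 := EaU a _ b1 bM1; have Ec1 := EaU c _ b2 bM2.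
have {}Ea1 : \int[mu]_x (Ea \_ `[a, a + 1]) x <= energy_cst M * \int[mu]_(x in D) q x.
  apply: Ea1 => x /=; rewrite in_itv /= => /andP[_ xa] /=; rewrite /D /= in_itv /=.
  by move=> /andP[]; rewrite leNgt xa.
have {}Ec1 : \int[mu]_x (Ec \_ `[c, c + 1]) x <= energy_cst M * \int[mu]_(x in D) q x.
  apply: Ec1 => x /=; rewrite in_itv /= => /andP[cx _] /=; rewrite /D /= in_itv /=.
  by move=> /andP[_]; rewrite ltNge cx.
have wu x : (w x - u x) ^+ 2 <= (q \_ D) x.
  rewrite patchE; case: ifPn => [_|/inD[X1 _ _]]; last first.
    by rewrite /w X1 mul1r subrr expr0n.
  rewrite (_ : w x - u x = (X x - 1) * u x); last by rewrite /w; ring.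
  have /andP[? ?] := X01 x; rewrite /q exprMn -[leLHS]addr0 lerD ?sqr_ge0 //.
  by rewrite ler_piMl ?sqr_ge0 // expr2; nra.
have qwu : sqint (fun x => w x - u x).
  by apply: sqint_dom iqD wu; exact: measurable_funB.
exists k, w, y; split => //.
- have z0 x : x < a \/ c + 1 <= x -> [/\ X x = 0, X' x = 0 & X'' x = 0].
    rewrite /X /X' /X'' /r !indicE !mem_setE /= !in_itv /= => -[xa|cx].
      have xc : x <= c by lra.
      rewrite (smoothstep_lt (ltW xa)) (smoothstep_lt xc) (ramp_lt (ltW xa)) (ramp_lt xc).
      rewrite (leNgt a) xa (leNgt c) (_ : x < c) /=; last lra.
      by split; ring.
    have ax : a + 1 <= x by lra.
    rewrite (smoothstep_gt ax) (smoothstep_gt cx) (ramp_gt ax) (ramp_gt cx).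
    rewrite (ltNge x (a + 1)) ax (ltNge x (c + 1)) cx !andbF /=.
    by split; ring.
  move=> x /z0[X0 X'0 X''0]; split; rewrite ?/w ?/y ?/k X0 ?X'0 ?X''0; ring.
- split.
    by have := sqintD qwu qu; congr sqint; apply/funext => x; ring.
  by have := sqintD qkh qh; congr sqint; apply/funext => x; ring.
- by rewrite -(Rintegral_patch q D); apply: le_RintegralT => //; exact: qwu.2.
- apply: (@le_trans _ _ (\int[mu]_x W x)).
    by apply: le_RintegralT => //; exact: qkh.2.
  rewrite /W RintegralD //; last first.
    by apply: integrableTZ; exact: integrableTD.
    exact: integrableTZ.
  rewrite RintegralZl // RintegralZl //; last exact: integrableTD.
  rewrite RintegralD // Rintegral_patch.
  move: Ea1 Ec1; rewrite /reverse_coercion.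
  move: (Rintegral _ _ _) (Rintegral _ _ _) (Rintegral _ _ _) (energy_cst _) => x1 x2 x3 x4.
  lra.
Qed.

Definition quiet (b : R -> R) := exists2 M : R, 1 <= M & forall N : R,
  (exists c b0 : R, N <= c /\ \int[mu]_(x in `[c, c + 1]) (b x - b0) ^+ 2 <= M) /\
  (exists a b0 : R, a + 1 <= - N /\ \int[mu]_(x in `[a, a + 1]) (b x - b0) ^+ 2 <= M).

Definition cutoff_of b h u k w y (K e : R) :=
  [/\ rsol b k w y, (forall x, K <= `|x| -> [/\ w x = 0, y x = 0 & k x = 0]),
   sqint w /\ sqint k, \int[mu]_x (w x - u x) ^+ 2 <= e &
   \int[mu]_x (k x - h x) ^+ 2 <= e].

(** Meant for the real and imaginary part of one complex solution: both are cut off over the same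
    two intervals, which gives a common support radius [K]. *)
Lemma rsol_simultaneous_cutoff b h1 u1 v1 h2 u2 v2 (e : R) : continuous b -> quiet b ->
  rsol b h1 u1 v1 -> rsol b h2 u2 v2 -> sqint u1 -> sqint h1 -> sqint u2 -> sqint h2 -> 0 < e ->
  exists K k1 w1 y1 k2 w2 y2, [/\ 0 < K, cutoff_of b h1 u1 k1 w1 y1 K e &
    cutoff_of b h2 u2 k2 w2 y2 K e].
Proof.
move=> cb [M M1 qb] s1 s2 qu1 qh1 qu2 qh2 e0.
pose q1 x := u1 x ^+ 2 + h1 x ^+ 2; pose q2 x := u2 x ^+ 2 + h2 x ^+ 2.
have i1 : mu.-integrable setT (EFin \o q1) := integrableTD qu1.2 qh1.2.
have i2 : mu.-integrable setT (EFin \o q2) := integrableTD qu2.2 qh2.2.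
have q10 x : 0 <= q1 x by rewrite addr_ge0 ?sqr_ge0.
have q20 x : 0 <= q2 x by rewrite addr_ge0 ?sqr_ge0.
pose C := 432 + 1728 * energy_cst M.
have C1 : 1 <= C by have := energy_cst_ge0 M1; rewrite /C; lra.
have C0 : 0 < C by lra.
have eC : 0 < e / C by rewrite divr_gt0.
have [N1 HN1] := Rintegral_tail_le i1 q10 eC.
have [N2 HN2] := Rintegral_tail_le i2 q20 eC.
pose N := Num.max (Num.max N1 N2) 0.
have NN1 : N1 <= N by rewrite /N !le_max lexx.
have NN2 : N2 <= N by rewrite /N !le_max lexx orbT.
have N0 : 0 <= N by rewrite /N le_max lexx orbT.
have [[c [b2 [Nc bM2]]] [a [b1 [aN bM1]]]] := qb N.
have ac : a + 1 <= c by lra.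
have [k1 [w1 [y1 [sw1 z1 [qw1 qk1] E1 F1]]]] := rsol_cutoff_estimate cb s1 qu1 qh1 M1 bM1 bM2 ac.
have [k2 [w2 [y2 [sw2 z2 [qw2 qk2] E2 F2]]]] := rsol_cutoff_estimate cb s2 qu2 qh2 M1 bM1 bM2 ac.
have aN1 : a + 1 <= - N1 by lra.
have aN2 : a + 1 <= - N2 by lra.
have T1 := HN1 _ _ aN1 (le_trans NN1 Nc); have T2 := HN2 _ _ aN2 (le_trans NN2 Nc).
have Ce : e / C <= e by rewrite ler_pdivrMr // ler_peMr // ltW.
have CT1 : C * \int[mu]_(x in ~` `[a + 1, c[) q1 x <= e.
  by rewrite mulrC -ler_pdivlMr.
have CT2 : C * \int[mu]_(x in ~` `[a + 1, c[) q2 x <= e.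
  by rewrite mulrC -ler_pdivlMr.
exists (`|a| + `|c + 1| + 1), k1, w1, y1, k2, w2, y2.
have out x : `|a| + `|c + 1| + 1 <= `|x| -> x < a \/ c + 1 <= x.
  have := normr_ge0 a; have := normr_ge0 (c + 1); have := ler_norm (- a).
  have := ler_norm (c + 1); rewrite normrN; case: (lerP 0 x) => x0.
    by rewrite (ger0_norm x0) => *; right; lra.
  by rewrite (ltr0_norm x0) => *; left; lra.
split.
- by have := normr_ge0 a; have := normr_ge0 (c + 1); lra.
- split => //; first by move=> x /out; exact: z1.
    exact: le_trans (le_trans E1 T1) Ce.
  exact: le_trans F1 CT1.
- split => //; first by move=> x /out; exact: z2.
    exact: le_trans (le_trans E2 T2) Ce.
  exact: le_trans F2 CT2.
Qed.

Lemma sqint_prodB_integral f g w z : sqint f -> sqint g -> sqint w -> sqint z ->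
  \int[mu]_x (f x * g x - w x * z x) = \int[mu]_x (f x * g x) - \int[mu]_x (w x * z x).
Proof. by move=> sf sg sw sz; rewrite RintegralB //; exact: sqint_mul. Qed.

(** Green's identity on an interval reaching beyond the support, where all boundary terms vanish. *)
Lemma cutoff_green b h1 u1 k w y (K e : R) h2 u2 v2 : cutoff_of b h1 u1 k w y K e ->
  rsol b h2 u2 v2 -> sqint u2 -> sqint h2 -> \int[mu]_x (k x * u2 x) = \int[mu]_x (w x * h2 x).
Proof.
move=> [sw z [qw qk] _ _] s2 qu2 qh2; apply/eqP; rewrite -subr_eq0; apply/eqP.
rewrite -sqint_prodB_integral //.
have K0 : - `|K| <= `|K| by have := normr_ge0 K; lra.
have [_ G] := rsol_green sw s2.
transitivity (\int[mu]_(x in `[- `|K|, `|K|]) (k x * u2 x - w x * h2 x)).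
  rewrite -(Rintegral_patch (fun x => k x * u2 x - w x * h2 x) `[- `|K|, `|K|]).
  apply: eq_Rintegral => x _; rewrite patchE; case: ifPn => //.
  rewrite mem_setE /= in_itv /= -ler_norml -ltNge => Kx.
  by have [-> _ ->] := z x (le_trans (ler_norm K) (ltW Kx)); rewrite !mul0r subrr.
rewrite -G //.
have K1 : K <= `|(`|K|)| by rewrite normr_id ler_norm.
have K2 : K <= `|(- `|K|)| by rewrite normrN normr_id ler_norm.
have [w1 y1 _] := z _ K1; have [w2 y2 _] := z _ K2.
by rewrite w1 y1 w2 y2 !mul0r !subrr.
Qed.

(** By [cutoff_green] the difference of the two sides involves only the cutoff errors [w - u1] and
    [k - h1]. *)
Lemma rsol_symmetric b h1 u1 v1 h2 u2 v2 : continuous b -> quiet b ->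
  rsol b h1 u1 v1 -> rsol b h2 u2 v2 -> sqint u1 -> sqint h1 -> sqint u2 -> sqint h2 ->
  \int[mu]_x (h1 x * u2 x) = \int[mu]_x (u1 x * h2 x).
Proof.
move=> cb qb s1 s2 qu1 qh1 qu2 qh2; apply/eqP; rewrite -subr_eq0 -normr_le0.
apply/ler_addgt0Pr => e e0; rewrite add0r.
pose S := \int[mu]_x u2 x ^+ 2 + \int[mu]_x h2 x ^+ 2 + 1.
have U0 : 0 <= \int[mu]_x u2 x ^+ 2 by apply: Rintegral_ge0 => x _; exact: sqr_ge0.
have H0 : 0 <= \int[mu]_x h2 x ^+ 2 by apply: Rintegral_ge0 => x _; exact: sqr_ge0.
have S0 : 0 < S by rewrite /S ltr_wpDl // addr_ge0.
(* [k0] and [d] are chosen so that the two error norms and the fixed norms contribute at most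
   [e / 3] each. *)
pose k0 := 3 * S / e; have k00 : 0 < k0 by rewrite divr_gt0 // mulr_gt0.
pose d := e / 3 / k0; have d0 : 0 < d by rewrite divr_gt0 // divr_gt0.
have [K [k [w [y [_ [_ [_ [_ cut _]]]]]]]] := rsol_simultaneous_cutoff cb qb s1 s2 qu1 qh1 qu2 qh2 d0.
have G := cutoff_green cut s2 qu2 qh2.
have [sw z [qw qk] dw dk] := cut.
have -> : \int[mu]_x (h1 x * u2 x) - \int[mu]_x (u1 x * h2 x) =
   \int[mu]_x ((w x - u1 x) * h2 x) - \int[mu]_x ((k x - h1 x) * u2 x).
  have e1 f g p : sqint f -> sqint g -> sqint p -> \int[mu]_x ((f x - g x) * p x) =
      \int[mu]_x (f x * p x) - \int[mu]_x (g x * p x).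
    move=> qf qg qp; rewrite -sqint_prodB_integral //.
    by apply: eq_Rintegral => x _; rewrite mulrBl.
  by rewrite !e1 // G; ring.
apply: (le_trans (ler_normB _ _)).
have := sqint_mul_le k00 (sqintB qw qu1) qh2.
have := sqint_mul_le k00 (sqintB qk qh1) qu2.
have I1 : k0 * \int[mu]_x (w x - u1 x) ^+ 2 <= e / 3.
  by rewrite mulrC -ler_pdivlMr.
have I2 : k0 * \int[mu]_x (k x - h1 x) ^+ 2 <= e / 3.
  by rewrite mulrC -ler_pdivlMr.
have I3 : k0^-1 * (\int[mu]_x u2 x ^+ 2) + k0^-1 * (\int[mu]_x h2 x ^+ 2) <= e / 3.
  rewrite -mulrDr /k0 invf_div mulrAC ler_pdivrMr ?mulr_gt0 //.
  rewrite (_ : e / 3 * (3 * S) = e * S); last by field.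
  by rewrite ler_wpM2l ?(ltW e0) // /S lerDl.
move: I1 I2 I3; rewrite /reverse_coercion => I1 I2 I3 h3 h4.
apply: (le_trans (lerD h4 h3)).
move: I1 I2 I3; move: (Rintegral _ _ _) (Rintegral _ _ _) (Rintegral _ _ _) (Rintegral _ _ _) => x1 x2 x3 x4.
move: (k0^-1) => ki; lra.
Qed.
End Core.

(** * Solvability on intervals and on the line *)

Section ResolventReal.
Context {R : realType}.
Implicit Types (F G f g b h u v gr gi ur ui vr vi : R -> R) (a c d x : R).
Local Notation mu := (@lebesgue_measure R).

Lemma integrable_addr (D : set R) f g : measurable D ->
  mu.-integrable D (EFin \o f) -> mu.-integrable D (EFin \o g) ->
  mu.-integrable D (EFin \o (fun x => f x + g x)).
Proof.
move=> mD lf lg; rewrite (_ : EFin \o _ = (EFin \o f) \+ (EFin \o g))%E //.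
exact: integrableD.
Qed.

Lemma integrable_scaler (D : set R) (k : R) f : measurable D -> mu.-integrable D (EFin \o f) ->
  mu.-integrable D (EFin \o (fun x => k * f x)).
Proof.
move=> mD lf; rewrite (_ : EFin \o _ = (fun x => k%:E * (EFin \o f) x))%E //.
exact: integrableZl.
Qed.

(** The last hypothesis is symmetry for the real and imaginary part of [u]. It turns [zi] times the
    squared norm into the integral of [gr ui - gi ur], and Young's inequality finishes. Line and box
    differ only in how this hypothesis is obtained. *)
Lemma resolvent_bound (D : set R) (zr zi : R) gr gi ur ui : measurable D ->
  measurable_fun D gr -> measurable_fun D gi -> measurable_fun D ur -> measurable_fun D ui ->
  mu.-integrable D (EFin \o (fun x => gr x ^+ 2 + gi x ^+ 2)) ->
  mu.-integrable D (EFin \o (fun x => ur x ^+ 2 + ui x ^+ 2)) ->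
  \int[mu]_(x in D) ((gr x + (zr * ur x - zi * ui x)) * ui x -
     ur x * (gi x + (zr * ui x + zi * ur x))) = 0 ->
  zi ^+ 2 * \int[mu]_(x in D) (ur x ^+ 2 + ui x ^+ 2) <= \int[mu]_(x in D) (gr x ^+ 2 + gi x ^+ 2).
Proof.
move=> mD mgr mgi mur mui iG iU E.
pose f x := gr x * ui x - gi x * ur x.
have iGU := integrable_addr mD iG iU.
have intf : mu.-integrable D (EFin \o f).
  apply: le_integrable iGU => //.
    by apply/measurable_EFinP; apply: measurable_funB; exact: measurable_funM.
  move=> x _; rewrite /= lee_fin (le_trans _ (ler_norm _)) // /f ler_norml.
  have := sqr_ge0 (gr x - ui x); have := sqr_ge0 (gr x + ui x).
  have := sqr_ge0 (gi x - ur x); have := sqr_ge0 (gi x + ur x).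
  have := sqr_ge0 (gr x); have := sqr_ge0 (gi x); have := sqr_ge0 (ur x); have := sqr_ge0 (ui x).
  by move=> *; apply/andP; split; lra.
have Z (k : R) g := @integrable_scaler D k g mD.
have E1 : \int[mu]_(x in D) f x = zi * \int[mu]_(x in D) (ur x ^+ 2 + ui x ^+ 2).
  apply/eqP; rewrite -subr_eq0 -RintegralZl // -RintegralB //; last exact: Z.
  by rewrite -E; apply/eqP; apply: eq_Rintegral => x _; rewrite /f; ring.
have : \int[mu]_(x in D) (zi * f x) <= \int[mu]_(x in D)
    (2^-1 * (zi ^+ 2 * (ur x ^+ 2 + ui x ^+ 2)) + 2^-1 * (gr x ^+ 2 + gi x ^+ 2)).
  apply: le_Rintegral => //.
  - exact: Z.
  - by apply: integrable_addr => //; [exact: (Z _ _ (Z _ _ iU))|exact: (Z _ _ iG)].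
  - move=> x _; rewrite /f; have := sqr_ge0 (zi * ui x - gr x); have := sqr_ge0 (zi * ur x + gi x).
    lra.
rewrite RintegralD //; [|exact: (Z _ _ (Z _ _ iU))|exact: (Z _ _ iG)].
rewrite !RintegralZl //; last exact: (Z _ _ iU).
rewrite E1 /reverse_coercion.
move: (Rintegral _ _ _) (Rintegral _ _ _) => x1 x2; lra.
Qed.

Lemma primitive_eq0 F f a c : primitive F f -> continuous f ->
  (forall x, a < x -> x < c -> F x = 0) -> forall x, a < x -> x < c -> f x = 0.
Proof.
move=> pF cf F0 x ax xc.
have dF := primitive_is_derive pF (cf x).
have d0 : is_derive x 1 F 0.
  apply: near_eq_is_derive (is_derive_cst (0 : R^o) x 1); near=> y.
  by rewrite F0 //; near: y; [exact: lt_nbhsr|exact: lt_nbhsl].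
by rewrite -(@derive_val _ _ _ _ _ _ _ dF) derive_val.
Unshelve. all: by end_near. Qed.

Lemma continuous_integral_eq0 f a c : continuous f -> (forall x, 0 <= f x) ->
  \int[mu]_(x in `[a, c]) f x = 0 -> forall x, a < x -> x < c -> f x = 0.
Proof.
move=> cf f0 I0; have lf := continuous_locint cf.
apply: (primitive_eq0 (primitive_oint a lf) cf) => x ax xc.
rewrite (ointr _ (ltW ax)); apply/eqP; rewrite eq_le Rintegral_ge0 // andbT -I0.
by apply: Rintegral_itv_sub => //; exact: ltW.
Qed.

Lemma csolB b zr zi gr gi gr' gi' ur vr ui vi ur' vr' ui' vi' :
  csol b zr zi gr gi ur vr ui vi -> csol b zr zi gr' gi' ur' vr' ui' vi' ->
  csol b zr zi (fun x => gr x - gr' x) (fun x => gi x - gi' x)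
    (fun x => ur x - ur' x) (fun x => vr x - vr' x) (fun x => ui x - ui' x) (fun x => vi x - vi' x).
Proof.
move=> [s1 s2] [s1' s2']; split.
- by apply: rsol_eq (rsolB s1 s1') => x; ring.
- by apply: rsol_eq (rsolB s2 s2') => x; ring.
Qed.

Lemma csolD b zr zi gr gi gr' gi' ur vr ui vi ur' vr' ui' vi' :
  csol b zr zi gr gi ur vr ui vi -> csol b zr zi gr' gi' ur' vr' ui' vi' ->
  csol b zr zi (fun x => gr x + gr' x) (fun x => gi x + gi' x)
    (fun x => ur x + ur' x) (fun x => vr x + vr' x) (fun x => ui x + ui' x) (fun x => vi x + vi' x).
Proof.
move=> [s1 s2] [s1' s2']; split.
- by apply: rsol_eq (rsolD s1 s1') => x; ring.
- by apply: rsol_eq (rsolD s2 s2') => x; ring.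
Qed.

Lemma csol_scale b zr zi (cr ci : R) ur vr ui vi :
  csol b zr zi (fun=> 0) (fun=> 0) ur vr ui vi ->
  csol b zr zi (fun=> 0) (fun=> 0) (fun x => cr * ur x - ci * ui x) (fun x => cr * vr x - ci * vi x)
    (fun x => cr * ui x + ci * ur x) (fun x => cr * vi x + ci * vr x).
Proof.
move=> [s1 s2]; split.
- by apply: rsol_eq (rsolB (rsolZ cr s1) (rsolZ ci s2)) => x; ring.
- by apply: rsol_eq (rsolD (rsolZ cr s2) (rsolZ ci s1)) => x; ring.
Qed.

Lemma csol_continuous b zr zi gr gi ur vr ui vi : csol b zr zi gr gi ur vr ui vi ->
  [/\ continuous ur, continuous vr, continuous ui & continuous vi].
Proof. by move=> [/rsol_continuous[? ?] /rsol_continuous[? ?]]. Qed.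

Lemma sqr2_locint u v : continuous u -> continuous v -> locint (fun x => u x ^+ 2 + v x ^+ 2).
Proof. by move=> cu cv; apply: locintD; exact: locint_sqr. Qed.

Lemma box_bound b zr zi gr gi ur vr ui vi (l : R) : continuous b ->
  locint (fun x => gr x ^+ 2 + gi x ^+ 2) -> measurable_fun setT gr -> measurable_fun setT gi ->
  csol b zr zi gr gi ur vr ui vi -> 0 <= l ->
  ur l = 0 -> ui l = 0 -> ur (- l) = 0 -> ui (- l) = 0 ->
  zi ^+ 2 * \int[mu]_(x in `[- l, l]) (ur x ^+ 2 + ui x ^+ 2) <=
    \int[mu]_(x in `[- l, l]) (gr x ^+ 2 + gi x ^+ 2).
Proof.
move=> cb lg mgr mgi su l0 url uil urNl uiNl.
have [cur _ cui _] := csol_continuous su.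
apply: (@resolvent_bound _ zr zi) => //.
- exact: measurable_funTS.
- exact: measurable_funTS.
- exact: measurable_funTS (continuous_measurable_fun cur).
- exact: measurable_funTS (continuous_measurable_fun cui).
- exact: sqr2_locint.
have [s1 s2] := su; have [_ G] := rsol_green s1 s2.
by rewrite -G ?url ?uil ?urNl ?uiNl; [ring|lra].
Qed.

(** Otherwise this would be an eigenfunction with nonreal eigenvalue: the a priori bound makes [ur]
    zero inside, hence also its derivative [b ur + vr], which contradicts [vr (- l) = 1] by
    continuity. *)
Lemma box_nonvanishing b zr zi ur vr ui vi (l : R) : continuous b -> zi != 0 ->
  csol b zr zi (fun=> 0) (fun=> 0) ur vr ui vi -> 0 < l ->
  ur (- l) = 0 -> ui (- l) = 0 -> vr (- l) = 1 -> ur l ^+ 2 + ui l ^+ 2 != 0.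
Proof.
move=> cb z0 su l0 urNl uiNl vrNl; apply/negP => /eqP u0.
have [cur cvr cui _] := csol_continuous su.
have url : ur l = 0.
  by apply/eqP; rewrite -sqrf_eq0 eq_le sqr_ge0 andbT -u0 lerDl sqr_ge0.
have uil : ui l = 0.
  by apply/eqP; rewrite -sqrf_eq0 eq_le sqr_ge0 andbT -u0 lerDr sqr_ge0.
have mc : measurable_fun setT ((fun=> 0) : R -> R) by exact: measurable_cst.
have := box_bound cb _ mc mc su (ltW l0) url uil urNl uiNl.
rewrite expr0n /= addr0 => /(_ (locint_cst _)); rewrite Rintegral_cst // mul0r => B.
have I0 : \int[mu]_(x in `[- l, l]) (ur x ^+ 2 + ui x ^+ 2) = 0.
  apply/eqP; rewrite eq_le Rintegral_ge0 ?andbT; last first.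
    by move=> x _; rewrite addr_ge0 ?sqr_ge0.
  by move: B; rewrite pmulr_rle0 // exprn_even_gt0.
have cS : continuous (fun x => ur x ^+ 2 + ui x ^+ 2).
  move=> x; apply: cvgD; rewrite /continuous_at expr2.
    by apply: cvgM; exact: cur.
  by apply: cvgM; exact: cui.
have S0 := continuous_integral_eq0 cS _ I0.
have ur0 x : - l < x -> x < l -> ur x = 0.
  move=> lx xl; apply/eqP; rewrite -sqrf_eq0 eq_le sqr_ge0 andbT.
  by rewrite -(S0 _ x lx xl) ?lerDl ?sqr_ge0 // => y; rewrite addr_ge0 ?sqr_ge0.
have cP : continuous (fun x => b x * ur x + vr x).
  by move=> x; apply: cvgD; [apply: cvgM; [exact: cb|exact: cur]|exact: cvr].
have P0 := primitive_eq0 su.1.1 cP ur0.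
have : \forall x \near - l, 1 / 2 < vr x.
  by apply: (cvgr_gt (vr (- l)) (cvr (- l))); rewrite vrNl; lra.
move=> [e /= e0 /(_ (- l + Num.min (e / 2) l))] /=.
have m0 : 0 < Num.min (e / 2) l by rewrite lt_min divr_gt0.
have m1 : Num.min (e / 2) l <= e / 2 by rewrite ge_min lexx.
have m2 : Num.min (e / 2) l <= l by rewrite ge_min lexx orbT.
rewrite opprD addrA subrr sub0r normrN gtr0_norm // => H.
have := P0 (- l + Num.min (e / 2) l); rewrite ur0; [|lra|lra].
rewrite mulr0 add0r => V; have := H _; rewrite V; [|lra|lra]; lra.
Qed.

(* Shooting: correct the solution starting from zero data at [- l] by a complex multiple of a
   homogeneous solution, which does not vanish at [l]. *)
Lemma box_exists b zr zi gr gi (l : R) : continuous b -> zi != 0 -> locint gr -> locint gi -> 0 < l ->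
  exists ur vr ui vi, csol b zr zi gr gi ur vr ui vi /\
    [/\ ur l = 0, ui l = 0, ur (- l) = 0 & ui (- l) = 0].
Proof.
move=> cb z0 lr li l0.
have [qr [sr [qi [si [qS [q1 _ q3 _]]]]]] := csol_exists zr zi (- l) 0 0 0 0 cb lr li.
have [pr [tr [pi [ti [pS [p1 p2 p3 _]]]]]] := csol_exists zr zi (- l) 0 1 0 0 cb (locint_cst 0) (locint_cst 0).
have N0 := box_nonvanishing cb z0 pS l0 p1 p3 p2.
pose N := pr l ^+ 2 + pi l ^+ 2.
(* [cr + i ci] is minus the quotient of the complex values of the two solutions at [l]; [N] is the
   squared modulus of the denominator. *)
pose cr := - (qr l * pr l + qi l * pi l) / N; pose ci := - (qi l * pr l - qr l * pi l) / N.
have := csolD qS (csol_scale cr ci pS).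
set ur := (fun x => qr x + _); set vr := (fun x => sr x + _).
set ui := (fun x => qi x + _); set vi := (fun x => si x + _) => S.
exists ur, vr, ui, vi; split.
  move: S => [s1 s2]; split; [apply: rsol_eq s1 => x|apply: rsol_eq s2 => x]; by rewrite addr0.
rewrite /ur /ui q1 q3 p1 p3 !mulr0 subrr !addr0; split => //; rewrite ?q1 ?q3; rewrite /cr /ci /N; field; exact: N0.
Qed.

(** Compactness in [R^4], phrased so that arbitrarily late indices with close data can be picked
    without extracting a subsequence. *)
Lemma bounded_rV_cluster (d : nat -> 'I_4 -> R) (B : R) : (forall n i, `|d n i| <= B) ->
  exists p : 'I_4 -> R, forall (e : R) (N : nat), 0 < e ->
    exists2 n, (N <= n)%N & forall i, `|d n i - p i| < e.
Proof.
move=> dB; pose D n : 'rV[R]_4 := \row_i d n i.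
pose K := [set v : 'rV[R]_4 | forall i, `[- B, B]%classic (v ord0 i)].
have cK : compact K by apply: (@rV_compact _ _ (fun=> `[- B, B]%classic)) => i; exact: segment_compact.
have [|p [Kp cp]] := cK (D @ \oo) _.
  exists 0%N => // n _ i; rewrite /= in_itv /= mxE -ler_norml; exact: dB.
exists (fun i => p ord0 i) => e N e0.
have [|_ [[n Nn <-] pn]] := cp [set D n | n in [set n | (N <= n)%N]] (ball p e) _ (nbhsx_ballx _ _ e0).
  by exists N => // n Nn; exists n.
exists n => // i; have [_ /(_ ord0 i)] := pn.
by rewrite /ball /= mxE distrC.
Qed.
End ResolventReal.

(** * Bounds and existence on the whole line *)

Section Line.
Context {R : realType}.
Implicit Types (F G f g b h u v gr gi ur ui vr vi : R -> R) (a c d x : R).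
Local Notation mu := (@lebesgue_measure R).

Lemma sqint_is_locint f : sqint f -> locint f.
Proof.
move=> qf; apply: (@locint_le _ _ (fun x => 1 + f x ^+ 2)); first exact: qf.1.
  move=> x; rewrite -(real_normK (num_real (f x))).
  by have := sqr_ge0 (`|f x| - 1); have := normr_ge0 (f x); lra.
by apply: locintD; [exact: locint_cst|exact: sqint_locint].
Qed.

Lemma Rintegral_itv_subset f a a' c' c : locint f -> (forall x, 0 <= f x) ->
  a <= a' -> a' <= c' -> c' <= c ->
  \int[mu]_(x in `[a', c']) f x <= \int[mu]_(x in `[a, c]) f x.
Proof.
move=> lf f0 aa ac cc; rewrite (@Rintegral_itv_cat _ f a a' c) //; last exact: le_trans cc.
rewrite (@Rintegral_itv_cat _ f a' c' c) //.
have h1 : 0 <= \int[mu]_(x in `[a, a']) f x by exact: Rintegral_ge0.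
have h2 : 0 <= \int[mu]_(x in `[c', c]) f x by exact: Rintegral_ge0.
by rewrite addrCA lerDl addr_ge0.
Qed.

Lemma integrable_of_bounded f (T : R) : locint f -> (forall x, 0 <= f x) ->
  (forall n : nat, \int[mu]_(x in `[- n%:R, n%:R]) f x <= T) ->
  mu.-integrable setT (EFin \o f).
Proof.
move=> lf f0 fT; have mf := locint_measurable lf.
apply/integrableP; split; first exact/measurable_EFinP.
under eq_integral do rewrite /= ger0_norm //.
apply: (@le_lt_trans _ _ T%:E); last by rewrite ltry.
have C := cvg_integral_itv mf f0.
rewrite -(cvg_lim _ C) //; apply: lime_le; first by apply/cvg_ex; eexists; exact: C.
apply: nearW => n; have := fT n; rewrite -lee_fin /Rintegral fineK //.
by apply: integrable_fin_num => //; exact: lf.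
Qed.

Lemma norm_le_sqr (B x : R) : x ^+ 2 <= B -> `|x| <= B + 1.
Proof.
rewrite -real_normK ?num_real // => H.
by have := sqr_ge0 (`|x| - 1); have := normr_ge0 x; lra.
Qed.

(** The interval [[- 1/2, 1/2]] has its midpoint at 0, so [rsol_midpoint_le] bounds the data there.
    [Z] is such that [|g + z u|^2] is at most [Z (|g|^2 + |u|^2)]. *)
Lemma csol_data_bound b zr zi : continuous b -> exists2 C, 0 < C & forall gr gi ur vr ui vi,
  csol b zr zi gr gi ur vr ui vi -> sqint gr -> sqint gi ->
  [/\ ur 0 ^+ 2 <= C * (\int[mu]_(x in `[-(1/2), 1/2]) (ur x ^+ 2 + ui x ^+ 2) + \int[mu]_x (gr x ^+ 2 + gi x ^+ 2)),
      vr 0 ^+ 2 <= C * (\int[mu]_(x in `[-(1/2), 1/2]) (ur x ^+ 2 + ui x ^+ 2) + \int[mu]_x (gr x ^+ 2 + gi x ^+ 2)),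
      ui 0 ^+ 2 <= C * (\int[mu]_(x in `[-(1/2), 1/2]) (ur x ^+ 2 + ui x ^+ 2) + \int[mu]_x (gr x ^+ 2 + gi x ^+ 2)) &
      vi 0 ^+ 2 <= C * (\int[mu]_(x in `[-(1/2), 1/2]) (ur x ^+ 2 + ui x ^+ 2) + \int[mu]_x (gr x ^+ 2 + gi x ^+ 2))].
Proof.
move=> cb; have [C C0 HC] := @rsol_midpoint_le R b (-(1/2)) cb.
pose Z := 3 * (1 + zr ^+ 2 + zi ^+ 2).
have Z0 : 0 < Z by rewrite /Z; have := sqr_ge0 zr; have := sqr_ge0 zi; lra.
exists (C * (1 + Z)); first by rewrite mulr_gt0 // addr_gt0.
move=> gr gi ur vr ui vi su qgr qgi.
have [cur cvr cui cvi] := csol_continuous su.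
have lgr := sqint_is_locint qgr; have lgi := sqint_is_locint qgi.
have iG : mu.-integrable setT (EFin \o (fun x => gr x ^+ 2 + gi x ^+ 2)) := integrableTD qgr.2 qgi.2.
have lG : locint (fun x => gr x ^+ 2 + gi x ^+ 2) by move=> a c; apply: integrableS iG.
have lU := sqr2_locint cur cui.
have lGU := locintZ Z (locintD lG lU).
have m12 : -(1/2) + 1 = 1/2 :> R by field.
have m0 : -(1/2) + 1/2 = 0 :> R by field.
pose U := \int[mu]_(x in `[-(1/2), 1/2]) (ur x ^+ 2 + ui x ^+ 2).
pose Gs := \int[mu]_x (gr x ^+ 2 + gi x ^+ 2).
have GI : \int[mu]_(x in `[-(1/2), 1/2]) (gr x ^+ 2 + gi x ^+ 2) <= Gs.
  by apply: le_Rintegral_subset => // x; rewrite addr_ge0 ?sqr_ge0.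
have aux (w y h : R -> R) : rsol b h w y -> (forall x, w x ^+ 2 <= ur x ^+ 2 + ui x ^+ 2) ->
    (forall x, h x ^+ 2 <= Z * ((gr x ^+ 2 + gi x ^+ 2) + (ur x ^+ 2 + ui x ^+ 2))) ->
    w 0 ^+ 2 <= C * (1 + Z) * (U + Gs) /\ y 0 ^+ 2 <= C * (1 + Z) * (U + Gs).
  move=> sw wU hG; have lh := rsol_locint cb sw.
  have lh2 : locint (fun x => h x ^+ 2).
    apply: locint_le lGU.
      by apply: measurable_funX; exact: locint_measurable.
    by move=> x; rewrite ger0_norm ?sqr_ge0.
  have cw := (rsol_continuous sw).1.
  have [H1 H2] := HC _ _ _ sw lh2.
  rewrite m12 m0 in H1 H2.
  suff S : \int[mu]_(x in `[-(1/2), 1/2]) w x ^+ 2 + \int[mu]_(x in `[-(1/2), 1/2]) h x ^+ 2 <=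
      (1 + Z) * (U + Gs).
    split; [apply: (le_trans H1)|apply: (le_trans H2)];
      by rewrite -(mulrA C) ler_wpM2l // ltW.
  have I1 : \int[mu]_(x in `[-(1/2), 1/2]) w x ^+ 2 <= U.
    by apply: le_Rintegral_itv => //; exact: locint_sqr.
  have I2 : \int[mu]_(x in `[-(1/2), 1/2]) h x ^+ 2 <= Z * (Gs + U).
    apply: (@le_trans _ _ (\int[mu]_(x in `[-(1/2), 1/2]) (Z * ((gr x ^+ 2 + gi x ^+ 2) + (ur x ^+ 2 + ui x ^+ 2))))).
      by apply: le_Rintegral_itv.
    rewrite Rintegral_itvZ; last exact: locintD.
    by rewrite Rintegral_itvD // ler_wpM2l ?(ltW Z0) // lerD2r.
  have Gs0 : 0 <= Gs by apply: Rintegral_ge0 => x _; rewrite addr_ge0 ?sqr_ge0.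
  apply: (le_trans (lerD I1 I2)); move: Gs0; clear; move: U Gs => U Gs; lra.
have ha x (p q r : R) : p ^+ 2 + q ^+ 2 = zr ^+ 2 + zi ^+ 2 -> r ^+ 2 <= gr x ^+ 2 + gi x ^+ 2 ->
    (r + (p * ur x + q * ui x)) ^+ 2 <= Z * ((gr x ^+ 2 + gi x ^+ 2) + (ur x ^+ 2 + ui x ^+ 2)).
  move=> pq rg; rewrite /Z; have h0 := sqr_ge0 (p * ui x - q * ur x).
  have h1 := sqr_ge0 (r - (p * ur x + q * ui x)).
  have W0 : 0 <= zr ^+ 2 + zi ^+ 2 by rewrite addr_ge0 ?sqr_ge0.
  have U0 : 0 <= ur x ^+ 2 + ui x ^+ 2 by rewrite addr_ge0 ?sqr_ge0.
  have G0 : 0 <= gr x ^+ 2 + gi x ^+ 2 by rewrite addr_ge0 ?sqr_ge0.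
  have h2 : (p * ur x + q * ui x) ^+ 2 + (p * ui x - q * ur x) ^+ 2 =
     (zr ^+ 2 + zi ^+ 2) * (ur x ^+ 2 + ui x ^+ 2) by rewrite -pq; ring.
  have h3 := mulr_ge0 W0 U0; have h4 := mulr_ge0 W0 G0.
  move: h0 h1 h2 h3 h4 U0 G0 rg; lra.
have [s1 s2] := su.
have [A1 A2] : ur 0 ^+ 2 <= C * (1 + Z) * (U + Gs) /\ vr 0 ^+ 2 <= C * (1 + Z) * (U + Gs).
  apply: (aux _ _ _ s1) => x; first by rewrite lerDl sqr_ge0.
  rewrite (_ : zr * ur x - zi * ui x = zr * ur x + (- zi) * ui x); last by ring.
  by apply: (ha x zr (- zi) (gr x)); [rewrite sqrrN|rewrite lerDl sqr_ge0].
have [A3 A4] : ui 0 ^+ 2 <= C * (1 + Z) * (U + Gs) /\ vi 0 ^+ 2 <= C * (1 + Z) * (U + Gs).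
  apply: (aux _ _ _ s2) => x; first by rewrite lerDr sqr_ge0.
  rewrite (_ : zr * ui x + zi * ur x = zi * ur x + zr * ui x); last by ring.
  by apply: (ha x zi zr (gi x)); [rewrite addrC|rewrite lerDr sqr_ge0].
by split.
Qed.

Lemma line_bound b zr zi gr gi ur vr ui vi : continuous b -> quiet b ->
  csol b zr zi gr gi ur vr ui vi -> sqint gr -> sqint gi -> sqint ur -> sqint ui ->
  zi ^+ 2 * \int[mu]_x (ur x ^+ 2 + ui x ^+ 2) <= \int[mu]_x (gr x ^+ 2 + gi x ^+ 2).
Proof.
move=> cb qb [s1 s2] qgr qgi qur qui.
have qhr : sqint (fun x => gr x + (zr * ur x - zi * ui x)).
  by apply: sqintD => //; apply: sqintB; exact: sqintZ.
have qhi : sqint (fun x => gi x + (zr * ui x + zi * ur x)).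
  by apply: sqintD => //; apply: sqintD; exact: sqintZ.
apply: (@resolvent_bound _ _ zr zi) => //; rewrite ?(qgr.1) ?(qgi.1) //.
- exact: qgr.1.
- exact: qgi.1.
- exact: qur.1.
- exact: qui.1.
- exact: integrableTD qgr.2 qgi.2.
- exact: integrableTD qur.2 qui.2.
rewrite sqint_prodB_integral // (rsol_symmetric cb qb s1 s2 qur qhr qui qhi).
by rewrite subrr.
Qed.

(* The data at 0 of the Dirichlet solutions on [[- n, n]] stay bounded; a solution with a
   cluster point of these data as initial values is square integrable. *)
Lemma line_exists b zr zi gr gi : continuous b -> zi != 0 -> sqint gr -> sqint gi ->
  exists ur vr ui vi, [/\ csol b zr zi gr gi ur vr ui vi, sqint ur & sqint ui].
Proof.
move=> cb z0 qgr qgi.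
have lgr := sqint_is_locint qgr; have lgi := sqint_is_locint qgi.
have iG : mu.-integrable setT (EFin \o (fun x => gr x ^+ 2 + gi x ^+ 2)) := integrableTD qgr.2 qgi.2.
have lG : locint (fun x => gr x ^+ 2 + gi x ^+ 2) by move=> a c; apply: integrableS iG.
have [C C0 HC] := csol_data_bound zr zi cb.
pose Gs := \int[mu]_x (gr x ^+ 2 + gi x ^+ 2); pose S := Gs / zi ^+ 2.
have zi2 : 0 < zi ^+ 2 by rewrite exprn_even_gt0.
have box n : exists w : (R -> R) * (R -> R) * ((R -> R) * (R -> R)),
    csol b zr zi gr gi w.1.1 w.1.2 w.2.1 w.2.2 /\
    \int[mu]_(x in `[- n.+1%:R, n.+1%:R]) (w.1.1 x ^+ 2 + w.2.1 x ^+ 2) <= S.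
  have [|ur [vr [ui [vi [su [e1 e2 e3 e4]]]]]] := @box_exists R b zr zi gr gi n.+1%:R cb z0 lgr lgi.
    by rewrite ltr0n.
  exists (ur, vr, (ui, vi)); split => //=.
  rewrite /S ler_pdivlMr // mulrC.
  apply: (le_trans (box_bound cb lG qgr.1 qgi.1 su _ e1 e2 e3 e4)); first exact: ler0n.
  by apply: le_Rintegral_subset => // x; rewrite addr_ge0 ?sqr_ge0.
have [w Hw] := choice box.
have cw n : [/\ continuous (w n).1.1, continuous (w n).1.2, continuous (w n).2.1 & continuous (w n).2.2].
  exact: csol_continuous (Hw n).1.
have lw n : locint (fun x => (w n).1.1 x ^+ 2 + (w n).2.1 x ^+ 2).
  by have [? ? ? ?] := cw n; exact: sqr2_locint.
have w0 n x : 0 <= (w n).1.1 x ^+ 2 + (w n).2.1 x ^+ 2 by rewrite addr_ge0 ?sqr_ge0.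
have data n i : `|quad ((w n).1.1 0) ((w n).1.2 0) ((w n).2.1 0) ((w n).2.2 0) i| <= C * (S + Gs) + 1.
  have [D1 D2 D3 D4] := HC _ _ _ _ _ _ (Hw n).1 qgr qgi.
  have US : \int[mu]_(x in `[-(1/2), 1/2]) ((w n).1.1 x ^+ 2 + (w n).2.1 x ^+ 2) <= S.
    have n1 : 1 <= n.+1%:R :> R by rewrite ler1n.
    by apply: le_trans (Hw n).2; apply: Rintegral_itv_subset => //; move: n1; lra.
  have CS : C * (\int[mu]_(x in `[-(1/2), 1/2]) ((w n).1.1 x ^+ 2 + (w n).2.1 x ^+ 2) + Gs) <= C * (S + Gs).
    by rewrite ler_wpM2l ?(ltW C0) // lerD2r.
  move: i; apply: quad_ind; rewrite /quad /=; apply: norm_le_sqr.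
  - exact: le_trans D1 CS.
  - exact: le_trans D2 CS.
  - exact: le_trans D3 CS.
  - exact: le_trans D4 CS.
have [p Hp] := bounded_rV_cluster data.
have [ur [vr [ui [vi [su [u1 u2 u3 u4]]]]]] := csol_exists zr zi 0 (p (@Ordinal 4 0 isT))
  (p (@Ordinal 4 1 isT)) (p (@Ordinal 4 2 isT)) (p (@Ordinal 4 3 isT)) cb lgr lgi.
have [cur _ cui _] := csol_continuous su.
have lu := sqr2_locint cur cui.
have iU : mu.-integrable setT (EFin \o (fun x => ur x ^+ 2 + ui x ^+ 2)).
  (* The bound must not depend on [K], whereas [N] does, so the data are taken within
     [1 / (N (K + 1))]. Then the Dirichlet solution is within [1 / (K + 1)] of [ur] and [ui] on
     [[- K, K]], which contributes at most 8 to the integral. *)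
  apply: (@integrable_of_bounded _ (2 * S + 8)) => // [x|K]; first by rewrite addr_ge0 ?sqr_ge0.
  have [N N0 HN] := @csol_bound R b zr zi 0 K.+1%:R cb.
  have e0 : 0 < (N * K.+1%:R)^-1 by rewrite invr_gt0 mulr_gt0 // ltr0n.
  have [n Kn dn] := Hp _ K e0.
  have [s1 s2] := csolB (Hw n).1 su.
  have K1 : N * (N * K.+1%:R)^-1 <= 1.
    rewrite invfM mulrA divff ?gt_eqF // mul1r invf_le1 ?ltr0n //.
    by rewrite ler1n.
  have near x : `|x - 0| < K.+1%:R -> ur x ^+ 2 + ui x ^+ 2 <= 2 * ((w n).1.1 x ^+ 2 + (w n).2.1 x ^+ 2) + 4 / K.+1%:R ^+ 2.
    move=> xK.
    have [|||||d1 _ d3 _] := HN _ _ _ _ _ _ _ _ (N * K.+1%:R)^-1 s1.1 s1.2 s2.1 s2.2 _ _ _ _ _ x xK.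
    - by move=> y _; split => //; ring.
    - by have := dn (@Ordinal 4 0 isT); rewrite /quad /= u1 => /ltW.
    - by have := dn (@Ordinal 4 1 isT); rewrite /quad /= u2 => /ltW.
    - by have := dn (@Ordinal 4 2 isT); rewrite /quad /= u3 => /ltW.
    - by have := dn (@Ordinal 4 3 isT); rewrite /quad /= u4 => /ltW.
    have sq (y q : R) : `|y - q| <= N * (N * K.+1%:R)^-1 -> q ^+ 2 <= 2 * y ^+ 2 + 2 / K.+1%:R ^+ 2.
      rewrite invfM mulrA divff ?gt_eqF // mul1r => yq.
      have : (y - q) ^+ 2 <= K.+1%:R^-1 ^+ 2.
        by rewrite -real_normK ?num_real // lerXn2r ?nnegrE // ?invr_ge0 ?ler0n.
      by rewrite exprVn; have := sqr_ge0 (2 * y - q); move: (_^-1) => k; nra.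
    by have := lerD (sq _ _ d1) (sq _ _ d3); move: (_^-1) => k; lra.
  apply: (@le_trans _ _ (\int[mu]_(x in `[- K%:R, K%:R]) (2 * ((w n).1.1 x ^+ 2 + (w n).2.1 x ^+ 2) + 4 / K.+1%:R ^+ 2))).
    apply: le_Rintegral_itv => //; first by apply: locintD; [exact: locintZ|exact: locint_cst].
    move=> x Kx xK; apply: near; rewrite subr0 (@le_lt_trans _ _ K%:R) ?ltr_nat //.
    by rewrite ler_norml Kx.
  rewrite Rintegral_itvD; [|exact: locintZ|exact: locint_cst].
  rewrite Rintegral_itvZ // Rintegral_itv_cst; last by have := ler0n R K; lra.
  apply: lerD.
    rewrite ler_wpM2l //; apply: le_trans (Hw n).2; apply: Rintegral_itv_subset => //.
    - by rewrite lerN2 ler_nat; exact: leq_trans (leqnSn n).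
    - by have := ler0n R K; lra.
    - by rewrite ler_nat; exact: leq_trans (leqnSn n).
  rewrite mulrAC ler_pdivrMr ?exprn_gt0 ?ltr0n // -natr1.
  by have := ler0n R K; nra.
exists ur, vr, ui, vi; split => //.
- apply: sqint_dom iU _; first exact: continuous_measurable_fun.
  by move=> x; rewrite lerDl sqr_ge0.
- apply: sqint_dom iU _; first exact: continuous_measurable_fun.
  by move=> x; rewrite lerDr sqr_ge0.
Qed.
End Line.

(** * Maximal domains and operators *)

Section ComplexL2.
Context {R : realType}.
Implicit Types (D : set R) (f g h : R -> R[i]).
Local Notation mu := (@lebesgue_measure R).

(** Extension by 0 turns every norm on [D] into an integral over the line and makes the restriction
    of [g] a right-hand side defined everywhere. *)
Definition rpart D f : R -> R := (fun x => complex.Re (f x)) \_ D.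
Definition ipart D f : R -> R := (fun x => complex.Im (f x)) \_ D.
Definition sqnorm D f : R := \int[mu]_x (rpart D f x ^+ 2 + ipart D f x ^+ 2).

Lemma rpart_in D f x : D x -> rpart D f x = complex.Re (f x).
Proof. by move=> Dx; rewrite /rpart patchE mem_set. Qed.

Lemma ipart_in D f x : D x -> ipart D f x = complex.Im (f x).
Proof. by move=> Dx; rewrite /ipart patchE mem_set. Qed.

Lemma rpart_out D f x : ~ D x -> rpart D f x = 0.
Proof. by move=> Dx; rewrite /rpart patchE memNset. Qed.

Lemma ipart_out D f x : ~ D x -> ipart D f x = 0.
Proof. by move=> Dx; rewrite /ipart patchE memNset. Qed.

Lemma l2normE D f : l2norm D f = sqrte (\int[mu]_x (rpart D f x ^+ 2 + ipart D f x ^+ 2)%:E).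
Proof.
rewrite /l2norm unlock poweR12_sqrt; last by apply: integral_ge0 => x _; rewrite poweR_ge0.
congr sqrte; apply: eq_integral => x _ /=.
rewrite powR_mulrn ?normr_ge0 // real_normK ?num_real //.
have [Dx|Dx] := pselect (D x).
  rewrite rpart_in // ipart_in // patchE mem_set //; case: (f x) => p q /=.
  by rewrite sqr_sqrtr // addr_ge0 ?sqr_ge0.
by rewrite rpart_out // ipart_out // patchE memNset // expr0n /= addr0.
Qed.

Lemma L2P D f : measurable D -> L2 D f <-> sqint (rpart D f) /\ sqint (ipart D f).
Proof.
move=> mD.
have mP (F : R -> R) : measurable_fun D F <-> measurable_fun setT (F \_ D).
  by rewrite (measurable_restrictT F mD).
split.
  move=> [[mr mi]]; rewrite l2normE => fin.
  have {}mr : measurable_fun setT (rpart D f) by apply/mP.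
  have {}mi : measurable_fun setT (ipart D f) by apply/mP.
  have i2 : mu.-integrable setT (EFin \o (fun x => rpart D f x ^+ 2 + ipart D f x ^+ 2)).
    apply/integrableP; split.
      by apply/measurable_EFinP; apply: measurable_funD; apply: measurable_funX.
    under eq_integral do rewrite /= ger0_norm ?addr_ge0 ?sqr_ge0 //.
    rewrite ltey; apply/negP => /eqP e; move: fin; by rewrite e.
  split; apply: sqint_dom i2 _ => // x; first by rewrite lerDl sqr_ge0.
  by rewrite lerDr sqr_ge0.
move=> [[mr ir] [mi ii]]; split; first by split; apply/mP.
rewrite l2normE; have := integrableTD ir ii => /integrable_fin_num -/(_ measurableT).
by move=> /fineK <- /=; rewrite ltry.
Qed.

Lemma sqnorm_ge0 D f : 0 <= sqnorm D f.
Proof. by apply: Rintegral_ge0 => x _; rewrite addr_ge0 ?sqr_ge0. Qed.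

Lemma l2norm_sqnorm D f : measurable D -> L2 D f -> l2norm D f = (Num.sqrt (sqnorm D f))%:E.
Proof.
move=> mD /(L2P _ mD)[[mr ir] [mi ii]]; rewrite l2normE /sqnorm /Rintegral.
by have := integrableTD ir ii => /integrable_fin_num -/(_ measurableT) /fineK <-.
Qed.

Lemma ae_eq_partP D f g : f = g %[ae mu in D] <->
  {ae mu, forall x, rpart D f x = rpart D g x} /\ {ae mu, forall x, ipart D f x = ipart D g x}.
Proof.
split=> [fg|[fr fi]].
  split; apply: ae_imp fg => x fg; have [Dx|Dx] := pselect (D x).
  - by rewrite !rpart_in // fg.
  - by rewrite !rpart_out.
  - by rewrite !ipart_in // fg.
  - by rewrite !ipart_out.
apply: (ae_imp2 _ fr fi) => x er ei Dx.
move: er ei; rewrite !rpart_in // !ipart_in //.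
by case: (f x) (g x) => p q [p' q'] /= -> ->.
Qed.

Lemma rpartB D f g x : rpart D (fun x => f x - g x) x = rpart D f x - rpart D g x.
Proof.
have [Dx|Dx] := pselect (D x); last by rewrite !rpart_out // subr0.
by rewrite !rpart_in //; case: (f x) (g x) => p q [p' q'].
Qed.

Lemma ipartB D f g x : ipart D (fun x => f x - g x) x = ipart D f x - ipart D g x.
Proof.
have [Dx|Dx] := pselect (D x); last by rewrite !ipart_out // subr0.
by rewrite !ipart_in //; case: (f x) (g x) => p q [p' q'].
Qed.

Lemma rpartT f x : rpart setT f x = complex.Re (f x).
Proof. exact: rpart_in. Qed.

Lemma ipartT f x : ipart setT f x = complex.Im (f x).
Proof. exact: ipart_in. Qed.

Lemma sqnorm_eq D f g : measurable D -> L2 D f -> L2 D g -> f = g %[ae mu in D] -> sqnorm D f = sqnorm D g.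
Proof.
move=> mD /(L2P _ mD)[[mr _] [mi _]] /(L2P _ mD)[[mr' _] [mi' _]] /ae_eq_partP[er ei].
apply: Rintegral_ae_eq => //.
- by apply: measurable_funD; apply: measurable_funX.
- by apply: measurable_funD; apply: measurable_funX.
- by apply: (ae_imp2 _ er ei) => x -> ->.
Qed.

End ComplexL2.

(** * Uniqueness of absolutely continuous solutions *)

Section AbsolutelyContinuousSolutions.
Context {R : realType}.
Implicit Types (D : set R) (f g h : R -> R[i]) (b : R -> R).
Local Notation mu := (@lebesgue_measure R).

(** The differences solve the homogeneous system on []- K, K[] with zero data at 0, so [csol_bound]
    with [C = 0] applies. Clamping makes functions known on [[- K, K]] into primitives on the
    line. *)
Lemma ac_csol_eq b (zr zi K : R) (F1 Q1 F2 Q2 gr gi ur vr ui vi : R -> R) : continuous b -> 0 < K ->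
  ac_on (- K) K F1 -> ac_on (- K) K Q1 -> ac_on (- K) K F2 -> ac_on (- K) K Q2 ->
  {ae mu, forall x : R, - K < x -> x < K -> [/\ derive1 F1 x = b x * F1 x + Q1 x,
     derive1 Q1 x = - (b x) ^+ 2 * F1 x - b x * Q1 x - (gr x + (zr * F1 x - zi * F2 x)),
     derive1 F2 x = b x * F2 x + Q2 x &
     derive1 Q2 x = - (b x) ^+ 2 * F2 x - b x * Q2 x - (gi x + (zr * F2 x + zi * F1 x))]} ->
  csol b zr zi gr gi ur vr ui vi ->
  ur 0 = F1 0 -> vr 0 = Q1 0 -> ui 0 = F2 0 -> vi 0 = Q2 0 ->
  forall x, - K < x < K -> F1 x = ur x /\ F2 x = ui x.
Proof.
move=> cb K0 aF1 aQ1 aF2 aQ2 H su e1 e2 e3 e4.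
have KK : - K <= K by lra.
have [f1 [pF1 dF1]] := ac_on_primitive KK aF1; have [q1 [pQ1 dQ1]] := ac_on_primitive KK aQ1.
have [f2 [pF2 dF2]] := ac_on_primitive KK aF2; have [q2 [pQ2 dQ2]] := ac_on_primitive KK aQ2.
have [N N0 HN] := @csol_bound R b zr zi 0 K cb.
have [s1 s2] := su; have [cur cvr cui cvi] := csol_continuous su.
have clE x : - K < x -> x < K -> clamp (- K) K x = x by move=> /ltW ? /ltW ?; exact: clamp_id.
pose A1 x := F1 (clamp (- K) K x) - ur x; pose P1 x := Q1 (clamp (- K) K x) - vr x.
pose A2 x := F2 (clamp (- K) K x) - ui x; pose P2 x := Q2 (clamp (- K) K x) - vi x.
(* Changing the density on a null set makes the equation hold at every point of the interval, as
   [csol_bound] requires. *)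
have glue (F f G : R -> R) : primitive F f -> continuous G ->
    {ae mu, forall x, - K < x -> x < K -> f x = G x} ->
    exists2 g, primitive F g & forall x, `|x - 0| < K -> g x = G x.
  move=> pF cG fG; exists (fun x => if `|x - 0| < K then G x else f x); last by move=> x ->.
  apply: (primitive_ae_eq pF).
    apply: measurable_fun_ifT.
    - apply: measurable_fun_ltr => //.
      by apply: measurableT_comp => //; exact: measurable_funB.
    - exact: continuous_measurable_fun.
    - by apply: locint_measurable; case: pF.
  apply: ae_imp fG => x fG; case: ifPn => // xK; apply: fG; move: xK;
    by rewrite subr0 ltr_norml => /andP[].
have pA1 := primitiveB pF1 s1.1; have pP1 := primitiveB pQ1 s1.2.
have pA2 := primitiveB pF2 s2.1; have pP2 := primitiveB pQ2 s2.2.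
have cA1 : continuous A1 := primitive_continuous pA1.
have cP1 : continuous P1 := primitive_continuous pP1.
have cA2 : continuous A2 := primitive_continuous pA2.
have cP2 : continuous P2 := primitive_continuous pP2.
have cM (p q : R -> R) : continuous p -> continuous q -> continuous (fun x => p x * q x).
  by move=> cp cq x; apply: cvgM; [exact: cp|exact: cq].
have cB (p q : R -> R) : continuous p -> continuous q -> continuous (fun x => p x - q x).
  by move=> cp cq x; apply: cvgB; [exact: cp|exact: cq].
have cD (p q : R -> R) : continuous p -> continuous q -> continuous (fun x => p x + q x).
  by move=> cp cq x; apply: cvgD; [exact: cp|exact: cq].
have cK (k : R) (p : R -> R) : continuous p -> continuous (fun x => k * p x).
  by move=> cp x; apply: cvgMr; exact: cp.
have cb2 : continuous (fun x => - b x ^+ 2).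
  by move=> x; apply: cvgN; under [X in X @ _]eq_fun do rewrite expr2; exact: cM.
have [|f1' pA1' E1] := glue _ _ (fun x => b x * A1 x + P1 x) pA1 (cD _ _ (cM _ _ cb cA1) cP1) _.
  apply: (ae_imp2 _ H dF1) => x Hx dx x1 x2; have [h1 _ _ _] := Hx x1 x2.
  have := dx x1 x2 => d1; rewrite /A1 /P1 clE //.
  by move: h1; rewrite derive1E derive_val => ->; ring.
have [|q1' pP1' E2] := glue _ _ (fun x => - (b x) ^+ 2 * A1 x - b x * P1 x - (zr * A1 x - zi * A2 x)) pP1
    (cB _ _ (cB _ _ (cM _ _ cb2 cA1) (cM _ _ cb cP1)) (cB _ _ (cK zr _ cA1) (cK zi _ cA2))) _.
  apply: (ae_imp2 _ H dQ1) => x Hx dx x1 x2; have [_ h1 _ _] := Hx x1 x2.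
  have := dx x1 x2 => d1; rewrite /A1 /P1 /A2 !clE //.
  by move: h1; rewrite derive1E derive_val => ->; ring.
have [|f2' pA2' E3] := glue _ _ (fun x => b x * A2 x + P2 x) pA2 (cD _ _ (cM _ _ cb cA2) cP2) _.
  apply: (ae_imp2 _ H dF2) => x Hx dx x1 x2; have [_ _ h1 _] := Hx x1 x2.
  have := dx x1 x2 => d1; rewrite /A2 /P2 !clE //.
  by move: h1; rewrite derive1E derive_val => ->; ring.
have [|q2' pP2' E4] := glue _ _ (fun x => - (b x) ^+ 2 * A2 x - b x * P2 x - (zr * A2 x + zi * A1 x)) pP2
    (cB _ _ (cB _ _ (cM _ _ cb2 cA2) (cM _ _ cb cP2)) (cD _ _ (cK zr _ cA2) (cK zi _ cA1))) _.
  apply: (ae_imp2 _ H dQ2) => x Hx dx x1 x2; have [_ _ _ h1] := Hx x1 x2.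
  have := dx x1 x2 => d1; rewrite /A2 /P2 /A1 !clE //.
  by move: h1; rewrite derive1E derive_val => ->; ring.
move=> x /andP[x1 x2]; have x0K : `|x - 0| < K by rewrite subr0 ltr_norml x1.
have cl0 : clamp (- K) K 0 = 0 by apply: clE; lra.
have [|||||d1 _ d3 _] := HN A1 P1 A2 P2 f1' q1' f2' q2' 0 pA1' pP1' pA2' pP2' _ _ _ _ _ x x0K.
- by move=> y yK; rewrite E1 // E2 // E3 // E4.
- by rewrite /A1 /= cl0 e1 subrr normr0.
- by rewrite /P1 /= cl0 e2 subrr normr0.
- by rewrite /A2 /= cl0 e3 subrr normr0.
- by rewrite /P2 /= cl0 e4 subrr normr0.
move: d1 d3; rewrite mulr0 !normr_le0 /A1 /A2 clE // !subr_eq0.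
by move=> /eqP -> /eqP ->.
Qed.
End AbsolutelyContinuousSolutions.

(** * Elements of the maximal domain as solutions of the system *)

Section MaximalDomain.
Context {R : realType}.
Implicit Types (D : set R) (f g h : R -> R[i]) (b : R -> R).
Local Notation mu := (@lebesgue_measure R).

Lemma normc_leD (p q : R) : Normc.normc (p +i* q) <= `|p| + `|q|.
Proof.
rewrite /= -(ger0_norm (addr_ge0 (normr_ge0 p) (normr_ge0 q))) -sqrtr_sqr ler_wsqrtr //.
rewrite -(real_normK (num_real p)) -(real_normK (num_real q)).
by have := mulr_ge0 (normr_ge0 p) (normr_ge0 q); lra.
Qed.

Lemma normc_Re (w : R[i]) : `|complex.Re w| <= Normc.normc w.
Proof.
by case: w => p q /=; rewrite -sqrtr_sqr ler_wsqrtr // lerDl sqr_ge0.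
Qed.

Lemma normc_Im (w : R[i]) : `|complex.Im w| <= Normc.normc w.
Proof.
by case: w => p q /=; rewrite -sqrtr_sqr ler_wsqrtr // lerDr sqr_ge0.
Qed.

Lemma absolutely_continuousP c d f : absolutely_continuous c d f <->
  ac_on c d (fun x => complex.Re (f x)) /\ ac_on c d (fun x => complex.Im (f x)).
Proof.
split=> [acf|[ar ai] e e0].
  split=> e e0; have [dl dl0 H] := acf e e0; exists dl => // n s t st tr sdl;
    apply: le_lt_trans (H n s t st tr sdl); apply: ler_sum => i _.
  - by apply: le_trans (normc_Re _); case: (f (t i)) (f (s i)) => p q [p' q'].
  - by apply: le_trans (normc_Im _); case: (f (t i)) (f (s i)) => p q [p' q'].
have e2 : 0 < e / 2 by rewrite divr_gt0.
have [d1 d10 H1] := ar _ e2; have [d2 d20 H2] := ai _ e2.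
exists (Num.min d1 d2); first by rewrite lt_min d10.
move=> n s t st tr; rewrite lt_min => /andP[sd1 sd2].
apply: (@le_lt_trans _ _ (\sum_(i < n) (`|complex.Re (f (t i)) - complex.Re (f (s i))| +
    `|complex.Im (f (t i)) - complex.Im (f (s i))|))).
  apply: ler_sum => i _; case: (f (t i)) (f (s i)) => p q [p' q']; exact: normc_leD.
rewrite big_split /= [e]splitr; apply: ltrD; [exact: H1|exact: H2].
Qed.

(** A union of symmetric compact intervals; the line and the boxes both have this form, so initial
    data at 0 serve for all of them. *)
Definition exhausted D := forall x, D x -> exists K : R, [/\ 0 < K, - K < x < K & `[- K, K] `<=` D].

(** On [D], [f] agrees with the global solution that has the same data at 0 and right-hand side [g]
    extended by 0. In particular, domain elements extend continuously to the end points of a box. *)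
Lemma Dmax_csol b D (z : R[i]) f g : continuous b -> measurable D -> exhausted D ->
  Dmax D b f -> L2 D g -> (fun x => tau b f x - z * f x) = g %[ae mu in D] ->
  exists ur vr ui vi, csol b (complex.Re z) (complex.Im z) (rpart D g) (ipart D g) ur vr ui vi /\
    forall x, D x -> f x = ur x +i* ui x.
Proof.
move=> cb mD exD [_ acf acq _] /(L2P _ mD)[qr qi] eqn.
have [ur [vr [ui [vi [su [u1 u2 u3 u4]]]]]] := csol_exists (complex.Re z) (complex.Im z) 0
  (complex.Re (f 0)) (complex.Re (quasi_derive b f 0))
  (complex.Im (f 0)) (complex.Im (quasi_derive b f 0)) cb (sqint_is_locint qr) (sqint_is_locint qi).
exists ur, vr, ui, vi; split => // x Dx.
have [K [K0 xK KD]] := exD x Dx.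
have /absolutely_continuousP[a1 a2] := acf _ _ KD.
have /absolutely_continuousP[a3 a4] := acq _ _ KD.
have [|e1 e2] := ac_csol_eq cb K0 a1 a3 a2 a4 _ su u1 u2 u3 u4 xK; last first.
  by move: e1 e2; case: (f x) => p q /= -> ->.
apply: ae_imp eqn => y eqn y1 y2.
have Dy : D y by apply: KD; rewrite /= in_itv /= !ltW.
have := eqn Dy; rewrite !(rpart_in _ Dy) !(ipart_in _ Dy) => <-.
rewrite /tau /quasi_derive /cderive; case: z {eqn su} => zr zi; case: (f y) => p q /=.
rewrite !(mul0r, subr0, addr0, mulr0, oppr0, add0r); split; ring.
Qed.

(** The equation for [u] has a continuous right-hand side, so [cderive] is the classical derivative
    and the quasi-derivative is [v] at every point; only the derivative of [v] is an almost
    everywhere matter. *)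
Lemma csol_tau b zr zi gr gi ur vr ui vi : continuous b -> csol b zr zi gr gi ur vr ui vi ->
  [/\ (forall D, locally_absolutely_continuous D (fun x => ur x +i* ui x)),
     (forall D, locally_absolutely_continuous D (quasi_derive b (fun x => ur x +i* ui x))) &
     {ae mu, forall x, tau b (fun x => ur x +i* ui x) x =
        (gr x + (zr * ur x - zi * ui x)) +i* (gi x + (zr * ui x + zi * ur x))}].
Proof.
move=> cb su; have [cur cvr cui cvi] := csol_continuous su; have [[pr qr] [pi qi]] := su.
have dr x : derive1 ur x = b x * ur x + vr x.
  rewrite derive1E; apply: derive_val; apply: primitive_is_derive pr _.
  by apply: cvgD; [apply: cvgM; [exact: cb|exact: cur]|exact: cvr].
have di x : derive1 ui x = b x * ui x + vi x.
  rewrite derive1E; apply: derive_val; apply: primitive_is_derive pi _.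
  by apply: cvgD; [apply: cvgM; [exact: cb|exact: cui]|exact: cvi].
have qd : quasi_derive b (fun x => ur x +i* ui x) = (fun x => vr x +i* vi x).
  apply/funext => x; rewrite /quasi_derive /cderive /= dr di; congr (_ +i* _); ring.
split=> [D c d _|D c d _|].
- by apply/absolutely_continuousP; split; [exact: primitive_ac pr|exact: primitive_ac pi].
- by rewrite qd; apply/absolutely_continuousP; split; [exact: primitive_ac qr|exact: primitive_ac qi].
apply: (ae_imp2 _ (primitive_ae_is_derive qr) (primitive_ae_is_derive qi)) => x d1 d2.
have e1 := @derive_val _ _ _ _ _ _ _ d1; have e2 := @derive_val _ _ _ _ _ _ _ d2.
rewrite -!derive1E in e1 e2; rewrite /tau qd /cderive /= e1 e2 dr di.
by congr (_ +i* _); ring.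
Qed.

Lemma csol_Dmax b D (z : R[i]) g ur vr ui vi : continuous b -> measurable D ->
  csol b (complex.Re z) (complex.Im z) (rpart D g) (ipart D g) ur vr ui vi ->
  L2 D g -> L2 D (fun x => ur x +i* ui x) ->
  let U := fun x => ur x +i* ui x in let h := fun x => g x + z * U x in
  [/\ Dmax D b U, L2 D h & h = tau b U %[ae mu in D]].
Proof.
move=> cb mD su Lg LU U h; have [a1 a2 eq] := csol_tau cb su.
have hE : h = tau b U %[ae mu in D].
  apply: ae_imp eq => x eq Dx; rewrite eq rpart_in // ipart_in // /h /U.
  by case: z {su h eq} => zr zi; case: (g x) => p q /=; congr (_ +i* _); ring.
have Lh : L2 D h.
  have /(L2P _ mD)[qgr qgi] := Lg; have /(L2P _ mD)[qur qui] := LU.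
  apply/(L2P _ mD); split.
    rewrite (_ : rpart D h = (fun x => rpart D g x + (complex.Re z * rpart D U x - complex.Im z * ipart D U x))).
      by apply: sqintD => //; apply: sqintB; exact: sqintZ.
    apply/funext => x; have [Dx|Dx] := pselect (D x); last by rewrite !(rpart_out, ipart_out) //; ring.
    rewrite !(rpart_in, ipart_in) // /h; case: z {su h hE eq} => zr zi; case: (g x) => p q /=; ring.
  rewrite (_ : ipart D h = (fun x => ipart D g x + (complex.Re z * ipart D U x + complex.Im z * rpart D U x))).
    by apply: sqintD => //; apply: sqintD; exact: sqintZ.
  apply/funext => x; have [Dx|Dx] := pselect (D x); last by rewrite !(rpart_out, ipart_out) //; ring.
  rewrite !(rpart_in, ipart_in) // /h; case: z {su h hE eq} => zr zi; case: (g x) => p q /=; ring.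
split => //; split => //; exists h => //; exact: ae_eq_sym.
Qed.

End MaximalDomain.

(** * From well-posedness to resolvents *)

Section Resolvents.
Context {R : realType}.
Implicit Types (D : set R) (f g h u v : R -> R[i]) (b : R -> R) (z : R[i]).
Local Notation mu := (@lebesgue_measure R).

Lemma Im_neq0 z : z \isn't Num.real -> complex.Im z != 0.
Proof.
apply: contraNN => /eqP z0; rewrite realE !lecE /= z0 eqxx /=.
exact: le_total.
Qed.

Lemma L2_ae D f g : measurable D -> L2 D f -> cmeasurable_fun D g -> f = g %[ae mu in D] -> L2 D g.
Proof.
move=> mD Lf [mr mi] fg; split; first by split.
have [_ fin] := Lf; rewrite !l2normE in fin *.
rewrite (_ : (\int[mu]_x (rpart D g x ^+ 2 + ipart D g x ^+ 2)%:E =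
  \int[mu]_x (rpart D f x ^+ 2 + ipart D f x ^+ 2)%:E)%E) //.
have /(L2P _ mD)[[mfr _] [mfi _]] := Lf.
have mgr : measurable_fun setT (rpart D g) by apply: (measurable_restrictT (fun x => complex.Re (g x)) mD).1.
have mgi : measurable_fun setT (ipart D g) by apply: (measurable_restrictT (fun x => complex.Im (g x)) mD).1.
move/ae_eq_partP : fg => [er ei].
apply: ae_eq_integral => //.
- by apply/measurable_EFinP; apply: measurable_funD; apply: measurable_funX.
- by apply/measurable_EFinP; apply: measurable_funD; apply: measurable_funX.
- by apply: (ae_imp2 _ er ei) => x -> ->.
Qed.

Lemma continuous_cmeasurable D (ur ui : R -> R) : continuous ur -> continuous ui ->
  cmeasurable_fun D (fun x => ur x +i* ui x).
Proof.
by move=> cr ci; split; apply: measurable_funTS; exact: continuous_measurable_fun.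
Qed.

(** [Q] expresses the boundary conditions of [dom] on continuous functions of the line: trivial for
    the line, vanishing end values for a box. This lets the same proofs serve both operators. *)
Definition adapted D b (dom : (R -> R[i]) -> Prop) (Q : (R -> R) -> (R -> R) -> Prop) :=
  [/\ measurable D, exhausted D, forall f, dom f -> Dmax D b f &
    forall f ur ui, continuous ur -> continuous ui -> (forall x, D x -> f x = ur x +i* ui x) ->
      Dmax D b f -> dom f <-> Q ur ui].

(** Trades almost everywhere classes and the choice of a representative for genuine solutions of the
    first-order system. *)
Lemma resolvent_eqP D b dom Q z g u : continuous b -> adapted D b dom Q -> L2 D g ->
  resolvent_eq D (tau_operator D b dom) z g u <->
  L2 D u /\ exists ur vr ui vi, [/\
    csol b (complex.Re z) (complex.Im z) (rpart D g) (ipart D g) ur vr ui vi,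
    u = (fun x => ur x +i* ui x) %[ae mu in D] & Q ur ui].
Proof.
move=> cb [mD exD domD domQ] Lg; split.
  move=> [h [Lu Lh [f [df uf htau]]] eqn]; split => //.
  have [|ur [vr [ui [vi [su fU]]]]] := Dmax_csol cb mD exD (domD _ df) Lg (z := z).
    by apply: (ae_imp3 _ eqn uf htau) => x e1 e2 e3 Dx; rewrite -e1 // e2 // e3.
  have [cur _ cui _] := csol_continuous su.
  exists ur, vr, ui, vi; split => //.
    by apply: ae_imp uf => x e Dx; rewrite e // fU.
  by apply/(domQ f) => //; exact: domD.
move=> [Lu [ur [vr [ui [vi [su uU Qu]]]]]].
have [cur _ cui _] := csol_continuous su.
have LU : L2 D (fun x => ur x +i* ui x).
  by apply: L2_ae uU => //; exact: continuous_cmeasurable.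
have [dU Lh hE] := csol_Dmax cb mD su Lg LU.
have Lh' : L2 D (fun x => g x + z * (ur x +i* ui x)) by [].
exists (fun x => g x + z * (ur x +i* ui x)).
  split => //; exists (fun x => ur x +i* ui x); split => //.
  by apply/(domQ _ ur ui).
by apply: ae_imp uU => x e Dx; rewrite e //; ring.
Qed.

Lemma tau_operator_ae D b dom f h f' h' : tau_operator D b dom f h ->
  L2 D f' -> L2 D h' -> f = f' %[ae mu in D] -> h = h' %[ae mu in D] ->
  tau_operator D b dom f' h'.
Proof.
move=> [_ _ [f0 [d0 e1 e2]]] Lf Lh ef eh; split => //; exists f0; split => //.
  by apply: ae_eq_trans e1; exact: ae_eq_sym.
by apply: ae_eq_trans e2; exact: ae_eq_sym.
Qed.

(** Differences, an a priori bound and solvability: together with [adapted] this yields a resolvent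
    bounded by [1 / |Im z|]. *)
Definition well_posed D b (Q : (R -> R) -> (R -> R) -> Prop) z :=
  [/\ forall ur ui ur' ui', Q ur ui -> Q ur' ui' -> Q (fun x => ur x - ur' x) (fun x => ui x - ui' x),
    forall g ur vr ui vi, csol b (complex.Re z) (complex.Im z) (rpart D g) (ipart D g) ur vr ui vi ->
      L2 D g -> L2 D (fun x => ur x +i* ui x) -> Q ur ui ->
      complex.Im z ^+ 2 * sqnorm D (fun x => ur x +i* ui x) <= sqnorm D g &
    forall g, L2 D g -> exists ur vr ui vi,
      [/\ csol b (complex.Re z) (complex.Im z) (rpart D g) (ipart D g) ur vr ui vi,
      L2 D (fun x => ur x +i* ui x) & Q ur ui]].

Lemma sqnorm_eq0 D f : measurable D -> L2 D f -> sqnorm D f <= 0 -> f = (fun=> 0) %[ae mu in D].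
Proof.
move=> mD Lf f0; have /(L2P _ mD)[qr qi] := Lf.
have {}f0 : sqnorm D f = 0 by apply/eqP; rewrite eq_le f0 sqnorm_ge0.
have I0 : (\int[mu]_x `|(rpart D f x ^+ 2 + ipart D f x ^+ 2)%:E| = 0)%E.
  under eq_integral do rewrite /= ger0_norm ?addr_ge0 ?sqr_ge0 //.
  rewrite -[RHS](congr1 EFin f0) /sqnorm /Rintegral fineK //.
  exact: integrable_fin_num (integrableTD qr.2 qi.2).
have : ae_eq mu setT (fun x => (rpart D f x ^+ 2 + ipart D f x ^+ 2)%:E) (cst 0%E).
  apply/(ae_eq_integral_abs mu measurableT) => //.
  by apply/measurable_EFinP; apply: measurable_funD; apply: measurable_funX; [exact: qr.1|exact: qi.1].
apply: ae_imp => x /(_ I) /= [] /eqP; rewrite paddr_eq0 ?sqr_ge0 // !sqrf_eq0 => /andP[/eqP e1 /eqP e2] Dx.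
by move: e1 e2; rewrite rpart_in // ipart_in //; case: (f x) => p q /= -> ->.
Qed.

Lemma L2B D f g : measurable D -> L2 D f -> L2 D g -> L2 D (fun x => f x - g x).
Proof.
move=> mD /(L2P _ mD)[qr qi] /(L2P _ mD)[qr' qi']; apply/(L2P _ mD); split.
  by rewrite (_ : rpart _ _ = fun x => rpart D f x - rpart D g x); [exact: sqintB|apply/funext => x; exact: rpartB].
by rewrite (_ : ipart _ _ = fun x => ipart D f x - ipart D g x); [exact: sqintB|apply/funext => x; exact: ipartB].
Qed.

Lemma resolvent_eqB D b dom Q z g g' u u' : continuous b -> adapted D b dom Q -> well_posed D b Q z ->
  L2 D g -> L2 D g' ->
  resolvent_eq D (tau_operator D b dom) z g u -> resolvent_eq D (tau_operator D b dom) z g' u' ->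
  resolvent_eq D (tau_operator D b dom) z (fun x => g x - g' x) (fun x => u x - u' x).
Proof.
move=> cb ad [QB _ _] Lg Lg' /(resolvent_eqP _ _ cb ad Lg)[Lu [ur [vr [ui [vi [su uU Qu]]]]]].
move=> /(resolvent_eqP _ _ cb ad Lg')[Lu' [ur' [vr' [ui' [vi' [su' uU' Qu']]]]]].
have [mD _ _ _] := ad.
apply/(resolvent_eqP _ _ cb ad (L2B mD Lg Lg')); split; first exact: L2B.
exists (fun x => ur x - ur' x), (fun x => vr x - vr' x), (fun x => ui x - ui' x), (fun x => vi x - vi' x).
split.
- have -> : rpart D (fun x => g x - g' x) = (fun x => rpart D g x - rpart D g' x) by apply/funext => x; exact: rpartB.
  have -> : ipart D (fun x => g x - g' x) = (fun x => ipart D g x - ipart D g' x) by apply/funext => x; exact: ipartB.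
  exact: csolB.
- by apply: (ae_imp2 _ uU uU') => x e1 e2 Dx; rewrite e1 // e2.
- exact: QB.
Qed.

Lemma well_posed_bound D b dom Q z g u : continuous b -> adapted D b dom Q -> well_posed D b Q z ->
  L2 D g -> resolvent_eq D (tau_operator D b dom) z g u ->
  complex.Im z ^+ 2 * sqnorm D u <= sqnorm D g.
Proof.
move=> cb ad [_ bd _] Lg /(resolvent_eqP _ _ cb ad Lg)[Lu [ur [vr [ui [vi [su uU Qu]]]]]].
have [mD _ _ _] := ad; have [cur _ cui _] := csol_continuous su.
have LU : L2 D (fun x => ur x +i* ui x) by apply: L2_ae uU => //; exact: continuous_cmeasurable.
by rewrite (sqnorm_eq mD Lu LU uU); exact: bd su _ _ _.
Qed.

Lemma well_posed_diff D b dom Q z g g' u u' : continuous b -> adapted D b dom Q -> well_posed D b Q z ->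
  L2 D g -> L2 D g' ->
  resolvent_eq D (tau_operator D b dom) z g u -> resolvent_eq D (tau_operator D b dom) z g' u' ->
  complex.Im z ^+ 2 * sqnorm D (fun x => u x - u' x) <= sqnorm D (fun x => g x - g' x).
Proof.
move=> cb ad wp Lg Lg' s s'; have [mD _ _ _] := ad.
exact: (well_posed_bound cb ad wp (L2B mD Lg Lg') (resolvent_eqB cb ad wp Lg Lg' s s')).
Qed.

Lemma well_posed_exists D b dom Q z g : continuous b -> adapted D b dom Q -> well_posed D b Q z ->
  L2 D g -> exists u, resolvent_eq D (tau_operator D b dom) z g u.
Proof.
move=> cb ad [_ _ ex] Lg; have [ur [vr [ui [vi [su LU Qu]]]]] := ex g Lg.
exists (fun x => ur x +i* ui x); apply/(resolvent_eqP _ _ cb ad Lg); split => //.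
by exists ur, vr, ui, vi; split => //; exact: aeW.
Qed.

(** The a priori bound for the difference of two solutions, whose right-hand side is 0. *)
Lemma resolvent_eq0 D b dom Q z : continuous b -> adapted D b dom Q -> well_posed D b Q z ->
  complex.Im z != 0 -> forall g u u', L2 D g ->
  resolvent_eq D (tau_operator D b dom) z g u -> resolvent_eq D (tau_operator D b dom) z g u' ->
  u = u' %[ae mu in D].
Proof.
move=> cb ad wp z0 g u u' Lg su su'; have [mD _ _ _] := ad.
have z2 : 0 < complex.Im z ^+ 2 by rewrite exprn_even_gt0.
have Lu : L2 D u by case: su => ? [].
have Lu' : L2 D u' by case: su' => ? [].
have gg0 : sqnorm D (fun x => g x - g x) = 0.
  rewrite /sqnorm; under eq_Rintegral do rewrite rpartB ipartB !subrr expr0n addr0.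
  by rewrite /Rintegral integral0.
have := well_posed_diff cb ad wp Lg Lg su su'; rewrite gg0 pmulr_rle0 // => H.
have := sqnorm_eq0 mD (L2B mD Lu Lu') H.
by apply: ae_imp => x e Dx; apply/eqP; rewrite -subr_eq0 e.
Qed.

Lemma well_posed_resolvent_set D b dom Q z : continuous b -> adapted D b dom Q -> well_posed D b Q z ->
  complex.Im z != 0 -> in_resolvent_set D (tau_operator D b dom) z.
Proof.
move=> cb ad wp z0; have [mD _ _ _] := ad.
have z2 : 0 < complex.Im z ^+ 2 by rewrite exprn_even_gt0.
exists (`|complex.Im z|^-1); first by rewrite invr_ge0.
move=> g Lg; have [u su] := well_posed_exists cb ad wp Lg.
have Lu : L2 D u by case: su => ? [].
exists u; split => //.
  by move=> v sv; exact: (resolvent_eq0 cb ad wp z0 Lg).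
rewrite !l2norm_sqnorm // -EFinM lee_fin.
have := well_posed_bound cb ad wp Lg su.
rewrite -(ler_pM2l (_ : 0 < `|complex.Im z|)) ?normr_gt0 // mulrA divff ?normr_eq0 // mul1r.
move=> H; rewrite -sqrtr_sqr -sqrtrM ?sqr_ge0 // ler_wsqrtr //.
Qed.
End Resolvents.

(** * The line and the boxes *)

Section Adapted.
Context {R : realType}.
Implicit Types (D : set R) (f g h u v : R -> R[i]) (b : R -> R) (z : R[i]).
Local Notation mu := (@lebesgue_measure R).

(** [F] is controlled only on the open interval; its one-sided limit is the value of the continuous
    function [u] at the end point. *)
Lemma at_right_boundary (F u : R -> R) (a c : R) : a < c -> continuous u ->
  (forall x, a < x -> x < c -> F x = u x) -> F x @[x --> a^'+] --> (0 : R) <-> u a = 0.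
Proof.
move=> ac cu Fu.
have cua : u x @[x --> a^'+] --> u a by apply: cvg_at_right_filter; exact: cu.
have e : {near a^'+, F =1 u}.
  by near=> x; apply: Fu; near: x; [exact: nbhs_right_gt|exact: nbhs_right_lt].
have e' : {near a^'+, u =1 F} by near=> x; symmetry; near: x; exact: e.
split=> [F0|u0]; last by rewrite -u0; apply: cvg_trans cua; exact: near_eq_cvg.
have u0 : u x @[x --> a^'+] --> (0 : R) by apply: cvg_trans F0; exact: near_eq_cvg.
exact: (cvg_unique _ cua u0).
Unshelve. all: by end_near. Qed.

Lemma at_left_boundary (F u : R -> R) (a c : R) : a < c -> continuous u ->
  (forall x, a < x -> x < c -> F x = u x) -> F x @[x --> c^'-] --> (0 : R) <-> u c = 0.
Proof.
move=> ac cu Fu.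
have cua : u x @[x --> c^'-] --> u c by apply: cvg_at_left_filter; exact: cu.
have e : {near c^'-, F =1 u}.
  by near=> x; apply: Fu; near: x; [exact: nbhs_left_gt|exact: nbhs_left_lt].
have e' : {near c^'-, u =1 F} by near=> x; symmetry; near: x; exact: e.
split=> [F0|u0]; last by rewrite -u0; apply: cvg_trans cua; exact: near_eq_cvg.
have u0 : u x @[x --> c^'-] --> (0 : R) by apply: cvg_trans F0; exact: near_eq_cvg.
exact: (cvg_unique _ cua u0).
Unshelve. all: by end_near. Qed.

Lemma exhausted_setT : exhausted [set: R].
Proof.
move=> x _; exists (`|x| + 1); split => //.
by rewrite -ltr_norml ltrDl.
Qed.

Lemma exhausted_box (L : R) : exhausted (box L).
Proof.
move=> x; rewrite /box /= in_itv /= -ltr_norml => xL.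
have xx : - `|x| <= x <= `|x| by rewrite -ler_norml.
have x0 := normr_ge0 x; move: xx x0 xL; move: (`|x|) => k xx x0 xL.
exists ((k + L / 2) / 2); split; [lra|move: xx; lra|].
move=> y; rewrite /= !in_itv /=; lra.
Qed.

Definition vanishing_at (L : R) (ur ui : R -> R) :=
  [/\ ur (L / 2) = 0, ui (L / 2) = 0, ur (- (L / 2)) = 0 & ui (- (L / 2)) = 0].

Lemma adapted_line b : adapted setT b (Dmax setT b) (fun _ _ => True).
Proof.
split => //; exact: exhausted_setT.
Qed.

Lemma measurable_box (L : R) : measurable (box L).
Proof. exact: measurable_itv. Qed.

Lemma adapted_box b (L : R) : 0 < L ->
  adapted (box L) b (fun f => Dmax (box L) b f /\ dirichlet L f) (vanishing_at L).
Proof.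
move=> L0; have l0 : - (L / 2) < L / 2 by lra.
split=> [||f []//|f ur ui cr ci fU df].
- exact: measurable_box.
- exact: exhausted_box.
have inb x : - (L / 2) < x -> x < L / 2 -> box L x by move=> x1 x2; rewrite /box /= in_itv /= x1 x2.
have er x : - (L / 2) < x -> x < L / 2 -> complex.Re (f x) = ur x by move=> x1 x2; rewrite fU //; exact: inb.
have ei x : - (L / 2) < x -> x < L / 2 -> complex.Im (f x) = ui x by move=> x1 x2; rewrite fU //; exact: inb.
split=> [[_ []]|[]].
  move=> /(at_right_boundary l0 cr er) ? /(at_right_boundary l0 ci ei) ?.
  by move=> /(at_left_boundary l0 cr er) ? /(at_left_boundary l0 ci ei) ?.
move=> /(at_left_boundary l0 cr er) ? /(at_left_boundary l0 ci ei) ?.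
by move=> /(at_right_boundary l0 cr er) ? /(at_right_boundary l0 ci ei) ?.
Qed.

Lemma rpartTE f : rpart setT f = (fun x => complex.Re (f x)).
Proof. by apply/funext => x; exact: rpartT. Qed.

Lemma ipartTE f : ipart setT f = (fun x => complex.Im (f x)).
Proof. by apply/funext => x; exact: ipartT. Qed.

Lemma well_posed_line b z : continuous b -> quiet b -> complex.Im z != 0 ->
  well_posed setT b (fun _ _ => True) z.
Proof.
move=> cb qb z0; split=> // [g ur vr ui vi su|g].
  move=> /(L2P _ measurableT)[qgr qgi] /(L2P _ measurableT)[].
  rewrite rpartTE ipartTE /= => qur qui _.
  have := line_bound cb qb su qgr qgi qur qui.
  by rewrite /sqnorm !rpartTE !ipartTE.
move=> /(L2P _ measurableT)[qgr qgi].
have [ur [vr [ui [vi [su qur qui]]]]] := line_exists (complex.Re z) cb z0 qgr qgi.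
by exists ur, vr, ui, vi; split => //; apply/(L2P _ measurableT); rewrite rpartTE ipartTE.
Qed.

Lemma sqnorm_box (L : R) (ur ui : R -> R) : 0 < L -> continuous ur -> continuous ui ->
  sqnorm (box L) (fun x => ur x +i* ui x) =
  \int[mu]_(x in `[- (L / 2), L / 2]) (ur x ^+ 2 + ui x ^+ 2).
Proof.
move=> L0 cr ci; have lu := sqr2_locint cr ci.
rewrite /sqnorm; transitivity (\int[mu]_x (((fun x => ur x ^+ 2 + ui x ^+ 2) \_ (box L)) x)).
  apply: eq_Rintegral => x _; rewrite patchE; case: ifPn => [/set_mem Dx|/negP Dx].
    by rewrite rpart_in // ipart_in.
  have nD : ~ box L x by move=> /mem_set.
  by rewrite rpart_out // ipart_out // expr0n addr0.
rewrite Rintegral_patch Rintegral_itv_obnd_cbnd; last first.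
  by apply: integrableS (lu (- (L / 2)) (L / 2)) => //; exact: subset_itv_oo_cc.
rewrite Rintegral_itv_bndo_bndc //.
by apply: integrableS (lu (- (L / 2)) (L / 2)) => //; exact: subset_itv_co_cc.
Qed.

Lemma well_posed_box b z (L : R) : 0 < L -> continuous b -> complex.Im z != 0 ->
  well_posed (box L) b (vanishing_at L) z.
Proof.
move=> L0 cb z0; have l0 : 0 < L / 2 by lra.
have mb := measurable_box L.
split=> [ur ui ur' ui' [e1 e2 e3 e4] [e1' e2' e3' e4']|g ur vr ui vi su Lg LU [e1 e2 e3 e4]|g Lg].
- by split; rewrite ?(e1, e2, e3, e4) ?(e1', e2', e3', e4') subrr.
- have /(L2P _ mb)[qr qi] := Lg; have [cur _ cui _] := csol_continuous su.
  have iG := integrableTD qr.2 qi.2.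
  rewrite sqnorm_box //; apply: (@le_trans _ _ (\int[mu]_(x in `[- (L / 2), L / 2]) (rpart (box L) g x ^+ 2 + ipart (box L) g x ^+ 2))).
    apply: (box_bound cb _ qr.1 qi.1 su) => //; last exact: ltW.
    by move=> a c; apply: integrableS iG.
  by apply: le_Rintegral_subset => // x; rewrite addr_ge0 ?sqr_ge0.
have /(L2P _ mb)[qr qi] := Lg.
have [ur [vr [ui [vi [su [e1 e2 e3 e4]]]]]] :=
  box_exists (complex.Re z) cb z0 (sqint_is_locint qr) (sqint_is_locint qi) l0.
exists ur, vr, ui, vi; split => //.
have [cur _ cui _] := csol_continuous su.
split; first exact: continuous_cmeasurable.
rewrite l2normE; suff fin : (\int[mu]_x (rpart (box L) (fun x => (ur x +i* ui x)%C) x ^+ 2 + ipart (box L) (fun x => (ur x +i* ui x)%C) x ^+ 2)%:E < +oo)%E.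
  rewrite ltey; apply/negP => /eqP e; move: fin; case: (\int[mu]_x _)%E e => [r| |] //= .

rewrite (_ : (\int[mu]_x _)%E = (\int[mu]_(x in box L) (ur x ^+ 2 + ui x ^+ 2)%:E)%E); last first.
  rewrite [RHS]integral_mkcond; apply: eq_integral => x _; rewrite /patch; case: ifPn => [/set_mem Dx|/negP Dx].
    by rewrite rpart_in // ipart_in.
  have nD : ~ box L x by move=> /mem_set.
  by rewrite rpart_out // ipart_out // expr0n addr0.
have : mu.-integrable (box L) (EFin \o (fun x => ur x ^+ 2 + ui x ^+ 2)).
  by apply: integrableS (sqr2_locint cur cui (- (L / 2)) (L / 2)) => //; exact: subset_itv_oo_cc.
by move=> /integrable_fin_num -/(_ mb); rewrite fin_numE => /andP[_]; rewrite -ltey.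
Qed.

End Adapted.

(** * Compactly supported approximation of the resolvent *)

Section StrongResolvent.
Context {R : realType}.
Implicit Types (D : set R) (f g h u v : R -> R[i]) (b : R -> R) (z : R[i]).
Local Notation mu := (@lebesgue_measure R).

Lemma L2T (p q : R -> R) : L2 setT (fun x => p x +i* q x) <-> sqint p /\ sqint q.
Proof. by rewrite (L2P _ measurableT) rpartTE ipartTE. Qed.

Lemma sqnormT (p q : R -> R) : sqnorm setT (fun x => p x +i* q x) = \int[mu]_x (p x ^+ 2 + q x ^+ 2).
Proof. by rewrite /sqnorm rpartTE ipartTE. Qed.

Lemma Rintegral_sqintD (p q : R -> R) : sqint p -> sqint q ->
  \int[mu]_x (p x ^+ 2 + q x ^+ 2) = \int[mu]_x p x ^+ 2 + \int[mu]_x q x ^+ 2.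
Proof. by move=> [_ ip] [_ iq]; rewrite RintegralD. Qed.

Lemma ReImE (f : R -> R[i]) : f = (fun x => complex.Re (f x) +i* complex.Im (f x)).
Proof. by apply/funext => x; case: (f x). Qed.

Lemma L2_parts f : L2 setT f -> sqint (fun x => complex.Re (f x)) /\ sqint (fun x => complex.Im (f x)).
Proof. by rewrite {1}(ReImE f) => /L2T. Qed.

Lemma L2_restrict D f : measurable D -> L2 setT f -> L2 D f.
Proof.
move=> mD Lf; have [[mr ir] [mi ii]] := L2_parts Lf; apply/(L2P _ mD); split.
  apply: sqint_dom ir _.
    by apply: (measurable_restrictT (fun x => complex.Re (f x)) mD).1; exact: measurable_funTS.
  move=> x; have [Dx|Dx] := pselect (D x); first by rewrite rpart_in.
  by rewrite rpart_out // expr0n sqr_ge0.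
apply: sqint_dom ii _.
  by apply: (measurable_restrictT (fun x => complex.Im (f x)) mD).1; exact: measurable_funTS.
move=> x; have [Dx|Dx] := pselect (D x); first by rewrite ipart_in.
by rewrite ipart_out // expr0n sqr_ge0.
Qed.

Lemma sqr_add3_le (x y w : R) : (x + y + w) ^+ 2 <= 3 * (x ^+ 2 + y ^+ 2 + w ^+ 2).
Proof. have := sqr_ge0 (x - y); have := sqr_ge0 (y - w); have := sqr_ge0 (x - w); nra. Qed.

(** [W] is the cutoff of [u] and [G] is [(tau - z) W]. As [W] vanishes at the ends of every large
    box, one pair solves the resolvent equation in all of them. Each part of
    [g - G = (h - k) - z (u - W)] has three terms, whence [6 (1 + |z|^2)]. *)
Lemma cutoff_approximation b z g u (e : R) : continuous b -> quiet b -> complex.Im z != 0 -> L2 setT g ->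
  resolvent_eq setT (operator_H b) z g u -> 0 < e ->
  exists K W G, [/\ 0 < K, L2 setT W /\ L2 setT G, forall x, K <= `|x| -> W x = 0,
    forall L, 0 < L -> K <= L / 2 -> resolvent_eq (box L) (operator_HL b L) z G W &
    sqnorm setT (fun x => W x - u x) <= 2 * e /\
    sqnorm setT (fun x => g x - G x) <= 6 * (1 + (complex.Re z ^+ 2 + complex.Im z ^+ 2)) * e].
Proof.
move=> cb qb z0 Lg su e0; have ad := adapted_line b.
have /(resolvent_eqP _ _ cb ad Lg)[Lu [ur [vr [ui [vi [cs uU _]]]]]] := su.
have [cur _ cui _] := csol_continuous cs.
have LU : L2 setT (fun x => ur x +i* ui x) by apply: L2_ae uU => //; exact: continuous_cmeasurable.
have [qur qui] := (L2T _ _).1 LU; have [qgr qgi] := L2_parts Lg.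
move: cs; rewrite rpartTE ipartTE; move Er : (complex.Re z) => zr; move Ei : (complex.Im z) => zi [s1 s2].
set hr := (fun x => _) in s1; set hi := (fun x => _) in s2.
have qhr : sqint hr by apply: sqintD => //; apply: sqintB; exact: sqintZ.
have qhi : sqint hi by apply: sqintD => //; apply: sqintD; exact: sqintZ.
have [K [k1 [w1 [y1 [k2 [w2 [y2 [K0 [r1 o1 [qw1 qk1] a1 c1] [r2 o2 [qw2 qk2] a2 c2]]]]]]]]] :=
  rsol_simultaneous_cutoff cb qb s1 s2 qur qhr qui qhi e0.
pose Gr x := k1 x - (zr * w1 x - zi * w2 x); pose Gi x := k2 x - (zr * w2 x + zi * w1 x).
have qGr : sqint Gr by apply: sqintB => //; apply: sqintB; exact: sqintZ.
have qGi : sqint Gi by apply: sqintB => //; apply: sqintD; exact: sqintZ.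
have LG : L2 setT (fun x => Gr x +i* Gi x) by apply/L2T.
have LW : L2 setT (fun x => w1 x +i* w2 x) by apply/L2T.
exists K, (fun x => w1 x +i* w2 x), (fun x => Gr x +i* Gi x); split => //.
- by move=> x Kx; have [-> _ _] := o1 x Kx; have [-> _ _] := o2 x Kx.
- move=> L L0 KL.
  have LGb : L2 (box L) (fun x => Gr x +i* Gi x) by apply: L2_restrict LG; exact: measurable_box.
  have out x : ~ box L x -> K <= `|x|.
    move=> nb; apply: (le_trans KL); rewrite leNgt; apply/negP; rewrite ltr_norml => ?.
    by apply: nb; rewrite /box /= in_itv.
  apply/(resolvent_eqP _ _ cb (adapted_box b L0) LGb); split; first by apply: L2_restrict LW; exact: measurable_box.
  exists w1, y1, w2, y2; split.
  (* [G] is 0 outside the box, so its extension by 0 is [G] itself and the cutoff solves the system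
     on the whole line. *)
  + have -> : rpart (box L) (fun x => Gr x +i* Gi x) = Gr.
      apply/funext => x; have [Dx|Dx] := pselect (box L x); first by rewrite rpart_in.
      have [e1 _ e1'] := o1 x (out x Dx); have [e2 _ e2'] := o2 x (out x Dx).
      by rewrite rpart_out // /Gr e1 e1' e2; ring.
    have -> : ipart (box L) (fun x => Gr x +i* Gi x) = Gi.
      apply/funext => x; have [Dx|Dx] := pselect (box L x); first by rewrite ipart_in.
      have [e1 _ e1'] := o1 x (out x Dx); have [e2 _ e2'] := o2 x (out x Dx).
      by rewrite ipart_out // /Gi e1 e2' e2; ring.
    rewrite Er Ei; split; [apply: rsol_eq r1|apply: rsol_eq r2] => x; rewrite /Gr /Gi; ring.
  + exact: aeW.
  + have L1 : K <= `|L / 2| by rewrite ger0_norm // divr_ge0 // ltW.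
    have L2 : K <= `|- (L / 2)| by rewrite normrN.
    have [? _ _] := o1 _ L1; have [? _ _] := o1 _ L2.
    by have [? _ _] := o2 _ L1; have [? _ _] := o2 _ L2.
have qd1 := sqintB qw1 qur; have qd2 := sqintB qw2 qui.
have qc1 := sqintB qk1 qhr; have qc2 := sqintB qk2 qhi.
split.
  have WU : (fun x => (w1 x +i* w2 x) - u x) = (fun x => (w1 x - ur x) +i* (w2 x - ui x)) %[ae mu in setT].
    by apply: ae_imp uU => x ex Dx; rewrite ex.
  rewrite (sqnorm_eq measurableT _ _ WU); [|exact: L2B|exact/L2T].
  rewrite sqnormT Rintegral_sqintD //; move: a1 a2.
  by move: (Rintegral _ _ _) (Rintegral _ _ _) => p q; rewrite /reverse_coercion; lra.
have -> : (fun x => g x - (Gr x +i* Gi x)) = (fun x =>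
   ((hr x - k1 x) - zr * (ur x - w1 x) + zi * (ui x - w2 x)) +i*
   ((hi x - k2 x) - zr * (ui x - w2 x) - zi * (ur x - w1 x))).
  by apply/funext => x; rewrite /Gr /Gi /hr /hi; case: (g x) => p q /=; congr (_ +i* _); ring.
rewrite sqnormT.
pose Z := zr ^+ 2 + zi ^+ 2.
have Ic := integrableTZ 3 (integrableTD qc1.2 qc2.2).
have Id := integrableTZ (3 * Z) (integrableTD qd1.2 qd2.2).
apply: (@le_trans _ _ (\int[mu]_x (3 * ((k1 x - hr x) ^+ 2 + (k2 x - hi x) ^+ 2) +
    3 * Z * ((w1 x - ur x) ^+ 2 + (w2 x - ui x) ^+ 2)))).
  apply: le_RintegralT => [||x]; [|exact: integrableTD|]; last first.
    have := sqr_add3_le (hr x - k1 x) (- (zr * (ur x - w1 x))) (zi * (ui x - w2 x)).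
    have := sqr_add3_le (hi x - k2 x) (- (zr * (ui x - w2 x))) (- (zi * (ur x - w1 x))).
    rewrite /Z; lra.
  apply: integrableTD.
    by apply: (sqintD (sqintB (sqintB qhr qk1) (sqintZ zr (sqintB qur qw1))) (sqintZ zi (sqintB qui qw2))).2.
  by apply: (sqintB (sqintB (sqintB qhi qk2) (sqintZ zr (sqintB qui qw2))) (sqintZ zi (sqintB qur qw1))).2.
rewrite RintegralD // (RintegralZl 3) //; last exact: integrableTD qc1.2 qc2.2.
rewrite (RintegralZl (3 * Z)) //; last exact: integrableTD qd1.2 qd2.2.
rewrite !Rintegral_sqintD //.
have Z0 : 0 <= Z by rewrite addr_ge0 ?sqr_ge0.
move: a1 a2 c1 c2 Z0; rewrite -/Z; clear.
move: (Rintegral _ _ _) (Rintegral _ _ _) (Rintegral _ _ _) (Rintegral _ _ _) => p q r t; nra.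
Qed.

End StrongResolvent.

(** * Strong resolvent convergence *)

Section StrongConvergence.
Context {R : realType}.
Implicit Types (D : set R) (f g h u v : R -> R[i]) (b : R -> R) (z : R[i]).
Local Notation mu := (@lebesgue_measure R).

Lemma sqnormB_le D f g h : measurable D -> L2 D f -> L2 D g -> L2 D h ->
  sqnorm D (fun x => f x - h x) <= 2 * sqnorm D (fun x => f x - g x) + 2 * sqnorm D (fun x => g x - h x).
Proof.
move=> mD Lf Lg Lh.
have /(L2P _ mD)[a1 a2] := L2B mD Lf Lg; have /(L2P _ mD)[b1 b2] := L2B mD Lg Lh.
have /(L2P _ mD)[c1 c2] := L2B mD Lf Lh.
have Ia := integrableTZ 2 (integrableTD a1.2 a2.2); have Ib := integrableTZ 2 (integrableTD b1.2 b2.2).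
apply: (@le_trans _ _ (\int[mu]_x (2 * (rpart D (fun x => f x - g x) x ^+ 2 + ipart D (fun x => f x - g x) x ^+ 2) +
    2 * (rpart D (fun x => g x - h x) x ^+ 2 + ipart D (fun x => g x - h x) x ^+ 2)))).
  apply: le_RintegralT; [exact: integrableTD c1.2 c2.2|exact: integrableTD|move=> x].
  rewrite !rpartB !ipartB.
  have := sqr_ge0 (rpart D f x - 2 * rpart D g x + rpart D h x).
  have := sqr_ge0 (ipart D f x - 2 * ipart D g x + ipart D h x); lra.
rewrite RintegralD // (RintegralZl 2) //; last exact: integrableTD a1.2 a2.2.
by rewrite (RintegralZl 2) //; exact: integrableTD b1.2 b2.2.
Qed.

Lemma sqnorm_subset D D' f : measurable D -> measurable D' -> D `<=` D' -> L2 D' f ->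
  sqnorm D f <= sqnorm D' f.
Proof.
move=> mD mD' DD Lf; have /(L2P _ mD')[[m1 i1] [m2 i2]] := Lf.
rewrite /sqnorm (_ : (fun x => _) = (fun x => rpart D' f x ^+ 2 + ipart D' f x ^+ 2) \_ D); last first.
  apply/funext => x; rewrite patchE; case: ifPn => [/set_mem Dx|/negP Dx].
    by rewrite !rpart_in ?ipart_in //; exact: DD.
  have nD : ~ D x by move=> /mem_set.
  by rewrite rpart_out // ipart_out // expr0n addr0.
rewrite Rintegral_patch.
by apply: (@le_Rintegral_subset _ _ D setT) => //; [exact: integrableTD|move=> x; rewrite addr_ge0 ?sqr_ge0].
Qed.

Lemma patch_parts D f x : complex.Re (patch (fun=> 0) D f x) = rpart D f x /\
  complex.Im (patch (fun=> 0) D f x) = ipart D f x.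
Proof.
have [Dx|Dx] := pselect (D x); first by rewrite rpart_in // ipart_in // /patch mem_set.
by rewrite rpart_out // ipart_out // /patch memNset.
Qed.

Lemma L2_patch D f : measurable D -> L2 D f -> L2 setT (patch (fun=> 0) D f).
Proof.
move=> mD /(L2P _ mD)[qr qi]; rewrite (ReImE (patch _ _ _)); apply/L2T; split.
  by rewrite (_ : (fun x => _) = rpart D f) //; apply/funext => x; have [] := patch_parts D f x.
by rewrite (_ : (fun x => _) = ipart D f) //; apply/funext => x; have [] := patch_parts D f x.
Qed.

Lemma sqnorm_patch D f g : (forall x, ~ D x -> g x = 0) ->
  sqnorm setT (fun x => patch (fun=> 0) D f x - g x) = sqnorm D (fun x => f x - g x).
Proof.
move=> g0; apply: eq_Rintegral => x _; rewrite !rpartB !ipartB rpartT ipartT.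
have [-> ->] := patch_parts D f x.
have [Dx|Dx] := pselect (D x); first by rewrite !rpartT !ipartT !(rpart_in _ Dx) !(ipart_in _ Dx).
by rewrite rpartT ipartT g0 // !rpart_out // !ipart_out.
Qed.

Lemma resolvent_cvg b z g : continuous b -> quiet b -> complex.Im z != 0 -> L2 setT g ->
  l2norm setT (fun x => resolvent (box L) (operator_HL b L) z g x - resolvent setT (operator_H b) z g x)
    @[L --> +oo] --> 0%E.
Proof.
move=> cb qb z0 Lg; have ad := adapted_line b.
have wp := well_posed_line cb qb z0.
pose u := resolvent setT (operator_H b) z g.
have su : resolvent_eq setT (operator_H b) z g u.
  have -> : u = xget (fun=> 0) [set u | resolvent_eq setT (operator_H b) z g u].
    by apply/funext => x; rewrite /u /resolvent /patch in_setT.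
  (* The resolvent is defined by choice, so it is a solution as soon as one exists. *)
  by have [v sv] := well_posed_exists cb ad wp Lg; apply: (@xgetPex _ _ [set u | resolvent_eq _ _ z g u]); exists v.
have Lu : L2 setT u by case: su => ? [].
have z2 : 0 < complex.Im z ^+ 2 by rewrite exprn_even_gt0.
pose uL L := xget (fun=> 0) [set u | resolvent_eq (box L) (operator_HL b L) z g u].
have suL L : 0 < L -> resolvent_eq (box L) (operator_HL b L) z g (uL L).
  move=> L0; have [v sv] := well_posed_exists cb (adapted_box b L0) (well_posed_box L0 cb z0) (L2_restrict (measurable_box L) Lg).
  by apply: (@xgetPex _ _ [set u | resolvent_eq _ _ z g u]); exists v.
have LuL L : 0 < L -> L2 (box L) (uL L) by move=> /suL [? []].
have LpL L : 0 < L -> L2 setT (resolvent (box L) (operator_HL b L) z g).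
  by move=> L0; apply: L2_patch; [exact: measurable_box|exact: LuL].
pose Z := complex.Re z ^+ 2 + complex.Im z ^+ 2.
have Z0 : 0 <= Z by rewrite addr_ge0 ?sqr_ge0.
(* [sqnormB_le] doubles both contributions: the resolvent bound applied to [g - G], and [2 * e] for
   [W - u]. *)
pose C := 2 * (6 * (1 + Z) / complex.Im z ^+ 2) + 4.
have C0 : 0 < C.
  by rewrite ltr_wpDl // mulr_ge0 // divr_ge0 ?sqr_ge0 //; move: Z0; rewrite /Z; lra.
have key e : 0 < e -> \forall L \near +oo, 0 < L /\
    sqnorm setT (fun x => resolvent (box L) (operator_HL b L) z g x - u x) <= C * e.
  move=> e0; have [K [W [G [K0 [LW LG] W0 sW [dW dG]]]]] := cutoff_approximation cb qb z0 Lg su e0.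
  near=> L.
  have L0 : 0 < L by near: L; exact: nbhs_pinfty_gt.
  have KL : K <= L / 2.
    by rewrite ler_pdivlMr //; near: L; apply: nbhs_pinfty_ge; rewrite num_real.
  split => //; have mb := measurable_box L.
  have LGb := L2_restrict mb LG; have Lgb := L2_restrict mb Lg.
  apply: le_trans (sqnormB_le measurableT (LpL _ L0) LW Lu) _.
  have -> : sqnorm setT (fun x => resolvent (box L) (operator_HL b L) z g x - W x) =
      sqnorm (box L) (fun x => uL L x - W x).
    apply: sqnorm_patch => x nb; apply: W0; apply: (le_trans KL); rewrite leNgt.
    by apply/negP; rewrite ltr_norml => ?; apply: nb; rewrite /box /= in_itv.
  have H := well_posed_diff cb (adapted_box b L0) (well_posed_box L0 cb z0) Lgb LGb (suL _ L0) (sW L L0 KL).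
  have H2 : sqnorm (box L) (fun x => g x - G x) <= sqnorm setT (fun x => g x - G x).
    by apply: sqnorm_subset => //; exact: L2B.
  have H3 : sqnorm (box L) (fun x => uL L x - W x) <= 6 * (1 + Z) / complex.Im z ^+ 2 * e.
    rewrite mulrAC ler_pdivlMr // mulrC; exact: le_trans H (le_trans H2 dG).
  rewrite /C; move: H3 dW; rewrite /reverse_coercion; move: (6 * _ / _) => c; lra.
apply/fine_cvgP; split.
  near=> L; have L0 : 0 < L by near: L; exact: nbhs_pinfty_gt.
  by rewrite l2norm_sqnorm //; exact: (L2B measurableT (LpL _ L0) Lu).
apply/cvgr0Pnorm_lt => e e0.
(* [key] bounds the squared norm by [C] times its argument; this argument makes the norm at most
   [e / 2], strictly below [e]. *)
have e'0 : 0 < (e / 2) ^+ 2 / C by rewrite divr_gt0 // exprn_gt0 // divr_gt0.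
near=> L.
have [L0 H] : 0 < L /\ sqnorm setT (fun x => resolvent (box L) (operator_HL b L) z g x - u x) <= C * ((e / 2) ^+ 2 / C).
  by near: L; exact: key.
rewrite /= l2norm_sqnorm //=; last exact: (L2B measurableT (LpL _ L0) Lu).
rewrite ger0_norm ?sqrtr_ge0 //; apply: (@le_lt_trans _ _ (e / 2)); last by lra.
rewrite -(ger0_norm (ltW (divr_gt0 e0 _))) // -sqrtr_sqr ler_wsqrtr //.
by apply: (le_trans H); rewrite mulrCA divff ?gt_eqF // mulr1.
Unshelve. all: by end_near. Qed.

End StrongConvergence.

(** * Self-adjointness *)

Section Density.
Context {R : realType}.
Implicit Types (F G f g b h u v : R -> R) (a c d x N M e : R).
Local Notation mu := (@lebesgue_measure R).

Lemma dominated_small (w : nat -> R -> R) g e : (forall n, measurable_fun setT (w n)) ->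
  mu.-integrable setT (EFin \o g) -> (forall n x, 0 <= w n x) -> (forall n x, w n x <= g x) ->
  {ae mu, forall x, w n x @[n --> \oo] --> (0 : R)} -> 0 < e ->
  exists n, \int[mu]_x w n x <= e.
Proof.
move=> mw ig w0 wg w_cvg e0.
have [] := @dominated_convergence _ _ R mu setT measurableT (fun n x => (w n x)%:E) (cst 0%E) (EFin \o g).
- by move=> n; apply/measurable_EFinP; exact: mw.
- exact: measurable_cst.
- by apply: ae_imp w_cvg => x wx _; apply: cvg_EFin; [exact: nearW|exact: wx].
- exact: ig.
- by apply: aeW => x n _; rewrite /= lee_fin ger0_norm.
move=> _ _; rewrite integral_cst // mul0e => /fine_cvgP[fin /cvgr0Pnorm_le /(_ _ e0)].
move=> [n _ Hn]; exists n.
by have := Hn n (leqnn n); rewrite /= => /ler_normlW.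
Qed.

Lemma sqint_compact f M N : measurable_fun setT f -> (forall x, `|f x| <= M) ->
  (forall x, N < `|x| -> f x = 0) -> sqint f.
Proof.
move=> mf fM f0; have M0 : 0 <= M by apply: le_trans (fM 0).
apply: (@sqint_dom _ f ((fun=> M ^+ 2) \_ `[- N, N])) => //.
  by apply: integrable_patch => //; exact: locint_cst.
move=> x; rewrite patchE; case: ifPn => [_|/negP xN].
  by rewrite -real_normK ?num_real // lerXn2r ?nnegrE.
rewrite f0 ?expr0n // ltNge; apply/negP => xN'; apply: xN; apply/mem_set.
by rewrite /= in_itv /= -ler_norml.
Qed.

Lemma sqint_continuous_compact f N : continuous f -> (forall x, N < `|x| -> f x = 0) -> sqint f.
Proof.
move=> cf f0; have [M M0 fM] := continuous_bounded_itv (- N) N cf.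
apply: (@sqint_compact _ M N) => //; first exact: continuous_measurable_fun.
move=> x; have [xN|Nx] := leP `|x| N; last by rewrite f0 // normr0 ltW.
by move: xN; rewrite ler_norml => /andP[? ?]; exact: fM.
Qed.

Definition diffq d F x := d^-1 * (F (x + d) - F x).
(** The mean of [F] over [[x, x + d]] for [0 < d]. Written as a difference quotient of an
    antiderivative, it is visibly continuous and converges to [F] wherever that antiderivative has
    derivative [F]. *)
Definition steklov d F := diffq d (oint 0 F).

Lemma continuous_diffq d F : continuous F -> continuous (diffq d F).
Proof.
move=> cF x; apply: cvgMr; apply: cvgB; last exact: cF.
apply: (@continuous_comp _ _ _ (fun y => y + d) F); last exact: cF.
by apply: cvgD; [exact: cvg_id|exact: cvg_cst].
Qed.

Lemma primitive_diffq d F f : (forall x, is_derive x 1 F (f x)) -> continuous f ->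
  primitive (diffq d F) (diffq d f).
Proof.
move=> dF cf; apply: primitive_of_derive; last exact: continuous_diffq.
move=> x; rewrite /diffq.
have d1 : is_derive x 1 (fun y => F (y + d)) (f (x + d)).
  rewrite -[f _]mulr1; apply: (@is_derive1_comp _ F (fun y => y + d)) => //.
  by rewrite -[X in is_derive _ _ _ X]addr0; apply: is_deriveD.
by apply: is_deriveZ; apply: is_deriveB.
Qed.

Lemma diffq_out d F N : 0 < d -> d <= 1 -> (forall x, N < `|x| -> F x = 0) ->
  forall x, N + 1 < `|x| -> diffq d F x = 0.
Proof.
move=> d0 d1 F0 x xN; rewrite /diffq !F0 ?subrr ?mulr0 //; first by apply: lt_trans xN; rewrite ltrDl.
have := ler_normB (x + d) d; rewrite addrK (gtr0_norm d0); move: xN d1; lra.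
Qed.

Lemma steklovE d F x : 0 < d -> locint F ->
  steklov d F x = d^-1 * \int[mu]_(y in `[x, x + d]) F y.
Proof.
by move=> d0 lF; rewrite /steklov /diffq (primitive_oint 0 lF).2 // lerDl ltW.
Qed.

Lemma steklov_out d F N : 0 < d -> d <= 1 -> locint F -> (forall x, N < `|x| -> F x = 0) ->
  forall x, N + 1 < `|x| -> steklov d F x = 0.
Proof.
move=> d0 d1 lF F0 x xN; rewrite steklovE //.
rewrite (_ : \int[mu]_(y in _) F y = 0) ?mulr0 //.
transitivity (\int[mu]_(y in `[x, x + d]) (0 : R)); last by rewrite Rintegral_itv_cst ?mul0r // lerDl ltW.
apply: eq_Rintegral => y /set_mem /=; rewrite in_itv /= => /andP[xy yx]; apply: F0.
have := ler_normB y (y - x); rewrite (_ : y - (y - x) = x); last by ring.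
rewrite (ger0_norm (_ : 0 <= y - x)); [move: xN d1 yx; lra|lra].
Qed.

Lemma steklov_bound d F M x : 0 < d -> locint F -> (forall x, `|F x| <= M) -> `|steklov d F x| <= M.
Proof.
move=> d0 lF FM; rewrite steklovE // normrM gtr0_norm ?invr_gt0 // ler_pdivrMl //.
have xd : x <= x + d by rewrite lerDl ltW.
have B := Rintegral_itv_cst M xd; rewrite addrAC subrr add0r mulrC in B.
rewrite ler_norml -B; apply/andP; split.
  rewrite B -mulNr -[X in X <= _](_ : \int[mu]_(y in `[x, x + d]) (- M) = _); last first.
    by rewrite Rintegral_itv_cst // addrAC subrr add0r; ring.
  by apply: le_Rintegral_itv => // [|y _ _]; [exact: locint_cst|have := FM y; rewrite ler_norml => /andP[]].
by apply: le_Rintegral_itv => // [|y _ _]; [exact: locint_cst|have := FM y; rewrite ler_norml => /andP[]].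
Qed.

(** Lebesgue differentiation gives convergence almost everywhere along [d = 1 / (n + 1)];
    boundedness and compact support give the majorant. *)
Lemma steklov_approx F M N e : measurable_fun setT F -> locint F -> (forall x, `|F x| <= M) ->
  (forall x, N < `|x| -> F x = 0) -> 0 < e ->
  exists d, [/\ 0 < d, d <= 1 & \int[mu]_x (steklov d F x - F x) ^+ 2 <= e].
Proof.
move=> mF lF FM F0 e0; pose d n : R := n.+1%:R^-1.
have d0 n : 0 < d n by rewrite invr_gt0 ltr0n.
have d1 n : d n <= 1 by rewrite invf_le1 ?ltr0n // ler1n.
have cS n : continuous (steklov (d n) F).
  by apply: continuous_diffq; exact: primitive_continuous (primitive_oint 0 lF).
have M0 : 0 <= M by apply: le_trans (FM 0).
have [|||||n Hn] := @dominated_small (fun n x => (steklov (d n) F x - F x) ^+ 2)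
    ((fun=> (M + M) ^+ 2) \_ `[- (N + 1), N + 1]) e _ _ _ _ _ e0.
- by move=> n; apply: measurable_funX; apply: measurable_funB => //; exact: continuous_measurable_fun.
- by apply: integrable_patch => //; exact: locint_cst.
- by move=> n x; exact: sqr_ge0.
- move=> n x; rewrite patchE; case: ifPn => [_|/negP xN].
    rewrite -real_normK ?num_real // lerXn2r ?nnegrE ?addr_ge0 //.
    by apply: (le_trans (ler_normB _ _)); apply: lerD => //; exact: steklov_bound.
  have {}xN : N + 1 < `|x|.
    by rewrite ltNge; apply/negP => xN'; apply: xN; apply/mem_set; rewrite /= in_itv /= -ler_norml.
  by rewrite (steklov_out _ _ _ F0) // F0 ?subrr ?expr0n //; apply: lt_trans xN; rewrite ltrDl.
- apply: ae_imp (primitive_ae_is_derive (primitive_oint 0 lF)) => x dx.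
  have dn : d n @[n --> \oo] --> (0 : R)^'.
    move=> A /= A0; have H : \forall n \near \oo, d n != 0 -> A (d n) := cvg_harmonic A0.
    by apply: filterS H => n; apply; rewrite gt_eqF.
  have Dx : h^-1 *: ((oint 0 F \o shift x) (h *: (1 : R)) - oint 0 F x) @[h --> (0 : R)^'] --> F x.
    by rewrite -(@derive_val _ _ _ _ _ _ _ dx); exact: (@ex_derive _ _ _ _ _ _ _ dx).
  have Sx : steklov (d n) F x @[n --> \oo] --> F x.
    apply: cvg_trans (cvg_comp _ _ dn Dx); apply: near_eq_cvg; near=> n.
    rewrite /steklov /diffq /= -[d n *: _]/(d n * 1) -[_ *: _]/(_ * _) mulr1.
    by rewrite (addrC x).
  have Tx : steklov (d n) F x - F x @[n --> \oo] --> F x - F x by apply: cvgB Sx _; exact: cvg_cst.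
  have TT := cvgM Tx Tx _; rewrite subrr mulr0 in TT.
  have -> : (fun n => (steklov (d n) F x - F x) ^+ 2) =
    (fun n => (steklov (d n) F x - F x) * (steklov (d n) F x - F x)) by apply/funext => n; rewrite expr2.
  exact: TT.
by exists (d n).
Unshelve. all: by end_near. Qed.
End Density.

(** * Density of the domain *)

Section SmoothApproximation.
Context {R : realType}.
Implicit Types (F G f g b h u v : R -> R) (a c d x N M e : R).
Local Notation mu := (@lebesgue_measure R).

(* Three Steklov averages: the first makes [F] continuous, each of the others gains a derivative. *)
Lemma smooth_approx F M N e : measurable_fun setT F -> (forall x, `|F x| <= M) ->
  (forall x, N < `|x| -> F x = 0) -> 0 < e ->
  exists q q1 q2, [/\ primitive q q1 /\ primitive q1 q2, continuous q2,
    forall x, N + 3 < `|x| -> [/\ q x = 0, q1 x = 0 & q2 x = 0] &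
    \int[mu]_x (q x - F x) ^+ 2 <= e].
Proof.
(* Three approximations with squared error [e / 9] combine to [e] by [sqr_add3_le]; each enlarges
   the support by 1, hence [N + 3]. *)
move=> mF FM F0 e0; have e9 : 0 < e / 9 by rewrite divr_gt0.
have qF := sqint_compact mF FM F0.
have lF := sqint_is_locint qF.
have [d1 [d10 d11 I1]] := steklov_approx mF lF FM F0 e9.
pose G1 := steklov d1 F.
have c1 : continuous G1 by apply: continuous_diffq; exact: primitive_continuous (primitive_oint 0 lF).
have l1 := continuous_locint c1.
have b1 x : `|G1 x| <= M by exact: steklov_bound.
have o1 := steklov_out d10 d11 lF F0.
have [d2 [d20 d21 I2]] := steklov_approx (continuous_measurable_fun c1) l1 b1 o1 e9.
pose G2 := steklov d2 G1.
have p2 : forall x, is_derive x 1 (oint 0 G1) (G1 x).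
  by move=> x; apply: (primitive_is_derive (primitive_oint 0 l1)); exact: c1.
have c2 : continuous G2 by apply: continuous_diffq; exact: primitive_continuous (primitive_oint 0 l1).
have pG2 : primitive G2 (diffq d2 G1) := primitive_diffq d2 p2 c1.
have l2 := continuous_locint c2.
have b2 x : `|G2 x| <= M by exact: steklov_bound.
have o2 := steklov_out d20 d21 l1 o1.
have [d3 [d30 d31 I3]] := steklov_approx (continuous_measurable_fun c2) l2 b2 o2 e9.
pose q := steklov d3 G2.
have cq : continuous q by apply: continuous_diffq; exact: primitive_continuous (primitive_oint 0 l2).
have p3 : forall x, is_derive x 1 (oint 0 G2) (G2 x).
  by move=> x; apply: (primitive_is_derive (primitive_oint 0 l2)); exact: c2.
have cd2 : continuous (diffq d2 G1) by exact: continuous_diffq.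
have p4 : forall x, is_derive x 1 G2 (diffq d2 G1 x).
  by move=> x; apply: (primitive_is_derive pG2); exact: cd2.
have o1' x : N + 1 + 1 + 1 < `|x| -> N + 1 + 1 < `|x| by apply: lt_trans; rewrite ltrDl.
exists q, (diffq d3 G2), (diffq d3 (diffq d2 G1)); split.
- by split; [exact: primitive_diffq|exact: primitive_diffq].
- exact: continuous_diffq.
- move=> x Nx; have {}Nx : N + 1 + 1 + 1 < `|x| by rewrite (_ : N + 1 + 1 + 1 = N + 3) //; ring.
  split.
  + exact: (steklov_out d30 d31 l2 o2).
  + exact: (diffq_out d30 d31 o2).
  + exact: (diffq_out d30 d31 (diffq_out d20 d21 o1)).
have q1' := sqint_continuous_compact c1 o1; have q2' := sqint_continuous_compact c2 o2.
have qq := sqint_continuous_compact cq (steklov_out d30 d31 l2 o2).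
have i1 := (sqintB q1' qF).2; have i2 := (sqintB q2' q1').2; have i3 := (sqintB qq q2').2.
apply: (@le_trans _ _ (\int[mu]_x (3 * ((q x - G2 x) ^+ 2 + (G2 x - G1 x) ^+ 2 + (G1 x - F x) ^+ 2)))).
  apply: le_RintegralT; first exact: (sqintB qq qF).2.
    by apply: integrableTZ; apply: integrableTD i1; exact: integrableTD.
  move=> x; have := sqr_add3_le (q x - G2 x) (G2 x - G1 x) (G1 x - F x).
  by rewrite (_ : q x - G2 x + (G2 x - G1 x) + (G1 x - F x) = q x - F x) //; ring.
rewrite (RintegralZl 3) //; last by apply: integrableTD i1; exact: integrableTD.
rewrite RintegralD //; last exact: integrableTD.
rewrite RintegralD //; move: I1 I2 I3; rewrite /reverse_coercion -/G1 -/G2 -/q.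
by move: (Rintegral _ _ _) (Rintegral _ _ _) (Rintegral _ _ _) => s t r; lra.
Qed.

(** Truncation of both argument and value, with dominated convergence under the majorant
    [f ^+ 2]. *)
Lemma sqint_truncate f e : sqint f -> 0 < e -> exists F M, [/\ measurable_fun setT F,
  forall x, `|F x| <= M, forall x, M < `|x| -> F x = 0 & \int[mu]_x (F x - f x) ^+ 2 <= e].
Proof.
move=> [mf if2] e0.
pose T (n : nat) x := if (`|x| <= n%:R) && (`|f x| <= n%:R) then f x else 0.
have mT n : measurable_fun setT (T n).
  apply: measurable_fun_ifT => //; apply: measurable_and; apply: measurable_fun_ler => //;
    exact: measurableT_comp.
have [||||n Hn] := @dominated_small _ (fun n x => (T n x - f x) ^+ 2) (fun x => f x ^+ 2) e _ if2 _ _ _ e0.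
- by move=> n; apply: measurable_funX; exact: measurable_funB.
- by move=> n x; exact: sqr_ge0.
- move=> n x; rewrite /T; case: ifP => _; first by rewrite subrr expr0n sqr_ge0.
  by rewrite sub0r sqrrN.
- apply: aeW => x.
  have H : \forall n \near \oo, (T n x - f x) ^+ 2 = 0.
    near=> n; rewrite /T ifT ?subrr ?expr0n //; apply/andP; split; near: n; exact: nbhs_infty_ger.
  by apply: cvg_near_cst.
exists (T n), n%:R; split => // x.
  by rewrite /T; case: ifP => [/andP[]|_] //; rewrite normr0.
by rewrite /T ltNge => /negbTE ->.
Unshelve. all: by end_near. Qed.

Lemma sqint_contM (c f : R -> R) N : continuous c -> sqint f -> (forall x, N < `|x| -> f x = 0) ->
  sqint (fun x => c x * f x).
Proof.
move=> cc [mf if2] f0; have [C C0 cC] := continuous_bounded_itv (- N) N cc.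
apply: sqint_dom (integrableTZ (C ^+ 2) if2) _.
  by apply: measurable_funM => //; exact: continuous_measurable_fun.
move=> x; have [xN|Nx] := leP `|x| N; last by rewrite f0 // mulr0 expr0n mulr0.
rewrite exprMn ler_wpM2r ?sqr_ge0 // -(real_normK (num_real (c x))) lerXn2r ?nnegrE ?(ltW C0) //.
by move: xN; rewrite ler_norml => /andP[? ?]; exact: cC.
Qed.

(* [u = exp (int b) * q] with [q] of class [C^2] has quasi-derivative [exp (int b) * q']. *)
Lemma rsol_dense b f e : continuous b -> sqint f -> 0 < e ->
  exists h u v, [/\ rsol b h u v, sqint u, sqint h & \int[mu]_x (u x - f x) ^+ 2 <= e].
Proof.
move=> cb qf e0; have e4 : 0 < e / 4 by rewrite divr_gt0.
have [F [M [mF FM F0 IF]]] := sqint_truncate qf e4.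
have pb := primitive_oint 0 (continuous_locint cb); pose B := oint 0 b.
have dB x : is_derive x 1 B (b x) by apply: (primitive_is_derive pb); exact: cb.
have cB : continuous B := primitive_continuous pb.
pose E x := expR (B x); pose E' x := expR (- B x).
have cE : continuous E by move=> x; apply: (continuous_comp (cB x)); exact: continuous_expR.
have cE' : continuous E'.
  by move=> x; apply: (@continuous_comp _ _ _ (fun y => - B y) (@expR R)); [apply: cvgN; exact: cB|exact: continuous_expR].
have cEb : continuous (fun x => b x * E x) by move=> x; apply: cvgM; [exact: cb|exact: cE].
have pE : primitive E (fun x => b x * E x).
  apply: primitive_of_derive => // x; rewrite mulrC.
  exact: (@is_derive1_comp _ (@expR R) B).
have [C C0 EC] := continuous_bounded_itv (- (M + 3)) (M + 3) cE.
have qF := sqint_compact mF FM F0.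
(* [q] is to approximate [F / E], so that [E q] approximates [F]; the squared error grows by at most
   [C ^+ 2], a bound of [E ^+ 2] on the supports. *)
pose H x := E' x * F x.
have H0 x : M < `|x| -> H x = 0 by move=> Mx; rewrite /H F0 // mulr0.
have mH : measurable_fun setT H by apply: measurable_funM => //; exact: continuous_measurable_fun.
have [C' C'0 EC'] := continuous_bounded_itv (- M) M cE'.
have M0 : 0 <= M by apply: le_trans (FM 0).
have HM x : `|H x| <= C' * M.
  have [xM|Mx] := leP `|x| M; last by rewrite H0 // normr0 mulr_ge0 // ltW.
  by rewrite /H normrM ler_pM //; move: xM; rewrite ler_norml => /andP[? ?]; exact: EC'.
have e4C : 0 < e / 4 / C ^+ 2 by rewrite divr_gt0 // exprn_gt0.
have [q [q1 [q2 [[pq pq1] cq2 q0 Iq]]]] := smooth_approx mH HM H0 e4C.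
have cq := primitive_continuous pq; have cq1 := primitive_continuous pq1.
have oq x : M + 3 < `|x| -> q x = 0 by move=> /q0[].
have oq1 x : M + 3 < `|x| -> q1 x = 0 by move=> /q0[].
have oq2 x : M + 3 < `|x| -> q2 x = 0 by move=> /q0[].
have qq := sqint_continuous_compact cq oq; have qq1 := sqint_continuous_compact cq1 oq1.
have qq2 := sqint_continuous_compact cq2 oq2.
have qu := sqint_contM cE qq oq.
(* This is [- v' - b u'] for [u = E q] and [v = E q1]. *)
pose h x := - (b x * (b x * E x)) * q x - 2 * (b x * E x) * q1 x - E x * q2 x.
exists h, (fun x => E x * q x), (fun x => E x * q1 x).
have qh : sqint h.
  apply: sqintB; [apply: sqintB|exact: sqint_contM oq2].
    by apply: sqint_contM oq => // x; apply: cvgN; apply: cvgM; [exact: cb|exact: cEb].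
  by apply: sqint_contM oq1 => // x; apply: cvgMr; exact: cEb.
split => //.
  split.
    by apply: primitive_eq (primitiveM pE pq) => x; ring.
  by apply: primitive_eq (primitiveM pE pq1) => x; rewrite /h; ring.
have qd : sqint (fun x => E x * q x - F x) by exact: sqintB.
have S : \int[mu]_x (E x * q x - F x) ^+ 2 <= e / 4.
  have qH := sqint_compact mH HM H0.
  apply: (@le_trans _ _ (\int[mu]_x (C ^+ 2 * (q x - H x) ^+ 2))).
    apply: le_RintegralT; [exact: qd.2|exact: integrableTZ (sqintB qq qH).2|move=> x].
    have [xM|Mx] := leP `|x| (M + 3); last first.
      have Mx' : M < `|x| by apply: lt_trans Mx; rewrite ltrDl.
      by rewrite oq // F0 // mulr0 subrr expr0n mulr_ge0 ?sqr_ge0.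
    have -> : E x * q x - F x = E x * (q x - H x).
      by rewrite /H mulrBr mulrA -expRD subrr expR0 mul1r.
    rewrite exprMn ler_wpM2r ?sqr_ge0 // -(real_normK (num_real (E x))) lerXn2r ?nnegrE ?(ltW C0) //.
    by move: xM; rewrite ler_norml => /andP[? ?]; exact: EC.
  rewrite (RintegralZl (C ^+ 2)) //; last exact: (sqintB qq qH).2.
  by rewrite mulrC -ler_pdivlMr // exprn_gt0.
have i1 := qd.2; have i2 := (sqintB qF qf).2.
apply: (@le_trans _ _ (\int[mu]_x (2 * ((E x * q x - F x) ^+ 2 + (F x - f x) ^+ 2)))).
  apply: le_RintegralT; first exact: (sqintB qu qf).2.
    by apply: integrableTZ; exact: integrableTD.
  by move=> x; have := sqr_ge0 (E x * q x - 2 * F x + f x); lra.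
rewrite (RintegralZl 2) //; last exact: integrableTD.
rewrite RintegralD //; move: S IF; rewrite /reverse_coercion.
by move: (Rintegral _ _ _) (Rintegral _ _ _) => s t; lra.
Qed.

End SmoothApproximation.

(** * Symmetry and the adjoint *)

Section SelfAdjoint.
Context {R : realType}.
Implicit Types (D : set R) (f g h k u v : R -> R[i]) (b : R -> R) (z : R[i]).
Local Notation mu := (@lebesgue_measure R).
Local Notation re f := (fun x => complex.Re (f x)).
Local Notation im f := (fun x => complex.Im (f x)).

Lemma eq_sqint (p q : R -> R) : p =1 q -> sqint p -> sqint q.
Proof. by move=> /funext ->. Qed.

(** A pair in the graph solves the resolvent equation at [z = 0], so the translation into systems
    applies. *)
Lemma operator_HP b f k : continuous b -> operator_H b f k ->
  exists ur vr ui vi, [/\ rsol b (re k) ur vr /\ rsol b (im k) ui vi,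
    sqint ur /\ sqint ui, {ae mu, forall x, re f x = ur x} & {ae mu, forall x, im f x = ui x}].
Proof.
move=> cb Hfk; have [Lf Lk _] := Hfk.
have : resolvent_eq setT (operator_H b) 0 k f.
  by exists k => //; apply: aeW => x _; rewrite mul0r subr0.
move=> /(resolvent_eqP _ _ cb (adapted_line b) Lk)[_ [ur [vr [ui [vi [su fU _]]]]]].
have [cur _ cui _] := csol_continuous su; have [s1 s2] := su.
have LU : L2 setT (fun x => ur x +i* ui x) by apply: L2_ae fU => //; exact: continuous_cmeasurable.
rewrite rpartTE ipartTE /= in s1 s2.
exists ur, vr, ui, vi; split.
- by split; [apply: rsol_eq s1|apply: rsol_eq s2] => x; rewrite !mul0r ?subr0 ?addr0 ?addr0.
- exact/L2T.
- by apply: ae_imp fU => x e; rewrite e.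
- by apply: ae_imp fU => x e; rewrite e.
Qed.

Lemma Rintegral_mul_ae (p p' q : R -> R) : sqint p -> sqint p' -> sqint q ->
  {ae mu, forall x, p x = p' x} -> \int[mu]_x (p x * q x) = \int[mu]_x (p' x * q x).
Proof.
move=> [mp _] [mp' _] [mq _] e; apply: Rintegral_ae_eq => //; [exact: measurable_funM|exact: measurable_funM|].
by apply: ae_imp e => x ->.
Qed.

Lemma innerE f g : L2 setT f -> L2 setT g -> inner setT f g =
  (\int[mu]_x (re f x * re g x) + \int[mu]_x (im f x * im g x)) +i*
  (\int[mu]_x (im f x * re g x) - \int[mu]_x (re f x * im g x)).
Proof.
move=> /L2_parts[qfr qfi] /L2_parts[qgr qgi]; rewrite /inner; congr (_ +i* _).
  rewrite -RintegralD //; [|exact: sqint_mul|exact: sqint_mul].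
  by apply: eq_Rintegral => x _; case: (f x) (g x) => p q [p' q'] /=; ring.
rewrite -RintegralB //; [|exact: sqint_mul|exact: sqint_mul].
by apply: eq_Rintegral => x _; case: (f x) (g x) => p q [p' q'] /=; ring.
Qed.

Lemma operator_H_symmetric b f k g h : continuous b -> quiet b ->
  operator_H b f k -> operator_H b g h -> inner setT k g = inner setT f h.
Proof.
move=> cb qb Hf Hg; have [Lf Lk _] := Hf; have [Lg Lh _] := Hg.
have [ur [vr [ui [vi [[s1 s2] [q1 q2] e1 e2]]]]] := operator_HP cb Hf.
have [ur' [vr' [ui' [vi' [[s1' s2'] [q1' q2'] e1' e2']]]]] := operator_HP cb Hg.
have [qfr qfi] := L2_parts Lf; have [qkr qki] := L2_parts Lk.
have [qgr qgi] := L2_parts Lg; have [qhr qhi] := L2_parts Lh.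
have sym (k1 u1 v1 f1 h1 w1 y1 g1 : R -> R) : rsol b k1 u1 v1 -> rsol b h1 w1 y1 ->
    sqint k1 -> sqint u1 -> sqint f1 -> sqint h1 -> sqint w1 -> sqint g1 ->
    {ae mu, forall x, f1 x = u1 x} -> {ae mu, forall x, g1 x = w1 x} ->
    \int[mu]_x (k1 x * g1 x) = \int[mu]_x (f1 x * h1 x).
  move=> r1 r2 qk qu qf qh qw qg ef eg.
  rewrite (Rintegral_mul_ae qf qu qh ef) -(rsol_symmetric cb qb r1 r2 qu qk qw qh).
  transitivity (\int[mu]_x (g1 x * k1 x)); first by apply: eq_Rintegral => x _; rewrite mulrC.
  by rewrite (Rintegral_mul_ae qg qw qk eg); apply: eq_Rintegral => x _; rewrite mulrC.
rewrite !innerE //.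
rewrite (sym _ _ _ (re f) _ _ _ (re g) s1 s1') //.
rewrite (sym _ _ _ (im f) _ _ _ (im g) s2 s2') //.
rewrite (sym _ _ _ (im f) _ _ _ (re g) s2 s1') //.
by rewrite (sym _ _ _ (re f) _ _ _ (im g) s1 s2').
Qed.

Lemma operator_H_dense b : continuous b -> densely_defined setT (operator_H b).
Proof.
move=> cb f Lf e e0; have [qfr qfi] := L2_parts Lf.
have e8 : 0 < e ^+ 2 / 8 by rewrite divr_gt0 // exprn_gt0.
have [h1 [u1 [v1 [r1 q1 k1 I1]]]] := rsol_dense cb qfr e8.
have [h2 [u2 [v2 [r2 q2 k2 I2]]]] := rsol_dense cb qfi e8.
have LU : L2 setT (fun x => u1 x +i* u2 x) by exact/L2T.
have LH : L2 setT (fun x => h1 x +i* h2 x) by exact/L2T.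
have : resolvent_eq setT (operator_H b) 0 (fun x => h1 x +i* h2 x) (fun x => u1 x +i* u2 x).
  apply/(resolvent_eqP _ _ cb (adapted_line b) LH); split => //.
  exists u1, v1, u2, v2; split => //; last exact: aeW.
  by rewrite rpartTE ipartTE; split; [apply: rsol_eq r1|apply: rsol_eq r2] => x /=;
    rewrite !mul0r ?subr0 ?addr0.
move=> [k Hk _]; exists (fun x => u1 x +i* u2 x), k; split => //.
rewrite l2norm_sqnorm //; last exact: L2B.
rewrite lte_fin (ReImE (fun x => _ - _)) sqnormT.
apply: (@le_lt_trans _ _ (e / 2)); last by move: e0; lra.
rewrite -(ger0_norm (_ : 0 <= e / 2)) -?sqrtr_sqr; last by rewrite divr_ge0 // ltW.
apply: ler_wsqrtr.
have -> : (fun x => complex.Re (f x - (u1 x +i* u2 x)) ^+ 2 + complex.Im (f x - (u1 x +i* u2 x)) ^+ 2) =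
    (fun x => (u1 x - re f x) ^+ 2 + (u2 x - im f x) ^+ 2).
  by apply/funext => x; case: (f x) => p q /=; ring.
rewrite Rintegral_sqintD; [|exact: sqintB|exact: sqintB].
move: I1 I2; rewrite /reverse_coercion.
by move: (Rintegral _ _ _) (Rintegral _ _ _) => s t; lra.
Qed.

(* [w] solves [(H - i) w = h - i g] and [f] solves [(H + i) f = g - w]; testing the adjoint
   relation against [f] gives [|g - w|^2 = 0]. *)
Lemma adjoint_operator_H b g h : continuous b -> quiet b -> adjoint setT (operator_H b) g h ->
  operator_H b g h.
Proof.
move=> cb qb [Lg Lh adj]; have ad := adapted_line b.
have iN0 : complex.Im ('i : R[i]) != 0 by rewrite /= oner_neq0.
have iN0' : complex.Im (- 'i : R[i]) != 0 by rewrite /= oppr_eq0 oner_neq0.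
have Lhg : L2 setT (fun x => h x - 'i * g x).
  have [qgr qgi] := L2_parts Lg; have [qhr qhi] := L2_parts Lh.
  rewrite (ReImE (fun x => _ - _)) L2T; split.
    by apply: (@eq_sqint (fun x => re h x + im g x)); [|exact: sqintD];
      move=> x; case: (h x) (g x) => p q [p' q'] /=; ring.
  by apply: (@eq_sqint (fun x => im h x - re g x)); [|exact: sqintB];
    move=> x; case: (h x) (g x) => p q [p' q'] /=; ring.
have [w [m Hm em]] := well_posed_exists cb ad (well_posed_line cb qb iN0) Lhg.
have [Lw Lm _] := Hm; have Lp := L2B measurableT Lg Lw.
have [f [k Hk ek]] := well_posed_exists cb ad (well_posed_line cb qb iN0') Lp.
have [Lf Lk _] := Hk.
have A1 := adj _ _ Hk; have A2 := operator_H_symmetric cb qb Hk Hm.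
have [qfr qfi] := L2_parts Lf; have [qkr qki] := L2_parts Lk.
have [qgr qgi] := L2_parts Lg; have [qhr qhi] := L2_parts Lh.
have [qwr qwi] := L2_parts Lw; have [qmr qmi] := L2_parts Lm.
move: A1 A2; rewrite !innerE // => -[A1 _] [A2 _].
have gw : g = w %[ae mu in setT].
  suff S : sqnorm setT (fun x => g x - w x) <= 0.
    have := sqnorm_eq0 measurableT Lp S.
    by apply: ae_imp => x e Dx; apply/eqP; rewrite -subr_eq0 e.
  pose X x := ((re k x * re g x + im k x * im g x) - (re f x * re h x + im f x * im h x)) -
    ((re k x * re w x + im k x * im w x) - (re f x * re m x + im f x * im m x)).
  pose S1 x := re k x * re g x + im k x * im g x; pose S2 x := re f x * re h x + im f x * im h x.
  pose S3 x := re k x * re w x + im k x * im w x; pose S4 x := re f x * re m x + im f x * im m x.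
  have I1 : mu.-integrable setT (EFin \o S1) by apply: integrableTD; exact: sqint_mul.
  have I2 : mu.-integrable setT (EFin \o S2) by apply: integrableTD; exact: sqint_mul.
  have I3 : mu.-integrable setT (EFin \o S3) by apply: integrableTD; exact: sqint_mul.
  have I4 : mu.-integrable setT (EFin \o S4) by apply: integrableTD; exact: sqint_mul.
  have mI (s : R -> R) : mu.-integrable setT (EFin \o s) -> measurable_fun setT s.
    by move=> /measurable_int/measurable_EFinP.
  have [qpr qpi] := L2_parts Lp.
  (* The equations [k + i f = g - w] and [m - i w = h - i g] express [|g - w|^2] pointwise by the
     integrands in the real parts of the two inner product identities. *)
  have -> : sqnorm setT (fun x => g x - w x) = \int[mu]_x ((S1 x + S4 x) - (S2 x + S3 x)).
    rewrite /sqnorm rpartTE ipartTE; apply: Rintegral_ae_eq => //.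
    - by apply: measurable_funD; apply: measurable_funX; [exact: qpr.1|exact: qpi.1].
    - by apply: measurable_funB; apply: measurable_funD; exact: mI.
    apply: (ae_imp2 _ ek em) => x /(_ I) e1 /(_ I) e2 _; move: e1 e2; rewrite /S1 /S2 /S3 /S4.
    case: (k x) (g x) (w x) (h x) => kr ki [gr gi] [wr wi] [hr hi].
    case: (m x) (f x) => mr mi [fr fi] /= [e1 e2] [e3 e4].
    have -> : kr = gr - wr + fi by move: e1; lra.
    have -> : ki = gi - wi - fr by move: e2; lra.
    have -> : hr = mr + wi - gi by move: e3; lra.
    have -> : hi = mi - wr + gr by move: e4; lra.
    by rewrite /=; ring.
  rewrite RintegralB //; [|exact: integrableTD|exact: integrableTD].
  rewrite (RintegralD measurableT I1 I4) (RintegralD measurableT I2 I3).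
  have E1 : \int[mu]_x S1 x = \int[mu]_x S2 x.
    rewrite /S1 /S2 RintegralD //; [|exact: sqint_mul|exact: sqint_mul].
    by rewrite A1 RintegralD //; exact: sqint_mul.
  have E2 : \int[mu]_x S3 x = \int[mu]_x S4 x.
    rewrite /S3 /S4 RintegralD //; [|exact: sqint_mul|exact: sqint_mul].
    by rewrite A2 RintegralD //; exact: sqint_mul.
  by rewrite E1 E2 subrr.
(* With [w = g] almost everywhere, the equation for [w] gives [m = h]. *)
apply: (tau_operator_ae Hm Lg Lh); first exact: ae_eq_sym.
apply: (ae_imp2 _ em gw) => x e1 e2 Dx; have := e1 Dx; rewrite -e2 //.
by move/addIr.
Qed.

Lemma operator_H_self_adjoint b : continuous b -> quiet b -> self_adjoint setT (operator_H b).
Proof.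
move=> cb qb; split; first exact: operator_H_dense.
move=> g h; split; last exact: adjoint_operator_H.
move=> Hg; have [Lg Lh _] := Hg; split => // f k Hk.
exact: operator_H_symmetric Hk Hg.
Qed.
End SelfAdjoint.

(** * Brownian paths *)

Section Riemann.
Context {R : realType}.
Local Notation mu := (@lebesgue_measure R).

Lemma limn_einf_ge (w : nat -> \bar R) (c : \bar R) N : (forall n, (N <= n)%N -> (c <= w n)%E) ->
  (c <= limn_einf w)%E.
Proof.
move=> H; rewrite limn_einf_lim; apply: lime_ge; first exact: is_cvg_einfs.
near=> n; rewrite /einfs /=; apply: le_ereal_inf_tmp => _ [k /= nk <-]; apply: H.
by apply: leq_trans nk; near: n; exact: nbhs_infty_ge.
Unshelve. all: by end_near. Qed.

Lemma limn_einf_le (w : nat -> \bar R) (c : \bar R) : (forall n, (w n <= c)%E) -> (limn_einf w <= c)%E.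
Proof.
move=> H; rewrite limn_einf_lim; apply: lime_le; first exact: is_cvg_einfs.
apply: nearW => n; apply: le_trans (H n); apply: ereal_inf_lbound; exists n => //=.
Qed.

Lemma limn_einf_frequently (w : nat -> \bar R) (c : \bar R) : (limn_einf w < c)%E ->
  forall N, exists2 n, (N <= n)%N & (w n < c)%E.
Proof.
move=> H N; apply: contrapT => no; move: H; apply/negP; rewrite -leNgt.
apply: (@limn_einf_ge _ _ N) => n Nn; rewrite leNgt; apply/negP => wn; apply: no; by exists n.
Qed.

Lemma measurable_limn_einf d (T : measurableType d) (f : nat -> T -> \bar R) :
  (forall n, measurable_fun setT (f n)) -> measurable_fun setT (fun x => limn_einf (f^~ x)).
Proof.
move=> mf; rewrite /limn_einf; apply: measurableT_comp => //.
by apply: (@measurable_fun_limn_esup _ _ _ _ (fun n x => - f n x)%E) => n; exact: measurableT_comp.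
Qed.

Lemma heine (g : R -> R) (a c e : R) : continuous g -> 0 < e ->
  exists2 dl, 0 < dl & forall x y, a <= x <= c -> `|x - y| < dl -> `|g x - g y| < e.
Proof.
move=> cg e0; have e2 : 0 < e / 2 by rewrite divr_gt0.
have /compact_near_coveringP K := @segment_compact R a c.
have := @K R (0^'+) (fun dl x => forall y, `|x - y| < dl -> `|g x - g y| < e) _ _.
case=> [x _|r /= r0 Hr].
  have /cvgr_dist_lt/(_ _ e2)/nbhs_ballP[r /= r0 Hr] := cg x.
  have r2 : 0 < r / 2 by rewrite divr_gt0.
  exists (ball x (r / 2), [set dl | dl < r / 2]).
    by split; [exact: nbhsx_ballx|exact: nbhs_right_lt].
  move=> [x' dl] /= [xx' dr] y yx'.
  have h1 : `|g x - g x'| < e / 2 by apply: Hr; rewrite /ball /= in xx' *; move: xx'; lra.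
  have h2 : `|g x - g y| < e / 2.
    apply: Hr; rewrite /ball /=; rewrite (_ : x - y = (x - x') + (x' - y)); last by ring.
    apply: le_lt_trans (ler_normD _ _) _; move: xx' yx' dr; rewrite /ball /=; lra.
  rewrite (_ : g x' - g y = - (g x - g x') + (g x - g y)); last by ring.
  by apply: le_lt_trans (ler_normD _ _) _; rewrite normrN; move: h1 h2; lra.
exists (r / 2); first by rewrite divr_gt0.
move=> x y xac; apply: (Hr (r / 2)) => //=.
- by rewrite sub0r normrN gtr0_norm ?divr_gt0 // gtr_pMr // invf_lt1 // ltr1n.
- by rewrite divr_gt0.
Qed.

(** An upper bound by left Riemann sums suffices: each sum is a random variable whose expectation is
    estimated term by term. *)
Lemma riemann_le (g : R -> R) (p e : R) : continuous g -> 0 < e -> exists N : nat, forall k, (N <= k)%N ->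
  \int[mu]_(x in `[p, p + 1]) g x <=
    k.+1%:R^-1 * (\sum_(j < k.+1) g (p + j%:R * k.+1%:R^-1)) + e.
Proof.
move=> cg e0; have lg := continuous_locint cg.
have [dl dl0 H] := heine p (p + 1) cg e0.
have [N HN] : exists N : nat, dl^-1 < N%:R.
  by exists (Num.trunc dl^-1).+1; exact: truncnS_gt.
exists N => k Nk; set h := k.+1%:R^-1.
have h0 : 0 < h by rewrite invr_gt0 ltr0n.
have hdl : h < dl.
  rewrite /h -[dl]invrK ltf_pV2 ?posrE ?invr_gt0 ?ltr0n //.
  by apply: (lt_le_trans HN); rewrite ler_nat; exact: leq_trans (leqnSn k).
have kh : k.+1%:R * h = 1 by rewrite divff // pnatr_eq0.
have step m : (m <= k.+1)%N -> \int[mu]_(x in `[p, p + m%:R * h]) g x <=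
    h * (\sum_(j < m) g (p + j%:R * h)) + m%:R * h * e.
  elim: m => [_|m IH mk].
    rewrite big_ord0 mulr0 !mul0r addr0 addr0 -[X in _ <= X](_ : \int[mu]_(x in `[p, p]) (0 : R) = 0); last first.
      by rewrite Rintegral_itv_cst // mul0r.
    by rewrite set_itv1 !Rintegral_set1.
  have m0 : 0 <= m%:R * h by rewrite mulr_ge0 // ltW.
  have mS : m.+1%:R * h = m%:R * h + h by rewrite -natr1 mulrDl mul1r.
  rewrite (@Rintegral_itv_cat _ g p (p + m%:R * h)) //; last 2 first.
  - by rewrite lerDl.
  - by rewrite mS; move: h0; lra.
  rewrite big_ord_recr /= mulrDr.
  have B : \int[mu]_(x in `[p + m%:R * h, p + m.+1%:R * h]) g x <= h * g (p + m%:R * h) + h * e.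
    have xx : p + m%:R * h <= p + m.+1%:R * h by rewrite mS; move: h0; lra.
    rewrite (_ : h * g _ + h * e = \int[mu]_(x in `[p + m%:R * h, p + m.+1%:R * h]) (g (p + m%:R * h) + e)); last first.
      by rewrite Rintegral_itv_cst // mS; ring.
    apply: le_Rintegral_itv => // [|x x1 x2]; first exact: locint_cst.
    have m1 : m%:R * h <= 1 by rewrite -[X in _ <= X]kh ler_pM2r // ler_nat ltnW.
    have xin : p <= p + m%:R * h <= p + 1 by rewrite lerDl m0 lerD2l.
    have := H (p + m%:R * h) x xin.
    rewrite ler0_norm; last by move: x1; lra.
    move=> /(_ _) G; have {}G : `|g (p + m%:R * h) - g x| < e by apply: G; move: x2 hdl; rewrite mS; lra.
    by move: G; rewrite ltr_norml; lra.
  apply: (le_trans (lerD (IH (ltnW mk)) B)); rewrite mS; lra.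
by have := step k.+1 (leqnn _); rewrite kh mul1r.
Qed.

End Riemann.

(** * Expected oscillation over unit intervals *)

Section Probability.
Context {R : realType} {d : measure_display} {Omega : measurableType d} (P : probability Omega R).
Implicit Types (B : R -> {RV P >-> R}) (xi : (R -> R) -> {RV P >-> R}).
Local Notation mu := (@lebesgue_measure R).

(* Fatou's lemma twice: over Riemann sums of the square increments, then over [n]. *)
Lemma frequently_quiet B (p : nat -> R) :
  (forall n t, p n <= t -> t <= p n + 1 -> (\int[P]_w ((B t w - B (p n) w) ^+ 2)%:E <= 1)%E) ->
  {ae P, forall w, continuous (fun t => B t w : R) -> exists M : R, forall N, exists2 n, (N <= n)%N &
    \int[mu]_(x in `[p n, p n + 1]) (B x w - B (p n) w) ^+ 2 <= M}.
Proof.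
move=> HB.
pose S n k w := (k.+1%:R^-1 * (\sum_(j < k.+1) (B (p n + j%:R * k.+1%:R^-1) w - B (p n) w) ^+ 2))%:E.
pose Z n w := limn_einf ((S n)^~ w).
have sq_meas s t : measurable_fun setT (fun w => (B s w - B t w) ^+ 2).
  by apply: measurable_funX; apply: measurable_funB.
have mS n k : measurable_fun setT (S n k).
  by apply/measurable_EFinP; apply: measurable_funM => //; apply: measurable_sum => j; exact: sq_meas.
have S0 n k w : (0 <= S n k w)%E.
  by rewrite lee_fin mulr_ge0 ?invr_ge0 ?ler0n // sumr_ge0 // => j _; exact: sqr_ge0.
have ES n k : (\int[P]_w S n k w <= 1)%E.
  under eq_integral do rewrite /S EFinM -sumEFin.
  have m1 (j : 'I_k.+1) : measurable_fun setT (fun w => ((B (p n + j%:R / k.+1%:R) w - B (p n) w) ^+ 2)%:E).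
    by apply/measurable_EFinP; exact: sq_meas.
  have p1 (j : 'I_k.+1) w : (0 <= ((B (p n + j%:R / k.+1%:R) w - B (p n) w) ^+ 2)%:E)%E.
    by rewrite lee_fin sqr_ge0.
  rewrite (@ge0_integralZl_EFin _ _ _ P setT measurableT _ _ _ (k.+1%:R^-1)); last 3 first.
  - by move=> w _; apply: sume_ge0 => j _; exact: p1.
  - by apply: emeasurable_sum => j; exact: m1.
  - by rewrite invr_ge0 ler0n.
  rewrite ge0_integral_sum //.
  apply: (@le_trans _ _ (k.+1%:R^-1%:E * \sum_(j < k.+1) 1)%E).
    rewrite lee_pmul2l ?lte_fin ?invr_gt0 ?ltr0n //; apply: lee_sum => j _; apply: HB.
      by rewrite lerDl mulr_ge0 ?invr_ge0 ?ler0n.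
    by rewrite lerD2l ler_pdivrMr ?ltr0n // mul1r ler_nat ltnW.
  by rewrite sumEFin sumr_const card_ord -EFinM mulVf ?pnatr_eq0.
have mZ n : measurable_fun setT (Z n) by exact: measurable_limn_einf.
have Z0 n w : (0 <= Z n w)%E by apply: (@limn_einf_ge _ _ _ 0%N) => k _; exact: S0.
have EZ n : (\int[P]_w Z n w <= 1)%E.
  by apply: le_trans (fatou P measurableT (mS n) (fun k w _ => S0 n k w)) _; exact: limn_einf_le.
pose Y w := limn_einf (Z ^~ w).
have mY : measurable_fun setT Y by exact: measurable_limn_einf.
have Y0 w : (0 <= Y w)%E by apply: (@limn_einf_ge _ _ _ 0%N) => k _; exact: Z0.
have EY : (\int[P]_w Y w <= 1)%E.
  by apply: le_trans (fatou P measurableT mZ (fun n w _ => Z0 n w)) _; exact: limn_einf_le.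
have iY : P.-integrable setT Y.
  apply/integrableP; split => //; under eq_integral do rewrite gee0_abs //.
  by apply: le_lt_trans EY _; rewrite ltry.
have := integrable_ae measurableT iY.
apply: (filterS (F := almost_everywhere P)) => w /(_ I) Yw cB.
(* Values of [Z] below [Y + 1] recur beyond every [N]; the second 1 is the error of the Riemann
   sum. *)
exists (fine (Y w) + 1 + 1) => N.
have YM : (Y w < (fine (Y w) + 1)%:E)%E by rewrite -[X in (X < _)%E](fineK Yw) lte_fin ltrDl.
have [n Nn Zn] := limn_einf_frequently YM N; exists n => //.
have cg : continuous (fun x => (B x w - B (p n) w) ^+ 2).
  have -> : (fun x => (B x w - B (p n) w) ^+ 2) = (fun x => (B x w - B (p n) w) * (B x w - B (p n) w)).
    by apply/funext => x; rewrite expr2.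
  move=> x; have cB1 : B y w - B (p n) w @[y --> x] --> B x w - B (p n) w.
    by apply: cvgB; [exact: cB|exact: cvg_cst].
  exact: cvgM.
have [K HK] := riemann_le (p n) cg (ltr01 : 0 < 1 :> R).
have [k Kk Sk] := limn_einf_frequently Zn K.
apply: (le_trans (HK k Kk)); rewrite lerD2r; move: Sk; rewrite /S lte_fin; exact: ltW.
Qed.

(** The noise is centered, so its covariances are second moments and the square can be expanded; the
    product is integrable because both squares are. *)
Lemma white_noise_increment xi f g (a m c : R) : white_noise xi ->
  f \in Lfun mu 2%:E -> g \in Lfun mu 2%:E ->
  (\int[mu]_x (f x * f x)%:E = a%:E)%E -> (\int[mu]_x (f x * g x)%:E = m%:E)%E ->
  (\int[mu]_x (g x * g x)%:E = c%:E)%E ->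
  (\int[P]_w ((xi f w - xi g w) ^+ 2)%:E = (a - 2 * m + c)%:E)%E.
Proof.
move=> [_ E0 cov] Lf Lg If Ifg Ig.
have covE h k : h \in Lfun mu 2%:E -> k \in Lfun mu 2%:E ->
    (\int[P]_w (xi h w * xi k w)%:E = \int[mu]_x (h x * k x)%:E)%E.
  move=> Lh Lk; rewrite -cov // covariance.unlock !E0 //= expectation.unlock.
  by apply: eq_integral => w _; rewrite -[in LHS](subr0 (xi h w)) -[in LHS](subr0 (xi k w)).
have mxi h : measurable_fun setT (xi h) by [].
have sqi h (s : R) : h \in Lfun mu 2%:E -> (\int[mu]_x (h x * h x)%:E = s%:E)%E ->
    P.-integrable setT (EFin \o (fun w => xi h w ^+ 2)).
  move=> Lh Ih; apply/integrableP; split; first by apply/measurable_EFinP; exact: measurable_funX.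
  under eq_integral do rewrite /= ger0_norm ?sqr_ge0 // expr2.
  by rewrite covE // Ih ltry.
have ff := sqi f a Lf If; have gg := sqi g c Lg Ig.
have fg : P.-integrable setT (EFin \o (fun w => xi f w * xi g w)).
  have fg2 : P.-integrable setT (EFin \o (fun w => xi f w ^+ 2 + xi g w ^+ 2)).
    exact: (integrableD measurableT ff gg).
  apply: le_integrable fg2 => //.
    by apply/measurable_EFinP; exact: measurable_funM.
  move=> w _; rewrite /= lee_fin [leRHS]ger0_norm ?addr_ge0 ?sqr_ge0 //.
  move: (xi f w) (xi g w) => r s; rewrite ler_norml; apply/andP; split.
    by have := sqr_ge0 (r + s); have := sqr_ge0 r; have := sqr_ge0 s; lra.
  by have := sqr_ge0 (r - s); have := sqr_ge0 r; have := sqr_ge0 s; lra.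
transitivity (\int[P]_w ((xi f w ^+ 2)%R%:E + ((- 2)%R%:E * (xi f w * xi g w)%R%:E + (xi g w ^+ 2)%R%:E)))%E.
  by apply: eq_integral => w _; rewrite -EFinM -!EFinD; congr EFin; ring.
have fg2 : P.-integrable setT (fun w => ((- 2)%R%:E * (xi f w * xi g w)%R%:E)%E) by exact: integrableZl.
rewrite integralD //; last exact: integrableD.
rewrite integralD // integralZl //.
have sqE h : (\int[P]_w (xi h w ^+ 2)%:E = \int[P]_w (xi h w * xi h w)%:E)%E.
  by apply: eq_integral => w _; rewrite expr2.
rewrite !sqE !covE // If Ifg Ig -EFinM -!EFinD; congr EFin; ring.
Qed.

End Probability.

Section BrownianQuiet.
Context {R : realType} {d : measure_display} {Omega : measurableType d} (P : probability Omega R).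
Implicit Types (B : R -> {RV P >-> R}) (xi : (R -> R) -> {RV P >-> R}).
Local Notation mu := (@lebesgue_measure R).

Lemma indic_integral (a c a' c' : R) : a' <= a -> a <= c -> c <= c' ->
  (\int[mu]_x ((\1_`[a, c] x : R) * (\1_`[a', c'] x : R))%:E = (c - a)%:E)%E.
Proof.
move=> aa ac cc; transitivity (\int[mu]_x (\1_(`[a, c] : set R) x)%:E)%E.
  apply: eq_integral => x _; congr EFin; rewrite !indicE.
  case: (boolP (x \in _)) => [/set_mem /=|_]; last by rewrite mul0r.
  rewrite in_itv /= => /andP[ax xc]; rewrite mem_set ?mulr1 //= in_itv /=.
  by rewrite (le_trans aa ax) (le_trans xc cc).
rewrite integral_indic // setIT; transitivity (mu `[a, c]%classic); first by [].
rewrite lebesgue_measure_itv /= lte_fin.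
by move: ac; rewrite le_eqVlt => /predU1P[->|->]; rewrite ?ltxx ?subrr // EFinB.
Qed.

Lemma indic_Lfun (a c : R) : (\1_`[a, c] : R -> R) \in Lfun mu 2%:E.
Proof.
rewrite inE; apply/andP; split; first by rewrite inE /=; exact: measurable_indic.
rewrite inE /= /finite_norm unlock; apply: poweR_lty.
have [ac|ca] := leP a c.
  rewrite (_ : (\int[mu]_x _ = (c - a)%:E)%E) ?ltry //.
  rewrite -(indic_integral (lexx a) ac (lexx c)); apply: eq_integral => x _ /=.
  by rewrite powR_mulrn ?normr_ge0 // real_normK ?num_real // expr2.
rewrite (_ : (\int[mu]_x _ = 0)%E) ?ltry // integral0_eq // => x _ /=.
rewrite indicE memNset ?normr0 ?powR0 ?pnatr_eq0 //= in_itv /= => /andP[ax xc].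
by move: ca; rewrite ltNge (le_trans ax xc).
Qed.

Lemma ae_increment (X Y X' Y' : {RV P >-> R}) : {ae P, forall w, X w = X' w} ->
  {ae P, forall w, Y w = Y' w} ->
  (\int[P]_w ((X w - Y w) ^+ 2)%:E = \int[P]_w ((X' w - Y' w) ^+ 2)%:E)%E.
Proof.
move=> eX eY; apply: ae_eq_integral => //.
- by apply/measurable_EFinP; apply: measurable_funX; exact: measurable_funB.
- by apply/measurable_EFinP; apply: measurable_funX; exact: measurable_funB.
by apply: (filterS2 (F := almost_everywhere P) _ _ eX eY) => w -> -> _.
Qed.

(** On one side of 0 both values are pairings with nested intervals, so all inner products are
    lengths. *)
Lemma brownian_increment xi B (s t : R) : white_noise xi -> associated_brownian_motion xi B ->
  s <= t -> 0 <= s \/ t < 0 -> (\int[P]_w ((B t w - B s w) ^+ 2)%:E = (t - s)%:E)%E.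
Proof.
move=> wn [Bp Bn _] st [s0|t0].
  rewrite (ae_increment (Bp t (le_trans s0 st)) (Bp s s0)).
  rewrite (white_noise_increment wn (indic_Lfun _ _) (indic_Lfun _ _) (a := t - 0) (m := s - 0) (c := s - 0)).
  - by congr EFin; ring.
  - by apply: indic_integral => //; exact: le_trans st.
  - by under eq_integral do rewrite mulrC; exact: indic_integral.
  - exact: indic_integral.
have s0 := le_lt_trans st t0.
transitivity (\int[P]_w ((xi \1_`[s, 0] w - xi \1_`[t, 0] w) ^+ 2)%:E)%E.
  apply: ae_eq_integral => //.
  - by apply/measurable_EFinP; apply: measurable_funX; exact: measurable_funB.
  - by apply/measurable_EFinP; apply: measurable_funX; exact: measurable_funB.
  apply: (filterS2 (F := almost_everywhere P) _ _ (Bn t t0) (Bn s s0)) => w -> -> _.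
  by congr EFin; ring.
rewrite (white_noise_increment wn (indic_Lfun _ _) (indic_Lfun _ _) (a := 0 - s) (m := 0 - t) (c := 0 - t)).
- by congr EFin; ring.
- by apply: indic_integral => //; exact: ltW.
- by under eq_integral do rewrite mulrC; apply: indic_integral => //; exact: ltW.
- by apply: indic_integral => //; exact: ltW.
Qed.

Lemma brownian_quiet xi B : white_noise xi -> associated_brownian_motion xi B ->
  {ae P, forall w, continuous (fun t => B t w : R) -> quiet (fun t => B t w)}.
Proof.
move=> wn bm.
(* The intervals are [[n + 1, n + 2]] on the right and [[- (n + 2), - (n + 1)]] on the left, so that
   none of them meets 0. *)
have H1 := @frequently_quiet _ _ _ P B (fun n => n.+1%:R) _.
have H2 := @frequently_quiet _ _ _ P B (fun n => - n.+2%:R) _.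
apply: (filterS2 (F := almost_everywhere P) _ _ (H1 _) (H2 _)) => [w h1 h2 cB|n t nt tn|n t nt tn].
- have [M1 {}h1] := h1 cB; have [M2 {}h2] := h2 cB.
  exists (1 + `|M1| + `|M2|); first by rewrite -addrA lerDl addr_ge0.
  move=> N; have NN := truncnS_gt N; split.
    have [n Nn I1] := h1 (Num.trunc N).
    exists n.+1%:R, (B n.+1%:R w); split.
      by apply: (le_trans (ltW NN)); rewrite ler_nat ltnS.
    apply: (le_trans I1); apply: (le_trans (ler_norm _)).
    by rewrite -addrA addrCA lerDl addr_ge0.
  have [n Nn I2] := h2 (Num.trunc N).
  exists (- n.+2%:R), (B (- n.+2%:R) w); split.
    rewrite lerNr opprD opprK -(natr1 n.+1) addrK; apply: (le_trans (ltW NN)).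
    by rewrite ler_nat ltnS.
  apply: (le_trans I2); apply: (le_trans (ler_norm _)).
  by rewrite lerDr addr_ge0.
- rewrite (brownian_increment wn bm) //; last by left.
  by rewrite lee_fin lerBlDl.
- rewrite (brownian_increment wn bm) //; first by rewrite lee_fin lerBlDl.
  right; apply: (le_lt_trans tn); rewrite -(natr1 n.+1) opprD addrNK oppr_lt0 ltr0n //.
Qed.

End BrownianQuiet.

Theorem theorem2 (R : realType) (d : measure_display) (Omega : measurableType d)
    (P : probability Omega R)
    (xi : (R -> R) -> {RV P >-> R}) (B : R -> {RV P >-> R})
    (hxi : white_noise xi) (hB : associated_brownian_motion xi B) :
  {ae P, forall w : Omega,
    let b := fun t : R => B t w in
    self_adjoint setT (operator_H b) /\
    (forall z : R[i], z \isn't Num.real ->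
      [/\ in_resolvent_set setT (operator_H b) z,
          (forall L : R, 0 < L ->
            in_resolvent_set (box L) (operator_HL b L) z) &
          (forall g : R -> R[i], L2 setT g ->
            l2norm setT (fun x => resolvent (box L) (operator_HL b L) z g x
                                  - resolvent setT (operator_H b) z g x)
              @[L --> +oo] --> 0%E)])}.
Proof.
have [_ _ cB] := hB.
(* The whole probabilistic input is path continuity and [quiet]; from here on the path is fixed. *)
apply: (filterS2 (F := almost_everywhere P) _ _ cB (brownian_quiet hxi hB)) => w [_ cb] Hq.
pose b := fun t : R => B t w.
have qb : quiet b := Hq cb.
split; first exact: operator_H_self_adjoint.
move=> z /Im_neq0 z0; split.
- exact: well_posed_resolvent_set (adapted_line b) (well_posed_line cb qb z0) z0.
- by move=> L L0; exact: well_posed_resolvent_set (adapted_box b L0) (well_posed_box L0 cb z0) z0.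
- by move=> g Lg; exact: resolvent_cvg.
Qed.
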